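(* Let $N\ge2$ and let $A$ and $V$ satisfy the assumptions listed in the context. Then the set $D=\{\tau_y:\ y\in\mathbb{Z}^N\}$ is a set of dislocations on $H^1_{A,V}(\mathbb{R}^N)$.
   Context: Functions are complex-valued unless specified; spaces are regarded as real vector spaces. $(Q_j)_{j\in\mathbb{N}}$ is an enumeration of the open unit cubes $y+(0,1)^N$, $y\in\mathbb{Z}^N$. Assumptions. $A:\mathbb{R}^N\to\mathbb{R}^N$: if $N\ge3$, $A\in L^N_{\mathrm{loc}}$, $\sup_j\|A\|_{L^N(Q_j)}<\infty$, and $A\in L^{N+\varepsilon}_{\mathrm{loc}}$ for some $\varepsilon>0$; if $N=2$, for some $\varepsilon>0$, $A\in L^{2+\varepsilon}_{\mathrm{loc}}$ and $\sup_j\|A\|_{L^{2+\varepsilon}(Q_j)}<\infty$; and the matrix of distributions $\operatorname{curl}A=(\partial_iA_k-\partial_kA_i)_{i,k}$ is $\mathbb{Z}^N$-periodic. $V\in L^1_{\mathrm{loc}}(\mathbb{R}^N;\mathbb{R})$ is $\mathbb{Z}^N$-periodic with $\operatorname{ess\,inf}V>0$. $H^1_{A,V}(\mathbb{R}^N)=\{u\in L^2(\mathbb{R}^N):\ Vu^2\in L^1,\ \nabla_Au:=(\nabla+\mathrm{i}A)u\in L^2\}$ with the real scalar product $\langle u,v\rangle=\mathrm{Re}\int Vu\overline v\,dx+\mathrm{Re}\int\nabla_Au\cdot\overline{\nabla_Av}\,dx$; it is a separable Hilbert space. For $y\in\mathbb{Z}^N$ let $\psi_y\in W^{1,N+\varepsilon}_{\mathrm{loc}}(\mathbb{R}^N;\mathbb{R})$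 be the unique continuous function with $\psi_y(0)=0$ and $A(x+y)=A(x)+\nabla\psi_y(x)$ for a.e. $x$; put $\varphi_y=\psi_y-\frac12\psi_y(-y)$ and define $\tau_y:H^1_{A,V}(\mathbb{R}^N)\to H^1_{A,V}(\mathbb{R}^N)$ by $\tau_yu=e^{\mathrm{i}\varphi_y}u(\cdot+y)$. Set of dislocations (Tintarev–Fieseler): for operators $T_k$ on a Hilbert space $H$, write $T_k\rightharpoonup0$ if $T_ku\rightharpoonup0$ weakly for every $u\in H$. A set $D$ of bounded linear operators on a separable infinite-dimensional Hilbert space $H$ is a set of dislocations if (i) $0<\inf_{T\in D,\|u\|=1}\|Tu\|\le\sup_{T\in D,\|u\|=1}\|Tu\|<\infty$, and (ii) whenever $(S_k),(T_k)\subset D$ with $S_k^\star T_k\not\rightharpoonup0$ and $(u_k)\subset H$ with $u_k\rightharpoonup0$, there is a subsequence along which $S_k^\star T_ku_k\rightharpoonup0$. *)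

(* Defs.v *)
From HB Require Import structures.
From mathcomp Require Import all_boot all_order all_algebra.
From mathcomp Require Import generic_quotient ring_quotient.
From mathcomp Require Import all_classical all_reals all_analysis.
From mathcomp Require Import measurable_realfun ess_sup_inf.
From mathcomp Require Import complex ring.

Set Implicit Arguments.
Unset Strict Implicit.
Unset Printing Implicit Defensive.

Import Order.TTheory GRing.Theory Num.Theory.
Import numFieldNormedType.Exports.

Local Open Scope classical_set_scope.
Local Open Scope ring_scope.
Local Open Scope quotient_scope.

(* Matrices, hence row vectors, carry the sigma-algebra generated by the
   entries; on 'rV[R]_n it coincides with the Borel sigma-algebra. *)
Section matrix_measurable.
Context {R : realType} (m n : nat).
Let G : set (set 'M[R]_(m, n)) :=
  \bigcup_(ij : 'I_m * 'I_n)
    preimage_set_system setT (fun M : 'M[R]_(m, n) => M ij.1 ij.2) measurable.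
Definition matrix_measurable : set (set 'M[R]_(m, n)) := <<s G>>.
Let mm0 : matrix_measurable set0. Proof. exact: sigma_algebra0. Qed.
Let mmC A : matrix_measurable A -> matrix_measurable (~` A).
Proof. exact: sigma_algebraC. Qed.
Let mmU (F : _^nat) : (forall i, matrix_measurable (F i)) ->
  matrix_measurable (\bigcup_i F i).
Proof. exact: sigma_algebra_bigcup. Qed.
HB.instance Definition _ := @isMeasurable.Build default_measure_display
  'M[R]_(m, n) matrix_measurable mm0 mmC mmU.

Lemma measurable_entry i j :
  measurable_fun setT (fun M : 'M[R]_(m, n) => M i j).
Proof.
by move=> _ Y mY; apply: sub_sigma_algebra; exists (i, j) => //; exists Y.
Qed.

Lemma measurable_matrixP d (T : measurableType d) (f : T -> 'M[R]_(m, n)) :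
  (forall i j, measurable_fun setT (fun t => f t i j)) -> measurable_fun setT f.
Proof.
move=> mf _ Y mY; rewrite setTI.
suff: matrix_measurable `<=` image_set_system setT f measurable.
  by move=> /(_ _ mY); rewrite /image_set_system /= setTI.
apply: smallest_sub; first exact/sigma_algebra_image/sigma_algebra_measurable.
move=> A [[i j] _ [B mB <-]]; rewrite /image_set_system /= !setTI.
by rewrite -[X in measurable X]setTI; exact: mf.
Qed.
End matrix_measurable.

Section lebesgue_rV.
Context {R : realType}.

Definition cons_rV n (p : measurableTypeR R * 'rV[R]_n) : 'rV[R]_n.+1 :=
  row_mx (scalar_mx p.1 : 'M[R]_1) p.2.

Let uncons_rV n (v : 'rV[R]_n.+1) : measurableTypeR R * 'rV[R]_n :=
  (v 0 0, rsubmx (v : 'rV_(1 + n))).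

Lemma measurable_cons_rV n : measurable_fun setT (@cons_rV n).
Proof.
apply: measurable_matrixP => i j; rewrite /cons_rV.
under eq_fun do rewrite mxE.
case: (splitP (j : 'I_(1 + n))) => k _.
  under eq_fun do rewrite mxE ord1 (ord1 k) eqxx mulr1n.
  exact: measurable_fst.
exact: (measurableT_comp (measurable_entry i k) measurable_snd).
Qed.

Let measurable_uncons_rV n : measurable_fun setT (@uncons_rV n).
Proof.
apply: measurable_fun_pair; first exact: measurable_entry.
apply: measurable_matrixP => i j; under eq_fun do rewrite mxE.
exact: measurable_entry.
Qed.

Let cons_rVK n : cancel (@cons_rV n) (@uncons_rV n).
Proof.
move=> [a v]; rewrite /uncons_rV /cons_rV row_mxKr; congr (_, _).
transitivity (row_mx (scalar_mx a : 'M[R]_1) v 0 (lshift n 0)).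
  by congr (fun_of_matrix _ _ _); exact: val_inj.
by rewrite row_mxEl mxE eqxx mulr1n.
Qed.

HB.instance Definition _ n :=
  isMeasurableFun.Build _ _ _ _ (@cons_rV n) (@measurable_cons_rV n).

Section step.
Variables (n : nat) (mu : {sigma_finite_measure set 'rV[R]_n -> \bar R}).
(* The product of the one-dimensional Lebesgue measure with a measure on
   'rV[R]_n, transported to 'rV[R]_n.+1. *)
Definition lebesgue_step : set 'rV[R]_n.+1 -> \bar R :=
  pushforward (@lebesgue_measure R \x mu)%E (@cons_rV n).

Let lebesgue_step0 : lebesgue_step set0 = 0%E.
Proof. exact: measure0. Qed.

Let lebesgue_step_ge0 A : (0 <= lebesgue_step A)%E.
Proof. exact: measure_ge0. Qed.

Let lebesgue_step_sigma_additive : semi_sigma_additive lebesgue_step.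
Proof. exact: measure_semi_sigma_additive. Qed.

HB.instance Definition _ := isMeasure.Build _ _ _ lebesgue_step
  lebesgue_step0 lebesgue_step_ge0 lebesgue_step_sigma_additive.

Let lebesgue_step_sigma_finite : sigma_finite setT lebesgue_step.
Proof.
have /sigma_finiteP[F [TF ndF Foo]] := sigma_finiteT (@lebesgue_measure R).
have /sigma_finiteP[G [TG ndG Goo]] := sigma_finiteT mu.
exists (fun k => @uncons_rV n @^-1` (F k `*` G k)).
  rewrite -preimage_bigcup; apply/esym/seteqP; split => // v _.
  have [k _ Fk] : (\bigcup_i F i) (uncons_rV v).1 by rewrite -TF.
  have [l _ Gl] : (\bigcup_i G i) (uncons_rV v).2 by rewrite -TG.
  exists (maxn k l) => //; split.
    exact: (subsetPset _ _ (ndF _ _ (leq_maxl k l))).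
  exact: (subsetPset _ _ (ndG _ _ (leq_maxr k l))).
move=> k; have [mF Fkoo] := Foo k; have [mG Gkoo] := Goo k; split.
  rewrite -[X in measurable X]setTI; apply: measurable_uncons_rV => //.
  exact: measurableX.
rewrite /lebesgue_step /pushforward -comp_preimage.
rewrite (_ : _ \o _ = id); last by apply/funext => p /=; rewrite cons_rVK.
by rewrite preimage_id product_measure1E// lte_mul_pinfty// ge0_fin_numE.
Qed.

HB.instance Definition _ := Measure_isSigmaFinite.Build _ _ _ lebesgue_step
  lebesgue_step_sigma_finite.
End step.

Fixpoint lebesgue_rV n : {sigma_finite_measure set 'rV[R]_n -> \bar R} :=
  match n with
  | 0 => \d_(0 : 'rV[R]_0)
  | n'.+1 => lebesgue_step (lebesgue_rV n')
  end.
End lebesgue_rV.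

Section function_spaces.
Context {R : realType} {N : nat}.
Local Notation E := 'rV[R]_N.
Local Notation mu := (@lebesgue_rV R N).
Local Notation C := (Rcomplex R).

(* The library norm on 'rV[R]_N is the sup norm. *)
Definition euclidean_norm (v : E) : R := Num.sqrt (\sum_i v 0 i ^+ 2).

Definition lattice (y : 'rV[int]_N) : E := map_mx intr y.

Definition unit_cube (y : 'rV[int]_N) : set E :=
  [set x | forall i, (y 0 i)%:~R < x 0 i < (y 0 i)%:~R + 1].

(* Elements of Lfun are Borel functions: functions defined up to equality
   almost everywhere are represented by Borel representatives. *)
Definition Lp_loc (p : R) (f : E -> R) : Prop :=
  forall K : set E, compact K -> f \_ K \in Lfun mu p%:E.

Definition Lp_loc_field (p : R) (F : E -> E) : Prop :=
  forall i, Lp_loc p (fun x => F x 0 i).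

Definition bounded_on_cubes (p : R) (F : E -> E) : Prop :=
  (ereal_sup [set 'N[mu]_p%:E[EFin \o ((euclidean_norm \o F) \_ (unit_cube y))]
             | y in [set: 'rV[int]_N]] < +oo)%E.

Definition partial (i : 'I_N) (f : E -> R) : E -> R :=
  fun x => 'D_(delta_mx 0 i) f x.

Fixpoint Ck (k : nat) (f : E -> R) : Prop :=
  continuous f /\
  if k is k'.+1 then
    forall i, (forall x, derivable f x (delta_mx 0 i)) /\ Ck k' (partial i f)
  else True.

(* Real-valued C_c^oo functions. *)
Definition test_function (eta : E -> R) : Prop :=
  (forall k, Ck k eta) /\ compact (closure [set x | eta x != 0]).

Definition weak_partial (i : 'I_N) (f g : E -> R) : Prop :=
  [/\ Lp_loc 1 f, Lp_loc 1 g & forall eta, test_function eta ->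
    \int[mu]_x (f x * partial i eta x) = - \int[mu]_x (g x * eta x)].

Definition W1p_loc (p : R) (f : E -> R) : Prop :=
  Lp_loc p f /\ forall i, exists2 g, weak_partial i f g & Lp_loc p g.

(* < d_i F_k - d_k F_i , eta > in the sense of distributions. *)
Definition curl (F : E -> E) (i k : 'I_N) (eta : E -> R) : R :=
  - \int[mu]_x (F x 0 k * partial i eta x - F x 0 i * partial k eta x).

Definition periodic_curl (F : E -> E) : Prop :=
  forall i k (y : 'rV[int]_N) eta, test_function eta ->
    curl F i k (fun x => eta (x - lattice y)) = curl F i k eta.

Definition vector_potential (eps : R) (A : E -> E) : Prop :=
  [/\ (3 <= N)%N ->
        [/\ Lp_loc_field N%:R A, bounded_on_cubes N%:R A
          & Lp_loc_field (N%:R + eps) A],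
      N = 2%N ->
        Lp_loc_field (2 + eps) A /\ bounded_on_cubes (2 + eps) A
    & periodic_curl A].

Definition scalar_potential (V : E -> R) : Prop :=
  [/\ Lp_loc 1 V,
      forall y : 'rV[int]_N, {ae mu, forall x, V (x + lattice y) = V x}
    & (0 < ess_inf mu (EFin \o V))%E].

Definition gauge_function (eps : R) (A : E -> E) (y : 'rV[int]_N)
    (psi : E -> R) : Prop :=
  [/\ continuous psi, W1p_loc (N%:R + eps) psi, psi 0 = 0
    & exists2 g : E -> E,
        forall i, weak_partial i psi (fun x => g x 0 i)
      & {ae mu, forall x, A (x + lattice y) = A x + g x}].

Definition L2 (u : E -> C) : Prop :=
  (fun x => complex.Re (u x)) \in Lfun mu 2%:E /\
  (fun x => complex.Im (u x)) \in Lfun mu 2%:E.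

Definition cintegral (f : E -> C) : C :=
  Complex (\int[mu]_x complex.Re (f x)) (\int[mu]_x complex.Im (f x)).

Definition weak_cpartial (i : 'I_N) (u g : E -> C) : Prop :=
  weak_partial i (fun x => complex.Re (u x)) (fun x => complex.Re (g x)) /\
  weak_partial i (fun x => complex.Im (u x)) (fun x => complex.Im (g x)).

(* g = (grad + iA) u, that is, the distributional gradient of u is g - iAu. *)
Definition magnetic_gradient (A : E -> E) (u : E -> C) (g : E -> 'rV[C]_N) :=
  forall i, weak_cpartial i u
    (fun x => g x 0 i - 'i%C * (A x 0 i)%:C%C * u x).

Definition mem_H1 (A : E -> E) (V : E -> R) (u : E -> C) : Prop :=
  [/\ L2 u,
      mu.-integrable setT (fun x => (V x * `|u x| ^+ 2)%:E)
    & exists2 g, magnetic_gradient A u g & forall i, L2 (fun x => g x 0 i)].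
End function_spaces.

Section closure.
Context {R : realType} {N : nat}.
Local Notation E := 'rV[R]_N.
Local Notation mu := (@lebesgue_rV R N).
Local Notation C := (Rcomplex R).

Lemma measurable_rV_ball (x : E) (r : R) : measurable (ball x r).
Proof.
have [r0|r0] := ltP 0 r; last first.
  rewrite (_ : ball x r = set0) //; apply/seteqP; split => // y [/lt_le_trans].
  by move=> /(_ _ r0); rewrite ltxx.
rewrite (_ : ball x r = \bigcap_(i in [set: 'I_N])
    ((fun y : E => y 0 i) @^-1` ball (x 0 i) r)).
  apply: fin_bigcap_measurable => // i _.
  rewrite -[X in measurable X]setTI; apply: measurable_entry => //.
  exact: measurable_ball.
apply/seteqP; split=> [y [_ xy] i _|y xy]; first exact: xy.
by split => // i j; rewrite !ord1; exact: xy.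
Qed.

Lemma open_measurable_rV (U : set E) : open U -> measurable U.
Proof.
move=> oU.
pose B (qk : 'rV[rat]_N * nat) : set E :=
  ball (map_mx ratr qk.1 : E) (qk.2.+1%:R^-1).
rewrite (_ : U = \bigcup_(qk : 'rV[rat]_N * nat)
    [set x | B qk x /\ B qk `<=` U]).
  apply: countable_bigcupT_measurable => // qk.
  have [BU|BU] := pselect (B qk `<=` U).
    rewrite (_ : [set _ | _] = B qk); first exact: measurable_rV_ball.
    by apply/seteqP; split=> [x []|].
  by rewrite (_ : [set _ | _] = set0)//; apply/seteqP; split=> [x []|].
apply/seteqP; split=> [x Ux|x [qk _ [Bx]]]; last exact.
have /nbhs_ballP[e /= e0 eU] : nbhs x U by exact: open_nbhs_nbhs.
have [k _ ke] : exists2 k : nat, True & k.+1%:R^-1 < e / 2.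
  have [k k0] := ltr_add_invr (divr_gt0 e0 (ltr0Sn R 1)).
  by exists k => //; rewrite add0r in k0.
have k0 : (0 : R) < k.+1%:R^-1 by rewrite invr_gt0.
have /choice[q xq] : forall i, exists q : rat,
    ball (x 0 i) (k.+1%:R^-1 : R) (ratr q).
  move=> i; have [q] := rat_in_itvoo (ltr_pwDr k0 (lexx (x 0 i))).
  rewrite in_itv/= => /andP[xq qk]; exists q.
  by rewrite /ball/= ltr_distlC (lt_trans _ xq) ?gtrBl.
have Bx : B (\row_i q i, k) x.
  by split => //= i j; rewrite !mxE (ord1 i); exact/ball_sym/xq.
exists (\row_i q i, k) => //; split=> // y By; apply: eU.
apply: (@le_ball _ _ _ (k.+1%:R^-1 + k.+1%:R^-1)).
  by rewrite [e]splitr lerD// ltW.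
exact: ball_triangle (ball_sym Bx) By.
Qed.

Lemma continuous_measurable_rV (h : E -> R) :
  continuous h -> measurable_fun setT h.
Proof.
move=> /continuousP ch.
apply: (measurability _ (measurable_realfun.RGenOpens.measurableE R)).
move=> _ [_ [a [b ->] <-]]; rewrite setTI.
by apply: open_measurable_rV; apply: ch; exact: interval_open.
Qed.

Lemma integrable_mul_compact_support (K : set E) (f h : E -> R) :
  compact K -> Lp_loc 1 f -> continuous h -> (forall x, ~ K x -> h x = 0) ->
  mu.-integrable setT (EFin \o (fun x => f x * h x)).
Proof.
move=> cK fK ch hK.
have /Lfun1_integrable ifK := fK _ cK.
have cnh : {within K, continuous h} by exact: continuous_subspaceT.
have [M [Mr hM]] := compact_bounded (continuous_compact cnh cK).
have M1 : M < `|M| + 1 by rewrite ltr_pwDr// ler_norm.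
pose c := `|M| + 1.
have c0 : 0 <= c by rewrite addr_ge0.
have hc x : K x -> `|h x| <= c by move=> Kx; apply: (hM _ M1); exists x.
have fhE x : f x * h x = (f \_ K) x * h x.
  rewrite patchE; case: ifPn => //; rewrite notin_setE => /hK ->.
  by rewrite !mulr0.
have mfK : measurable_fun setT (f \_ K).
  by apply/measurable_EFinP; case/integrableP: ifK.
apply: (@le_integrable _ _ _ mu setT measurableT _
  (fun x => c%:E * (EFin \o (f \_ K)) x)%E).
- apply/measurable_EFinP; under eq_fun do rewrite fhE.
  by apply: measurable_funM => //; exact: continuous_measurable_rV.
- move=> x _ /=; rewrite lee_fin fhE !normrM mulrC (ger0_norm c0).
  have [Kx|Kx] := pselect (K x); first by rewrite ler_wpM2r// hc.
  by rewrite hK// normr0 mul0r mulr_ge0.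
- exact: integrableZl.
Qed.

Section test_functions.
Variables (eta : E -> R) (teta : test_function eta).
Let K := closure [set x | eta x != 0].

Let eta_out x : ~ K x -> eta x = 0.
Proof.
by move=> Kx; apply/eqP/negP => /negP ex; apply: Kx; exact: subset_closure.
Qed.

Let partial_out i x : ~ K x -> partial i eta x = 0.
Proof.
move=> Kx; rewrite /partial (@near_eq_derive _ _ _ _ (cst 0)) ?derive_cst//.
have oK : open (~` K) by rewrite openC; exact: closed_closure.
have : nbhs x (~` K) by exact: open_nbhs_nbhs.
by apply: filterS => y /eta_out.
Qed.

Lemma integrable_mul_test f : Lp_loc 1 f ->
  mu.-integrable setT (EFin \o (fun x => f x * eta x)).
Proof.
move=> lf; apply: (integrable_mul_compact_support teta.2) => //.
by have [] := teta.1 0%N.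
Qed.

Lemma integrable_mul_partial_test i f : Lp_loc 1 f ->
  mu.-integrable setT (EFin \o (fun x => f x * partial i eta x)).
Proof.
move=> lf; apply: (integrable_mul_compact_support teta.2) => //.
  by have [_ /(_ i)[_ []]] := teta.1 1%N.
exact: partial_out.
Qed.
End test_functions.

Lemma Lp_loc_lincomb (p a : R) (f g : E -> R) : 1 <= p ->
  Lp_loc p f -> Lp_loc p g -> Lp_loc p (fun x => a * f x + g x).
Proof.
move=> p1 lf lg K cK.
have [_ lin] := @Lfun_submod_closed _ _ _ mu p%:E p1.
rewrite (_ : _ \_ K = a *: (f \_ K) + (g \_ K)); first exact: lin (lf _ cK) (lg _ cK).
apply/funext => x; rewrite [RHS](_ : _ = a * (f \_ K) x + (g \_ K) x)//.
by rewrite !patchE; case: ifPn => // _; rewrite mulr0 addr0.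
Qed.

Lemma weak_partial_lincomb i (a : R) (f1 f2 g1 g2 : E -> R) :
  weak_partial i f1 g1 -> weak_partial i f2 g2 ->
  weak_partial i (fun x => a * f1 x + f2 x) (fun x => a * g1 x + g2 x).
Proof.
move=> [lf1 lg1 fg1] [lf2 lg2 fg2]; split; [exact: Lp_loc_lincomb..|].
move=> eta teta.
have lin h (F G : E -> R) :
    mu.-integrable setT (EFin \o (fun x => F x * h x)) ->
    mu.-integrable setT (EFin \o (fun x => G x * h x)) ->
    \int[mu]_x ((a * F x + G x) * h x) =
    a * \int[mu]_x (F x * h x) + \int[mu]_x (G x * h x).
  move=> iF iG; rewrite -RintegralZl// -RintegralD//; last exact: (integrableZl _ a iF).
  by apply: eq_Rintegral => x _; rewrite mulrDl mulrA.
rewrite !lin; try by [exact: integrable_mul_test|exact: integrable_mul_partial_test].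
by rewrite fg1// fg2// mulrN opprD.
Qed.

Let le12 : (1%:E <= 2%:E :> \bar R)%E. Proof. by rewrite lee_fin ler1n. Qed.

Let ReD (a : R) (z w : C) :
  complex.Re (a *: z + w) = a * complex.Re z + complex.Re w.
Proof. by case: z w => [? ?] [? ?]. Qed.

Let ImD (a : R) (z w : C) :
  complex.Im (a *: z + w) = a * complex.Im z + complex.Im w.
Proof. by case: z w => [? ?] [? ?]. Qed.

Lemma L2_lincomb (a : R) (u v : E -> C) : L2 u -> L2 v -> L2 (a *: u + v).
Proof.
have [_ lin] := @Lfun_submod_closed _ _ _ mu 2%:E le12.
move=> [ur ui] [vr vi]; split.
- by under eq_fun do rewrite [X in complex.Re X]/= ReD; exact: (lin a _ _ ur vr).
- by under eq_fun do rewrite [X in complex.Im X]/= ImD; exact: (lin a _ _ ui vi).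
Qed.

Lemma L2_0 : L2 (0 : E -> C).
Proof.
by have [+ _] := @Lfun_submod_closed _ _ _ mu 2%:E le12.
Qed.

Lemma weak_cpartial_lincomb i (a : R) (u v g h : E -> C) :
  weak_cpartial i u g -> weak_cpartial i v h ->
  weak_cpartial i (a *: u + v) (a *: g + h).
Proof.
have reE (f1 f2 : E -> C) : (fun x => complex.Re ((a *: f1 + f2) x)) =
    (fun x => a * complex.Re (f1 x) + complex.Re (f2 x)).
  by apply/funext => x; rewrite -ReD.
have imE (f1 f2 : E -> C) : (fun x => complex.Im ((a *: f1 + f2) x)) =
    (fun x => a * complex.Im (f1 x) + complex.Im (f2 x)).
  by apply/funext => x; rewrite -ImD.
by move=> [ur ui] [vr vi]; rewrite /weak_cpartial !reE !imE; split;
  exact: weak_partial_lincomb.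
Qed.

Lemma magnetic_gradient_lincomb A (a : R) (u v : E -> C) (g h : E -> 'rV[C]_N) :
  magnetic_gradient A u g -> magnetic_gradient A v h ->
  magnetic_gradient A (a *: u + v) (fun x => \row_j (a *: g x 0 j + h x 0 j)).
Proof.
move=> ug vh i.
pose F (w : E -> C) (k : E -> 'rV[C]_N) : E -> C :=
  fun x => k x 0 i - 'i%C * (A x 0 i)%:C%C * w x.
have := weak_cpartial_lincomb a (ug i) (vh i).
rewrite -/(F _ _) -/(F v h) -/(F (a *: u + v) _).
suff -> : a *: F u g + F v h =
  F (a *: u + v) (fun x => \row_j (a *: g x 0 j + h x 0 j)) by [].
apply/funext => x; rewrite /F mxE !fctE.
case: (u x) (v x) (g x 0 i) (h x 0 i) => [? ?] [? ?] [? ?] [? ?].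
apply/eqP; rewrite eq_complex /=.
by apply/andP; split; apply/eqP; ring.
Qed.

Lemma Lp_loc0 : Lp_loc 1 (cst 0 : E -> R).
Proof.
have [+ _] := @Lfun_submod_closed _ _ R mu 1%:E (lexx _).
move=> L0 K cK; rewrite (_ : _ \_ _ = 0)//.
by apply/funext => x; rewrite patchE; case: ifP.
Qed.

Lemma magnetic_gradient0 (A : E -> E) :
  magnetic_gradient A (0 : E -> C) (0 : E -> 'rV[C]_N).
Proof.
have w0 i : weak_partial i (cst 0 : E -> R) (cst 0).
  split; [exact: Lp_loc0..|move=> eta _].
  by rewrite /Rintegral !integral0_eq ?oppr0// => x _; rewrite mul0r.
move=> i; suff -> : (fun x => (0 : E -> 'rV[C]_N) x 0 i -
    'i%C * (A x 0 i)%:C%C * (0 : E -> C) x) = cst 0 by split.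
by apply/funext => x; rewrite mulr0 subr0 mxE.
Qed.

Let sqr_normE (z : C) : `|z| ^+ 2 = complex.Re z ^+ 2 + complex.Im z ^+ 2.
Proof.
by case: z => p q; rewrite /Num.norm/= sqr_sqrtr// addr_ge0 ?sqr_ge0.
Qed.

Let sqr_norm_le (a : R) (z w : C) :
  `|a *: z + w| ^+ 2 <= 2 * a ^+ 2 * `|z| ^+ 2 + 2 * `|w| ^+ 2.
Proof.
rewrite !sqr_normE ReD ImD -subr_ge0.
case: z w => [p q] [r s] /=.
have -> : 2 * a ^+ 2 * (p ^+ 2 + q ^+ 2) + 2 * (r ^+ 2 + s ^+ 2) -
  ((a * p + r) ^+ 2 + (a * q + s) ^+ 2) =
  (a * p - r) ^+ 2 + (a * q - s) ^+ 2 by ring.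
by rewrite addr_ge0 ?sqr_ge0.
Qed.

Let measurable_sqr_norm (u : E -> C) : L2 u ->
  measurable_fun setT (fun x => `|u x| ^+ 2).
Proof.
move=> [/andP[/[!inE] ur _] /andP[/[!inE] ui _]].
under eq_fun do rewrite sqr_normE.
by apply: measurable_funD; exact: measurable_funX.
Qed.

Lemma weighted_lincomb (V : E -> R) (a : R) (u v : E -> C) : L2 u -> L2 v ->
  mu.-integrable setT (fun x => (V x * `|u x| ^+ 2)%:E) ->
  mu.-integrable setT (fun x => (V x * `|v x| ^+ 2)%:E) ->
  mu.-integrable setT (fun x => (V x * `|(a *: u + v) x| ^+ 2)%:E).
Proof.
move=> Lu Lv iu iv.
have mw := measurable_sqr_norm (L2_lincomb a Lu Lv).
have mVn (w : E -> C) : L2 w ->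
    mu.-integrable setT (fun x => (V x * `|w x| ^+ 2)%:E) ->
    measurable_fun setT (fun x => V x * `|w x| ^+ 2 * (`|w x| ^+ 2) `^ (-1)).
  move=> Lw /integrableP[/measurable_EFinP mVw _]; apply: measurable_funM => //.
  apply: (@measurableT_comp _ _ _ _ _ _ (@powR R ^~ (-1))).
    exact: measurable_powR.
  exact: measurable_sqr_norm.
pose W x := if `|u x| ^+ 2 == 0 then V x * `|v x| ^+ 2 * (`|v x| ^+ 2) `^ (-1)
  else V x * `|u x| ^+ 2 * (`|u x| ^+ 2) `^ (-1).
have WE x : V x * `|(a *: u + v) x| ^+ 2 = W x * `|(a *: u + v) x| ^+ 2.
  rewrite /W; case: ifPn => [u0|u0]; last first.
    by rewrite powR_inv1 ?sqr_ge0// mulfK.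
  have [v0|v0] := eqVneq (`|v x| ^+ 2) 0; last first.
    by rewrite powR_inv1 ?sqr_ge0// mulfK.
  suff -> : `|(a *: u + v) x| ^+ 2 = 0 by rewrite !mulr0.
  apply/eqP; rewrite eq_le sqr_ge0 andbT (le_trans (sqr_norm_le _ _ _))//.
  by rewrite (eqP u0) v0 !mulr0 addr0.
apply: (@le_integrable _ _ _ mu setT measurableT _ (fun x =>
  ((2 * a ^+ 2)%:E * (V x * `|u x| ^+ 2)%:E + 2%:E * (V x * `|v x| ^+ 2)%:E)%E)).
- apply/measurable_EFinP; under eq_fun do rewrite WE.
  apply: measurable_funM => //; apply: measurable_fun_ifT; [|exact: mVn..].
  apply: (measurable_fun_eqr (measurable_sqr_norm Lu)).
  exact: measurable_cst.
- move=> x _; rewrite -!EFinM -EFinD !abse_EFin lee_fin normrM.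
  rewrite (ger0_norm (sqr_ge0 _)).
  have le3 := sqr_norm_le a (u x) (v x).
  have -> : 2 * a ^+ 2 * (V x * `|u x| ^+ 2) + 2 * (V x * `|v x| ^+ 2) =
    V x * (2 * a ^+ 2 * `|u x| ^+ 2 + 2 * `|v x| ^+ 2) by ring.
  rewrite normrM ler_wpM2l//.
  by rewrite ger0_norm// (le_trans _ le3)// sqr_ge0.
- by apply: integrableD => //; exact: integrableZl.
Qed.

Lemma mem_H1_lincomb (A : E -> E) (V : E -> R) (a : R) (u v : E -> C) :
  mem_H1 A V u -> mem_H1 A V v -> mem_H1 A V (a *: u + v).
Proof.
move=> [Lu iu [g ug Lg]] [Lv iv [h vh Lh]]; split.
- exact: L2_lincomb.
- exact: weighted_lincomb.
- exists (fun x => \row_j (a *: g x 0 j + h x 0 j)).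
    exact: magnetic_gradient_lincomb.
  move=> i; under eq_fun do rewrite mxE.
  exact: (L2_lincomb a (Lg i) (Lh i)).
Qed.

Lemma mem_H1_0 (A : E -> E) (V : E -> R) : mem_H1 A V (0 : E -> C).
Proof.
split; first exact: L2_0.
- rewrite (_ : (fun x => _) = cst 0%E); first exact: integrable0.
  by apply/funext => x; rewrite normr0 expr0n mulr0.
- exists 0; first exact: magnetic_gradient0.
  move=> i; rewrite (_ : (fun x => _) = 0); first exact: L2_0.
  by apply/funext => x; rewrite mxE.
Qed.
End closure.

Section H1_space.
Context {R : realType} {N : nat}.
Local Notation E := 'rV[R]_N.
Local Notation mu := (@lebesgue_rV R N).
Local Notation C := (Rcomplex R).
Variables (A : E -> E) (V : E -> R).

Definition H1_pred : {pred E -> C} := fun u => `[< mem_H1 A V u >].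

Let H1_submod_closed : submod_closed H1_pred.
Proof.
split; first exact/asboolP/mem_H1_0.
by move=> a u v /asboolP Hu /asboolP Hv; exact/asboolP/mem_H1_lincomb.
Qed.

HB.instance Definition _ := GRing.isSubmodClosed.Build R (E -> C) H1_pred
  H1_submod_closed.

Record H1fun := { H1fun_val :> E -> C ; _ : H1fun_val \in H1_pred }.
HB.instance Definition _ := [isSub for H1fun_val].
HB.instance Definition _ := [Choice of H1fun by <:].
HB.instance Definition _ := [SubChoice_isSubLmodule of H1fun by <:].

(* H^1_{A,V} is the space of the functions of mem_H1 modulo equality almost
   everywhere. *)
Definition ae_zero : {pred H1fun} :=
  fun u => `[< {ae mu, forall x, u x = 0} >].

Let ae_zeroZ (a : R) (u : H1fun) : u \in ae_zero -> a *: u \in ae_zero.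
Proof.
move=> /asboolP u0; apply/asboolP; apply: filterS u0 => x /= u0.
by rewrite -[RHS](scaler0 _ a) -u0.
Qed.

Let ae_zero_closed : zmod_closed ae_zero.
Proof.
split; first by apply/asboolP; apply: nearW.
move=> u v /asboolP u0 /asboolP v0; apply/asboolP.
apply: filterS2 u0 v0 => x /= u0 v0.
by rewrite -[RHS](subrr (0 : C)) -{1}u0 -v0.
Qed.

HB.instance Definition _ := GRing.isZmodClosed.Build H1fun ae_zero ae_zero_closed.

Definition H1_space := {ideal_quot ae_zero}.
HB.instance Definition _ := GRing.Zmodule.on H1_space.
HB.instance Definition _ := EqQuotient.on H1_space.

Definition H1_scale (a : R) (u : H1_space) : H1_space :=
  \pi_H1_space (a *: repr u).

Let pi_scale a (u : H1fun) : \pi_H1_space (a *: u) = H1_scale a (\pi_H1_space u).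
Proof.
apply/eqP; rewrite -Quotient.idealrBE -scalerBr ae_zeroZ//.
by rewrite Quotient.idealrBE reprK.
Qed.

Let pi_add (u v : H1fun) :
  \pi_H1_space (u + v) = \pi_H1_space u + \pi_H1_space v.
Proof. exact: Quotient.pi_add. Qed.

Let H1_scaleA (a b : R) (u : H1_space) :
  H1_scale a (H1_scale b u) = H1_scale (a * b) u.
Proof.
elim/quotW: u => u; rewrite -(pi_scale b u) -(pi_scale a (b *: u)) scalerA.
exact: pi_scale.
Qed.

Let H1_scale1 : left_id 1 H1_scale.
Proof. by elim/quotW => u; rewrite -(pi_scale 1 u) scale1r. Qed.

Let H1_scaleDr : right_distributive H1_scale +%R.
Proof.
move=> a; elim/quotW => u; elim/quotW => v.
by rewrite -(pi_add u v) -(pi_scale a u) -(pi_scale a v) -pi_add -scalerDr -pi_scale.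
Qed.

Let H1_scaleDl (u : H1_space) : {morph H1_scale^~ u : a b / a + b}.
Proof.
move=> a b; elim/quotW: u => u.
by rewrite -(pi_scale a u) -(pi_scale b u) -pi_add -scalerDl -pi_scale.
Qed.

HB.instance Definition _ := GRing.Zmodule_isLmodule.Build R H1_space
  H1_scaleA H1_scale1 H1_scaleDr H1_scaleDl.

(* The class of u if u satisfies mem_H1, and 0 otherwise. *)
Definition H1_class (u : E -> C) : H1_space := \pi_H1_space (insubd 0 u).

(* A choice of (grad + iA) u, which is unique up to equality almost
   everywhere. *)
Definition magnetic_grad (u : E -> C) : E -> 'rV[C]_N :=
  xget (fun=> 0) [set g | magnetic_gradient A u g].

Definition H1_ip (u v : H1_space) : R :=
  complex.Re (cintegral (fun x => V x *: (repr u x * (repr v x)^*%C))) +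
  complex.Re (cintegral (fun x => \sum_i
    (magnetic_grad (repr u) x 0 i * (magnetic_grad (repr v) x 0 i)^*%C))).

Definition gauge_phase (psi : 'rV[int]_N -> E -> R) (y : 'rV[int]_N)
    (x : E) : R :=
  psi y x - psi y (- lattice y) / 2.

Definition expi (t : R) : C := Complex (cos t) (sin t).

Definition tau (psi : 'rV[int]_N -> E -> R) (y : 'rV[int]_N)
    (u : H1_space) : H1_space :=
  H1_class (fun x => expi (gauge_phase psi y x) * repr u (x + lattice y)).

End H1_space.

Section dislocations.
Context {R : realType} {H : lmodType R} (ip : H -> H -> R).

Definition inner_product : Prop :=
  [/\ forall u v, ip u v = ip v u,
      forall a u v w, ip (a *: u + v) w = a * ip u w + ip v w,
      forall u, 0 <= ip u u
    & forall u, ip u u = 0 -> u = 0].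

Definition hnorm (u : H) : R := Num.sqrt (ip u u).

Definition complete_norm : Prop := forall u : nat -> H,
  (forall e, 0 < e -> exists n0, forall m n, (n0 <= m)%N -> (n0 <= n)%N ->
    hnorm (u m - u n) < e) ->
  exists l, (fun n => hnorm (u n - l)) @ \oo --> (0 : R).

Definition separable_norm : Prop := exists d : nat -> H,
  forall u e, 0 < e -> exists n, hnorm (u - d n) < e.

Definition infinite_dimensional : Prop := forall n (b : 'I_n -> H),
  exists u, forall c : 'I_n -> R, u <> \sum_i c i *: b i.

Definition bounded_linear (T : H -> H) : Prop :=
  linear T /\ exists M, forall u, hnorm (T u) <= M * hnorm u.

Definition is_adjoint (S S' : H -> H) : Prop :=
  forall u v, ip (S u) v = ip u (S' v).

(* On a Hilbert space every bounded operator has exactly one adjoint, so the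
   default value is irrelevant. *)
Definition adjoint (S : H -> H) : H -> H :=
  xget (idfun : H -> H) [set S' | is_adjoint S S'].

Definition weakly_to0 (u : nat -> H) : Prop :=
  forall v, (fun k => ip (u k) v) @ \oo --> (0 : R).

Definition op_weakly_to0 (T : nat -> H -> H) : Prop :=
  forall u, weakly_to0 (fun k => T k u).

Definition operator_norms (D : set (H -> H)) : set (\bar R) :=
  [set e | exists T u, [/\ D T, hnorm u = 1 & e = (hnorm (T u))%:E]].

Record separable_infinite_hilbert : Prop := {
  hilbert_inner_product : inner_product;
  hilbert_complete : complete_norm;
  hilbert_separable : separable_norm;
  hilbert_infinite_dimensional : infinite_dimensional }.

Record dislocations (D : set (H -> H)) : Prop := {
  disl_hilbert : separable_infinite_hilbert;
  disl_bounded : D `<=` [set T | bounded_linear T];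
  disl_norms : (0 < ereal_inf (operator_norms D) /\
    ereal_inf (operator_norms D) <= ereal_sup (operator_norms D) /\
    ereal_sup (operator_norms D) < +oo)%E;
  disl_weak : forall S T : nat -> H -> H,
    (forall k, D (S k)) -> (forall k, D (T k)) ->
    ~ op_weakly_to0 (fun k => adjoint (S k) \o T k) ->
    forall u, weakly_to0 u ->
    exists2 n : nat -> nat, {homo n : i j / (i < j)%N} &
      weakly_to0 (fun k => adjoint (S (n k)) (T (n k) (u (n k)))) }.
End dislocations.

Arguments H1_ip {R N} A V u v.
Arguments tau {R N} A V psi y u.
Arguments H1_space {R N} A V.

(* Main.v *)
Require Import Defs.
From mathcomp Require Import all_boot all_order all_algebra.
From mathcomp Require Import generic_quotient ring_quotient.
From mathcomp Require Import all_classical all_reals all_analysis.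
From mathcomp Require Import measurable_realfun ess_sup_inf.
From mathcomp Require Import complex ring lra zify.

Set Implicit Arguments.
Unset Strict Implicit.
Unset Printing Implicit Defensive.

Import Order.TTheory GRing.Theory Num.Theory.
Import numFieldNormedType.Exports.

Local Open Scope classical_set_scope.
Local Open Scope ring_scope.
Local Open Scope quotient_scope.

(** The operators tau_y are translations corrected by a phase. As A(. + y) - A is the
    gradient of psi_y, the magnetic gradient of exp(i psi_y) u(. + y) is exp(i psi_y)
    times the translated magnetic gradient of u
    ([magnetic_gradient_translate]); since V is periodic, tau_y is therefore an invertible
    isometry ([translate_ip], [translate_inv]) and its adjoint is its inverse. All norms
    in condition (i) equal 1.

    For condition (ii), [translate] phi y is studied for every phase phi whose gradient is
    A(. + y) - A. Such operators are closed under products and inverses, so S_k^* T_k is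
    [translate] phi_k d_k for a lattice vector d_k, and the constants hidden in the phases
    never have to be computed. If each lattice vector occurs only finitely often among
    the d_k, then d_k leaves every bounded set and the operators converge weakly to 0,
    since translations push the mass of a fixed function out of every cube
    ([translate_vanish]). Hence, when S_k^* T_k does not converge weakly to 0, some vector
    d occurs infinitely often. Along this subsequence the phases have one and the
    same gradient, hence differ by real constants a_k ([admissible_uniq]), and the operators
    are exp(i a_k) T with one isometry T. As T has an adjoint it maps weakly null
    sequences to weakly null ones, and the factors exp(i a_k) do no harm
    ([rotated_weakly_to0]).

    The analysis behind this consists of three facts on weak derivatives: they are unique
    ([fundamental_lemma]); multiplication by exp(i phi) obeys the product rule if phi is
    continuous with locally square-integrable gradient ([weak_partial_cos],
    [weak_partial_sin]), which follows by mollifying phi; and a continuous function with zero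
    gradient is constant ([zero_gradient_cst]). They rest on the translation invariance of
    the iterated Lebesgue measure, on smooth bump functions, and on the density of step
    functions on boxes.

    H^1_{A,V} is a separable infinite-dimensional Hilbert space because it is isometric to
    a closed subspace of a finite power of the real L^2: the coordinates of u are the real
    and imaginary parts of the square root of V times u and of the components of its
    magnetic gradient ([rcoord_closed]). *)

(** * Real square-integrable functions *)

Section square_integrable.
Context d (T : measurableType d) (R : realType) (mu : {measure set T -> \bar R}).
Implicit Types f g h : T -> R.
Local Notation integ f := (mu.-integrable setT (EFin \o f)).

Lemma integ_measurable f : integ f -> measurable_fun setT f.
Proof. by move=> /measurable_int /measurable_EFinP. Qed.

Lemma integ_ae_le f g : measurable_fun setT f ->
  {ae mu, forall x, `|f x| <= g x} -> integ g -> integ f.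
Proof.
move=> mf fg ig; have mg := integ_measurable ig.
apply/integrableP; split; first exact/measurable_EFinP.
case/integrableP: (ig) => _; apply: le_lt_trans.
apply: ae_ge0_le_integral => //.
- by apply/measurable_EFinP; exact: measurableT_comp.
- by apply/measurable_EFinP; exact: measurableT_comp.
- apply: filterS fg => x fg _ /=; rewrite lee_fin (le_trans fg)//.
  exact: ler_norm.
Qed.

Lemma integ_le f g : measurable_fun setT f ->
  (forall x, `|f x| <= g x) -> integ g -> integ f.
Proof. by move=> mf fg; apply: integ_ae_le => //; exact: aeW. Qed.

Lemma integ_ae f g : measurable_fun setT g ->
  {ae mu, forall x, f x = g x} -> integ f -> integ g.
Proof.
move=> mg fg /integrable_norm fi; apply: (integ_ae_le mg _ fi).
by apply: filterS fg => x /= ->.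
Qed.

Lemma Rintegral_ae f g : measurable_fun setT f -> measurable_fun setT g ->
  {ae mu, forall x, f x = g x} -> \int[mu]_x f x = \int[mu]_x g x.
Proof.
move=> mf mg fg; rewrite /Rintegral; congr fine; apply: ae_eq_integral => //.
- exact/measurable_EFinP.
- exact/measurable_EFinP.
- by apply: filterS fg => x -> _.
Qed.

Lemma integD f g : integ f -> integ g -> integ (fun x => f x + g x).
Proof. by move=> fi gi; have := integrableD measurableT fi gi. Qed.

Lemma integZ a f : integ f -> integ (fun x => a * f x).
Proof. by move=> fi; have := integrableZl measurableT a fi. Qed.

Lemma Rdominated (F : nat -> T -> R) f g : (forall n, measurable_fun setT (F n)) ->
  measurable_fun setT f -> {ae mu, forall x, F n x @[n --> \oo] --> f x} ->
  integ g -> {ae mu, forall x, forall n, `|F n x| <= g x} ->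
  integ f /\ \int[mu]_x F n x @[n --> \oo] --> \int[mu]_x f x.
Proof.
move=> mF mf Ff ig Fg.
have [||||| fi _ cv] := @dominated_convergence _ T R mu setT measurableT
  (fun n => EFin \o F n) (EFin \o f) (EFin \o g).
- by move=> n; exact/measurable_EFinP.
- exact/measurable_EFinP.
- by apply: filterS Ff => x Ff _; apply: cvg_EFin Ff; exact: nearW.
- exact: ig.
- by apply: filterS Fg => x Fg n _; rewrite /= lee_fin.
split => //; apply: fine_cvg; rewrite fineK//.
exact: integrable_fin_num.
Qed.

Definition sqint f := measurable_fun setT f /\ integ (fun x => f x ^+ 2).

Definition dot f g := \int[mu]_x (f x * g x).

Lemma sqint_le f g : measurable_fun setT f ->
  {ae mu, forall x, `|f x| <= `|g x|} -> sqint g -> sqint f.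
Proof.
move=> mf fg [mg ig]; split => //; apply: (integ_ae_le _ _ ig).
  exact: measurable_funX.
apply: filterS fg => x fg.
by rewrite normrX -(real_normK (num_real (g x))) lerXn2r ?nnegrE.
Qed.

Lemma sqint_ae f g : measurable_fun setT g ->
  {ae mu, forall x, f x = g x} -> sqint f -> sqint g.
Proof.
by move=> mg fg; apply: sqint_le => //; apply: filterS fg => x ->.
Qed.

Lemma integ_mul f g : sqint f -> sqint g -> integ (fun x => f x * g x).
Proof.
move=> [mf fi] [mg gi]; apply: (integ_le _ _ (integD fi gi)).
  exact: measurable_funM.
move=> x; rewrite normrM.
have := sqr_ge0 (`|f x| - `|g x|).
rewrite -(real_normK (num_real (f x))) -(real_normK (num_real (g x))).
have := normr_ge0 (f x); have := normr_ge0 (g x); nra.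
Qed.

Lemma sqint_lin a f g : sqint f -> sqint g -> sqint (fun x => a * f x + g x).
Proof.
move=> fi gi; have fgi := integ_mul fi gi; case: fi gi => [mf fi] [mg gi].
split; first by apply: measurable_funD => //; exact: measurable_funM.
have -> : (fun x => (a * f x + g x) ^+ 2) =
    (fun x => a ^+ 2 * f x ^+ 2 + (2 * a * (f x * g x) + g x ^+ 2)).
  by apply/funext => x; ring.
by apply: integD; [exact: integZ|apply: integD => //; exact: integZ].
Qed.

Lemma sqint0 : sqint (fun=> 0).
Proof.
by split => //; rewrite expr0n/=; exact: integrable0.
Qed.

Lemma sqintZ a f : sqint f -> sqint (fun x => a * f x).
Proof.
move=> fi; have := sqint_lin a fi sqint0.
by under eq_fun do rewrite addr0.
Qed.

Lemma sqintB f g : sqint f -> sqint g -> sqint (fun x => f x - g x).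
Proof.
move=> fi gi; have := sqint_lin (-1) gi fi.
by under eq_fun do rewrite mulN1r addrC.
Qed.

Lemma sqintD f g : sqint f -> sqint g -> sqint (fun x => f x + g x).
Proof.
move=> fi gi; have := sqint_lin 1 fi gi.
by under eq_fun do rewrite mul1r.
Qed.

Lemma sqint_sum I (r : seq I) (F : I -> T -> R) :
  (forall i, sqint (F i)) -> sqint (fun x => \sum_(i <- r) F i x).
Proof.
move=> Fi; elim: r => [|i r IH].
  by under eq_fun do rewrite big_nil; exact: sqint0.
by under eq_fun do rewrite big_cons; exact: sqintD.
Qed.

Lemma dotC f g : dot f g = dot g f.
Proof. by apply: eq_Rintegral => x _; rewrite mulrC. Qed.

Lemma dot_lin a f g h : sqint f -> sqint g -> sqint h ->
  dot (fun x => a * f x + g x) h = a * dot f h + dot g h.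
Proof.
move=> fi gi hi; rewrite /dot -RintegralZl//; last exact: integ_mul.
rewrite -RintegralD//; [|exact/integZ/integ_mul|exact: integ_mul].
by apply: eq_Rintegral => x _; rewrite mulrDl mulrA.
Qed.

Lemma dot_ge0 f : 0 <= dot f f.
Proof. by apply: Rintegral_ge0 => x _; rewrite -expr2 sqr_ge0. Qed.

Lemma Rintegral_eq0 f : integ f -> (forall x, 0 <= f x) -> \int[mu]_x f x = 0 ->
  {ae mu, forall x, f x = 0}.
Proof.
move=> fi f0 If0.
have: (\int[mu]_(x in setT) `|(EFin \o f) x|)%E = 0%E.
  have -> : (\int[mu]_(x in setT) `|(EFin \o f) x|)%E = (\int[mu]_x (f x)%:E)%E.
    by apply: eq_integral => x _ /=; rewrite ger0_norm.
  rewrite -[LHS]fineK; last exact: integrable_fin_num.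
  by rewrite -[fine _]/(\int[mu]_x f x) If0.
move/ae_eq_integral_abs => /(_ measurableT); case/integrableP: fi => mf _.
move=> /(_ mf); apply: filterS => x /(_ Logic.I) /= [].
by [].
Qed.

Lemma dot_eq0 f : sqint f -> dot f f = 0 -> {ae mu, forall x, f x = 0}.
Proof.
move=> fi f0; have := Rintegral_eq0 (integ_mul fi fi) _ f0.
move=> /(_ (fun x => eq_ind _ (Order.le 0) (sqr_ge0 _) _ (expr2 _))).
by apply: filterS => x /eqP; rewrite mulf_eq0 orbb => /eqP.
Qed.

Lemma dot_ae f f' g g' : sqint f -> sqint f' -> sqint g -> sqint g' ->
  {ae mu, forall x, f x = f' x} -> {ae mu, forall x, g x = g' x} ->
  dot f g = dot f' g'.
Proof.
move=> [mf _] [mf' _] [mg _] [mg' _] ff gg; apply: Rintegral_ae.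
- exact: measurable_funM.
- exact: measurable_funM.
- by apply: filterS2 ff gg => x -> ->.
Qed.

Lemma dotBB f g : sqint f -> sqint g ->
  dot (fun x => f x - g x) (fun x => f x - g x) =
  dot f f - 2 * dot f g + dot g g.
Proof.
move=> fi gi; have hi := sqintB fi gi.
have E h : sqint h -> dot (fun x => f x - g x) h = dot f h - dot g h.
  move=> ih; rewrite -[in RHS]mulN1r addrC -(dot_lin (-1) gi fi ih).
  by apply: eq_Rintegral => x _; rewrite mulN1r addrC.
by rewrite E// (dotC f) (dotC g (fun=> _)) !E// (dotC g f); ring.
Qed.

Lemma dotDD f g : sqint f -> sqint g ->
  dot (fun x => f x + g x) (fun x => f x + g x) =
  dot f f + 2 * dot f g + dot g g.
Proof.
move=> fi gi; have hi := sqintD fi gi.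
have E h : sqint h -> dot (fun x => f x + g x) h = dot f h + dot g h.
  move=> ih; rewrite -[X in X + _]mul1r -(dot_lin 1 fi gi ih).
  by apply: eq_Rintegral => x _; rewrite mul1r.
by rewrite E// (dotC f) (dotC g (fun=> _)) !E// (dotC g f); ring.
Qed.

Lemma dotZZ a f : sqint f ->
  dot (fun x => a * f x) (fun x => a * f x) = a ^+ 2 * dot f f.
Proof.
move=> fi; rewrite /dot -RintegralZl//; last exact: integ_mul.
by apply: eq_Rintegral => x _; ring.
Qed.

(** Completing the square in a discriminant argument would need a division;
    testing with the particular combination below avoids it. *)
Lemma cauchy_schwarz f g : sqint f -> sqint g ->
  dot f g ^+ 2 <= dot f f * dot g g.
Proof.
move=> fi gi.
have [g0|g0] := eqVneq (dot g g) 0.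
  have /(dot_eq0 gi) ge0 := g0.
  have -> : dot f g = dot (fun=> 0) (fun=> 0).
    rewrite dotC; have -> : dot g f = dot (fun=> 0) f.
      by apply: (dot_ae gi sqint0 fi fi) => //; exact: aeW.
    by apply: eq_Rintegral => x _; rewrite !mul0r.
  rewrite g0 mulr0 [dot _ _](_ : _ = 0) ?expr0n//.
  by rewrite /dot; under eq_Rintegral do rewrite mul0r; rewrite Rintegral_cst// mul0r.
have := dot_ge0 (fun x => dot g g * f x - dot f g * g x).
rewrite dotBB; [|exact: sqintZ..].
rewrite !dotZZ//.
have -> : dot (fun x => dot g g * f x) (fun x => dot f g * g x) =
    dot g g * dot f g * dot f g.
  have Z a b : dot (fun x => a * f x) (fun x => b * g x) = a * b * dot f g.
    rewrite /dot -RintegralZl//; last exact: integ_mul.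
    by apply: eq_Rintegral => x _; ring.
  by rewrite Z.
have gg : 0 < dot g g by rewrite lt_neqAle eq_sym g0 dot_ge0.
have -> : dot g g ^+ 2 * dot f f - 2 * (dot g g * dot f g * dot f g) +
  dot f g ^+ 2 * dot g g = dot g g * (dot f f * dot g g - dot f g ^+ 2) by ring.
by rewrite pmulr_rge0// subr_ge0.
Qed.

Lemma sqint_dominated (F : nat -> T -> R) f g : (forall n, measurable_fun setT (F n)) ->
  measurable_fun setT f -> {ae mu, forall x, F n x @[n --> \oo] --> f x} ->
  sqint g -> {ae mu, forall x, forall n, `|F n x| <= `|g x|} ->
  sqint f /\ dot (fun x => F n x - f x) (fun x => F n x - f x) @[n --> \oo] --> (0 : R).
Proof.
move=> mF mf Ff ig Fg.
have fg : {ae mu, forall x, `|f x| <= `|g x|}.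
  apply: filterS2 Ff Fg => x Ff Fg.
  have : `|F n x| @[n --> \oo] --> `|f x| by exact: cvg_norm.
  move=> cv; rewrite -(cvg_lim _ cv)//; apply: limr_le; first exact/cvgP/cv.
  by apply: nearW.
have fi : sqint f by exact: sqint_le ig.
split => //.
have [|||||_] := @Rdominated (fun n x => (F n x - f x) * (F n x - f x)) (fun=> 0)
  (fun x => 4 * g x ^+ 2).
- move=> n; apply: measurable_funM; exact: measurable_funB.
- exact: measurable_cst.
- apply: filterS Ff => x Ff; rewrite -[X in _ --> X](mulr0 (0 : R)).
  by apply: cvgM; rewrite -(subrr (f x)); apply: cvgB => //; exact: cvg_cst.
- by case: ig => _ ig; exact: integZ.
- apply: filterS2 fg Fg => x fg Fg n; rewrite -expr2 ger0_norm ?sqr_ge0//.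
  have -> : 4 * g x ^+ 2 = (2 * `|g x|) ^+ 2 by rewrite exprMn real_normK ?num_real//; ring.
  rewrite -[leLHS](real_normK (num_real _)) lerXn2r ?nnegrE// ?mulr_ge0//.
  rewrite (le_trans (ler_normB _ _))// mulrDl mul1r lerD//; exact: Fg.
by rewrite Rintegral_cst// mul0r.
Qed.

End square_integrable.

Section riesz_fischer.
Context d (T : measurableType d) (R : realType) (mu : {measure set T -> \bar R}).
Implicit Types f g h : T -> R.
Local Notation integ f := (mu.-integrable setT (EFin \o f)).
Local Notation dist f g := (dot mu (fun x => f x - g x) (fun x => f x - g x)).

(** The parallelogram law gives this substitute for the triangle inequality, in which no
    square root occurs. *)
Lemma dist_triangle f g h : sqint mu f -> sqint mu g -> sqint mu h ->
  dist f h <= 2 * dist f g + 2 * dist g h.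
Proof.
move=> fi gi hi; have fg := sqintB fi gi; have gh := sqintB gi hi.
have -> : dist f h = dot mu (fun x => (f x - g x) + (g x - h x))
    (fun x => (f x - g x) + (g x - h x)).
  by apply: eq_Rintegral => x _; ring.
have := dot_ge0 mu (fun x => (f x - g x) - (g x - h x)).
by rewrite (dotBB fg gh) (dotDD fg gh); lra.
Qed.

Lemma limn_einf_le (u : nat -> \bar R) l : (forall n, (u n <= l)%E) -> (limn_einf u <= l)%E.
Proof.
move=> ul; rewrite limn_einf_lim; apply: lime_le; first exact: is_cvg_einfs.
apply: nearW => n; apply: (le_trans _ (ul n)).
by apply: ereal_inf_lbound; exists n => //=.
Qed.

(** The quantity summed is 4^k D_k^2 rather than |D_k|, so that monotone
    convergence applies to integrals of squares and no triangle inequality for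
    the L^2 norm is required; finiteness of the sum at a point forces D_k to
    decrease geometrically there. *)
Lemma fast_cauchy_ae_cvg (F : nat -> T -> R) : (forall n, sqint mu (F n)) ->
  (forall k, dist (F k.+1) (F k) <= (8 ^+ k)^-1) ->
  {ae mu, forall x, cvgn (fun k => F k x)}.
Proof.
move=> Fi FC.
pose D k x := F k.+1 x - F k x.
have Di k : sqint mu (D k) by exact: sqintB.
pose g k x := (4 ^+ k * D k x ^+ 2)%:E.
have g0 k x : (0 <= g k x)%E by rewrite lee_fin mulr_ge0 ?sqr_ge0 ?exprn_ge0.
have mg k : measurable_fun setT (g k).
  apply/measurable_EFinP; apply: measurable_funM => //.
  by apply: measurable_funX; case: (Di k).
pose G x := (\sum_(0 <= k <oo) g k x)%E.
have IG : (\int[mu]_x G x <= 2%:E)%E.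
  rewrite integral_nneseries//; apply: (le_trans _ (epsilon_trick0 xpredT _)) => //.
  apply: lee_nneseries => [k _ _|k _]; first exact: integral_ge0.
  have ik : integ (fun x => 4 ^+ k * D k x ^+ 2) by apply: integZ; case: (Di k).
  rewrite -(fineK (integrable_fin_num measurableT ik)) lee_fin.
  rewrite -[leLHS]/(\int[mu]_x (4 ^+ k * D k x ^+ 2)).
  rewrite RintegralZl//; last by case: (Di k).
  have := FC k; rewrite -/(D k) /dot.
  have -> : \int[mu]_x (D k x * D k x) = \int[mu]_x (D k x ^+ 2).
    by apply: eq_Rintegral => x _; rewrite expr2.
  move=> le; apply: (le_trans (ler_wpM2l _ le)); first by rewrite exprn_ge0.
  rewrite (_ : 8 = 4 * 2 :> R); last by ring.
  rewrite exprMn invfM mulrA divff ?expf_neq0// mul1r natrX exprS invfM mulrA divff//.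
  by rewrite mul1r.
have iG : mu.-integrable setT G.
  apply/integrableP; split.
    by apply: ge0_emeasurable_sum.
  apply: (@le_lt_trans _ _ 2%:E); last exact: ltry.
  apply: le_trans IG; rewrite le_eqVlt; apply/orP; left; apply/eqP.
  by apply: eq_integral => x _; rewrite gee0_abs// nneseries_ge0.
have := integrable_ae measurableT iG; apply: filterS => x /(_ Logic.I) Gx.
pose r := fine (G x).
have gr k : D k x ^+ 2 <= r * (1 / 4) ^+ k.
  have : (g k x <= G x)%E.
    apply: (le_trans _ (nneseries_lim_ge k.+1 _)) => //.
    by rewrite big_nat_recr//= leeDr// sume_ge0.
  rewrite -(fineK Gx) lee_fin -/r => H.
  rewrite expr_div_n expr1n mul1r ler_pdivlMr ?exprn_gt0//.
  by rewrite mulrC.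
have r0 : 0 <= r by rewrite fine_ge0// nneseries_ge0.
have Dr k : `|D k x| <= Num.sqrt r * (1 / 2) ^+ k.
  rewrite -(ler_pXn2r (n := 2))// ?nnegrE ?mulr_ge0 ?sqrtr_ge0 ?exprn_ge0//.
  rewrite real_normK ?num_real// exprMn sqr_sqrtr//.
  rewrite -exprM mulnC exprM (_ : (1 / 2) ^+ 2 = 1 / 4 :> R)//.
  by rewrite expr_div_n; congr (_ / _); ring.
have cD : cvgn (series (fun k => D k x)).
  apply: normed_cvg; apply: (@series_le_cvg _ _ (geometric (Num.sqrt r) (1 / 2))) => //.
  - by move=> n /=.
  - by move=> n /=; rewrite mulr_ge0 ?sqrtr_ge0// exprn_ge0.
  - by apply: is_cvg_geometric_series; rewrite ger0_norm//; lra.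
have -> : (fun k => F k x) = (fun k => F 0%N x + series (fun k => D k x) k).
  by apply/funext => k; rewrite [LHS](eq_sum_telescope (fun k => F k x)).
by apply: is_cvgD => //; exact: is_cvg_cst.
Qed.

(** The candidate limit is the pointwise limit of a fast Cauchy subsequence, and Fatou's
    lemma bounds its distance to every late member of the sequence. *)
Lemma riesz_fischer (F : nat -> T -> R) : (forall n, sqint mu (F n)) ->
  (forall e, 0 < e -> exists n0, forall m n, (n0 <= m)%N -> (n0 <= n)%N ->
    dist (F m) (F n) < e) ->
  exists2 f, sqint mu f & dist (F n) f @[n --> \oo] --> (0 : R).
Proof.
move=> Fi FC.
have /choice[M HM] : forall k : nat, exists n0, forall m n, (n0 <= m)%N -> (n0 <= n)%N ->
    dist (F m) (F n) < (8 ^+ k)^-1.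
  by move=> k; apply: FC; rewrite invr_gt0 exprn_gt0.
pose s k := (k + \sum_(i < k.+1) M i)%N.
have sM k : (M k <= s k)%N.
  by rewrite /s big_ord_recr/= addnA leq_addl.
have sk k : (k <= s k)%N by rewrite leq_addr.
have sS k : (s k <= s k.+1)%N.
  by rewrite /s leq_add// [leqRHS]big_ord_recr/= leq_addr.
have cF : {ae mu, forall x, cvgn (fun k => F (s k) x)}.
  apply: (@fast_cauchy_ae_cvg (F \o s)) => [k|k /=]; first exact: Fi.
  by apply/ltW/HM => //; rewrite (leq_trans (sM k)).
pose f x := fine (limn_esup (fun k => (F (s k) x)%:E)).
have mf : measurable_fun setT f.
  apply: measurableT_comp => //; apply: measurable_fun_limn_esup => k.
  by apply/measurable_EFinP; case: (Fi (s k)).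
have cf : {ae mu, forall x, F (s k) x @[k --> \oo] --> f x}.
  apply: filterS cF => x /cvg_ex[l cl].
  have : (F (s k) x)%:E @[k --> \oo] --> l%:E by apply: cvg_EFin => //; exact: nearW.
  by rewrite /f => /cvg_limn_einf_sup[_ ->].
have key e : 0 < e -> exists n0, forall n, (n0 <= n)%N ->
    integ (fun x => (F n x - f x) ^+ 2) /\ dist (F n) f <= e.
  move=> e0; have [n0 Hn0] := FC _ e0; exists n0 => n n0n.
  pose h k x := (((F n x - F (s (k + n0)%N) x) ^+ 2)%:E : \bar R).
  have mh k : measurable_fun setT (h k).
    apply/measurable_EFinP; apply: measurable_funX.
    by apply: measurable_funB; [case: (Fi n)|case: (Fi (s (k + n0)%N))].
  have m2 : measurable_fun setT (fun x => (F n x - f x) ^+ 2).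
    by apply: measurable_funX; apply: measurable_funB => //; case: (Fi n).
  have fat : (\int[mu]_x ((F n x - f x) ^+ 2)%:E <= e%:E)%E.
    have -> : (\int[mu]_x ((F n x - f x) ^+ 2)%:E = \int[mu]_x limn_einf (h ^~ x))%E.
      apply: ae_eq_integral => //.
      - exact/measurable_EFinP.
      - by apply: measurableT_comp => //; apply: measurable_fun_limn_esup => k;
          exact: measurableT_comp.
      - apply: filterS cf => x cx _.
        have : h k x @[k --> \oo] --> ((F n x - f x) ^+ 2)%:E.
          apply: cvg_EFin; first exact: nearW.
          rewrite expr2 (_ : fine \o _ = fun k =>
            (F n x - F (s (k + n0)%N) x) * (F n x - F (s (k + n0)%N) x)); last first.
            by apply/funext => k /=; rewrite expr2.
          have cs : F n x - F (s (k + n0)%N) x @[k --> \oo] --> F n x - f x.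
            apply: cvgB; first exact: cvg_cst.
            by rewrite (cvg_shiftn n0 (fun k => F (s k) x)).
          exact: cvgM.
        by move=> /cvg_limn_einf_sup[->].
    apply: (le_trans (fatou _ _ _ _)) => //.
      by move=> k x _; rewrite lee_fin sqr_ge0.
    apply: limn_einf_le => k.
    have Bi := sqintB (Fi n) (Fi (s (k + n0)%N)).
    rewrite -(fineK (integrable_fin_num measurableT Bi.2)) lee_fin.
    rewrite -[leLHS]/(\int[mu]_x _).
    under eq_Rintegral do rewrite expr2.
    apply/ltW/Hn0 => //; apply: (leq_trans _ (sk _)).
    by rewrite leq_addl.
  have i2 : integ (fun x => (F n x - f x) ^+ 2).
    apply/integrableP; split; first exact/measurable_EFinP.
    apply: (@le_lt_trans _ _ e%:E); last exact: ltry.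
    apply: le_trans fat; rewrite le_eqVlt; apply/orP; left; apply/eqP.
    by apply: eq_integral => x _; rewrite gee0_abs// lee_fin sqr_ge0.
  split => //.
  rewrite /dot; under eq_Rintegral do rewrite -expr2.
  by rewrite -lee_fin fineK// integrable_fin_num.
have fi : sqint mu f.
  have [n0 /(_ _ (leqnn n0))[i2 _]] := key 1 ltr01.
  have : sqint mu (fun x => F n0 x - (F n0 x - f x)).
    apply: sqintB => //; split => //; apply: measurable_funB => //.
    by case: (Fi n0).
  by under eq_fun do rewrite opprB addrC subrK.
exists f => //; apply/cvgrPdist_le => e e0.
have [n0 Hn0] := key _ e0; exists n0 => //= n n0n.
by rewrite sub0r normrN ger0_norm ?dot_ge0//; case: (Hn0 n n0n).
Qed.

End riesz_fischer.

(** * Hilbert spaces realized by square-integrable coordinates *)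

Section l2_coordinates.
Context d (T : measurableType d) (R : realType) (mu : {measure set T -> \bar R}).
Context (H : lmodType R) (ip : H -> H -> R) (I : finType) (J : H -> I -> T -> R).
Local Notation dist f g := (dot mu (fun x => f x - g x) (fun x => f x - g x)).
Hypothesis Jsq : forall u c, sqint mu (J u c).
Hypothesis Jlin : forall a u v c,
  {ae mu, forall x, J (a *: u + v) c x = a * J u c x + J v c x}.
Hypothesis Jip : forall u v, ip u v = \sum_c dot mu (J u c) (J v c).
Hypothesis Jinj : forall u, (forall c, {ae mu, forall x, J u c x = 0}) -> u = 0.

Lemma l2_inner_product : inner_product ip.
Proof.
split.
- by move=> u v; rewrite !Jip; apply: eq_bigr => c _; rewrite dotC.
- move=> a u v w; rewrite !Jip mulr_sumr -big_split; apply: eq_bigr => c _ /=.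
  rewrite -dot_lin//; apply: (dot_ae (Jsq _ _) (sqint_lin a (Jsq u c) (Jsq v c))) => //.
  exact: aeW.
- by move=> u; rewrite Jip sumr_ge0// => c _; exact: dot_ge0.
- move=> u; rewrite Jip => /eqP; rewrite psumr_eq0; last by move=> c _; exact: dot_ge0.
  by move=> /allP u0; apply: Jinj => c; apply: dot_eq0 => //; apply/eqP/u0/mem_index_enum.
Qed.

Lemma ip_dist u v : ip (u - v) (u - v) = \sum_c dist (J u c) (J v c).
Proof.
rewrite Jip; apply: eq_bigr => c _.
have E : {ae mu, forall x, J (u - v) c x = J u c x - J v c x}.
  rewrite addrC -scaleN1r; apply: filterS (Jlin (-1) v u c) => x ->.
  by rewrite mulN1r addrC.
by have B := sqintB (Jsq u c) (Jsq v c); exact: dot_ae.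
Qed.

Lemma ltr_sqrt_sqr (a e : R) : 0 < e -> (Num.sqrt a < e) = (a < e ^+ 2).
Proof.
by move=> e0; rewrite -[in LHS](ger0_norm (ltW e0)) -sqrtr_sqr ltr_sqrt ?exprn_gt0.
Qed.

(** Completeness is inherited from L^2 as soon as the range of the coordinate map is
    closed. *)
Lemma l2_complete :
  (forall (u : nat -> H) (f : I -> T -> R), (forall c, sqint mu (f c)) ->
    (forall c, dist (J (u n) c) (f c) @[n --> \oo] --> (0 : R)) ->
    exists l, forall c, {ae mu, forall x, J l c x = f c x}) ->
  complete_norm ip.
Proof.
move=> Jclosed u uC.
have /choice[f fP] : forall c, exists f, sqint mu f /\
    dist (J (u n) c) f @[n --> \oo] --> (0 : R).
  move=> c; have [|f fi fc] := @riesz_fischer _ _ _ mu (fun n => J (u n) c) (fun n => Jsq _ _).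
    move=> e e0.
    have [|n0 Hn0] := uC (Num.sqrt e); first by rewrite sqrtr_gt0.
    exists n0 => m n n0m n0n; have := Hn0 _ _ n0m n0n.
    rewrite /hnorm ltr_sqrt// ip_dist; apply: le_lt_trans.
    by rewrite (bigD1 c)//= lerDl sumr_ge0// => *; exact: dot_ge0.
  by exists f.
have [c|c|l Hl] := Jclosed u f; [by case: (fP c)..|].
exists l.
have E n : ip (u n - l) (u n - l) = \sum_c dist (J (u n) c) (f c).
  rewrite ip_dist; apply: eq_bigr => c _; have fi := (fP c).1.
  have B := sqintB (Jsq (u n) c) (Jsq l c); have B' := sqintB (Jsq (u n) c) fi.
  by apply: dot_ae => //; apply: filterS (Hl c) => x ->.
have C0 : \sum_c dist (J (u n) c) (f c) @[n --> \oo] --> (0 : R).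
  rewrite [X in _ --> X](_ : 0 = \sum_(c : I) (0 : R)); last by rewrite big1.
  by apply: cvg_big => [|c _]; [exact: add_continuous|case: (fP c)].
rewrite (_ : (fun n => _) = fun n => Num.sqrt (\sum_c dist (J (u n) c) (f c))).
  rewrite -[X in _ --> X](@sqrtr0 R); apply: continuous_cvg C0.
  exact: sqrt_continuous.
by apply/funext => n; rewrite /hnorm E.
Qed.

(** A subset of a separable metric space is separable: for each n and each choice of
    dense functions, pick a point of the space whose coordinates are (n+1)^-1-close to
    them, whenever there is one. *)
Lemma l2_separable :
  (exists2 q : nat -> T -> R, (forall n, sqint mu (q n)) &
    forall f e, sqint mu f -> 0 < e -> exists n, dist f (q n) < e) ->
  separable_norm ip.
Proof.
move=> [q qi qd].
pose near_q (s : {ffun I -> nat} * nat) u := forall c, dist (J u c) (q (s.1 c)) < s.2.+1%:R^-1.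
pose d' (s : {ffun I -> nat} * nat) := xget 0 (near_q s).
exists (fun n => if unpickle n is Some s then d' s else 0) => u e e0.
have I0 : 0 < (#|I|.+1%:R : R) by rewrite ltr0n.
have e20 : 0 < e ^+ 2 / 4 / #|I|.+1%:R by rewrite !divr_gt0 ?exprn_gt0.
have [m Hm] := ltr_add_invr e20; rewrite add0r in Hm.
have /choice[s Hs] : forall c, exists n, dist (J u c) (q n) < m.+1%:R^-1.
  by move=> c; apply: qd => //; rewrite invr_gt0 ltr0n.
pose S : {ffun I -> nat} * nat := ([ffun c => s c], m).
exists (pickle S); rewrite pickleK.
have Su : near_q S u by move=> c; rewrite ffunE.
have Sd : near_q S (d' S) by exact: (xgetPex 0 (ex_intro _ u Su)).
rewrite /hnorm ltr_sqrt_sqr// ip_dist.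
apply: (@le_lt_trans _ _ (\sum_(c : I) (4 * m.+1%:R^-1))).
  apply: ler_sum => c _.
  have := dist_triangle (Jsq u c) (qi (S.1 c)) (Jsq (d' S) c).
  have := Su c; have := Sd c.
  have -> : dist (q (S.1 c)) (J (d' S) c) = dist (J (d' S) c) (q (S.1 c)).
    by apply: eq_Rintegral => x _; ring.
  rewrite /S /=; set a := _^-1; lra.
rewrite sumr_const -[X in X < _]mulr_natl.
move: Hm; rewrite ltr_pdivlMr// ltr_pdivlMr//.
apply: le_lt_trans.
rewrite -addn1 natrD.
have : 0 < m.+1%:R^-1 :> R by rewrite invr_gt0 ltr0n.
set a := _^-1; set b : R := #|I|%:R; nra.
Qed.

End l2_coordinates.

(** * Lebesgue measure on row vectors: translations and boxes *)

Section lebesgue_translation.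
Context {R : realType}.

Let shift1 (y : R) (x : measurableTypeR R) : measurableTypeR R := x + y.

Let measurable_shift1 y : measurable_fun setT (shift1 y).
Proof. by apply: measurable_funD => //; exact: measurable_cst. Qed.

(** Both sides are measures in A that agree on half-open intervals, whence
    everywhere. *)
Lemma lebesgue_measure_shift (y : R) (A : set (measurableTypeR R)) : measurable A ->
  (@lebesgue_measure R) ((fun x => x + y) @^-1` A) = lebesgue_measure A.
Proof.
move=> mA; apply/esym.
rewrite -[RHS]/(pushforward (@lebesgue_measure R) (shift1 y) A).
apply: lebesgue_measure_unique mA => X [[a b] _ <-].
rewrite -[RHS]/(lebesgue_measure (shift1 y @^-1` `]a, b]%classic)).
rewrite (_ : _ @^-1` _ = `]a - y, b - y]%classic); last first.
  apply/seteqP; split => x /=; rewrite /shift1 !in_itv/=.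
    by rewrite ltrBlDr lerBrDr.
  by rewrite ltrBlDr lerBrDr.
rewrite !lebesgue_measure_itv/= !lte_fin ltrD2r -!EFinB.
by case: ifP => // _; congr EFin; ring.
Qed.

Definition shift_rV n (y x : 'rV[R]_n) : 'rV[R]_n := x + y.

Lemma measurable_shift_rV n (y : 'rV[R]_n) : measurable_fun setT (shift_rV y).
Proof.
apply: measurable_matrixP => i j; under eq_fun do rewrite mxE.
by apply: measurable_funD => //; exact: measurable_entry.
Qed.

Lemma cons_rV0 n (p : measurableTypeR R * 'rV[R]_n) : cons_rV p 0 ord0 = p.1.
Proof.
transitivity (row_mx (p.1%:M : 'M[R]_1) p.2 0 (lshift n (0 : 'I_1))).
  by congr (fun_of_matrix _ _ _); exact: val_inj.
by rewrite row_mxEl mxE eqxx mulr1n.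
Qed.

Lemma cons_rVS n (p : measurableTypeR R * 'rV[R]_n) i : cons_rV p 0 (lift ord0 i) = p.2 0 i.
Proof.
transitivity (row_mx (p.1%:M : 'M[R]_1) p.2 0 (rshift 1 i)).
  by congr (fun_of_matrix _ _ _); exact: val_inj.
by rewrite row_mxEr.
Qed.

Lemma cons_rVD n (a a' : R) (v v' : 'rV[R]_n) :
  cons_rV (a + a', v + v') = cons_rV (a, v) + cons_rV (a', v').
Proof.
apply/rowP => i; rewrite [RHS]mxE.
by case: (unliftP ord0 i) => [j|] ->; rewrite ?cons_rV0 ?cons_rVS// mxE.
Qed.

Lemma cons_rV_surj n (y : 'rV[R]_n.+1) : exists a v, y = cons_rV (a, v).
Proof.
exists (y 0 ord0), (\row_i y 0 (lift ord0 i)); apply/rowP => i.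
by case: (unliftP ord0 i) => [j|] ->; rewrite ?cons_rV0 ?cons_rVS//= mxE.
Qed.

Let shift_prod n (a : R) (v : 'rV[R]_n) (p : measurableTypeR R * 'rV[R]_n) :=
  (shift1 a p.1, shift_rV v p.2).

Let measurable_shift_prod n a (v : 'rV[R]_n) : measurable_fun setT (shift_prod a v).
Proof.
apply: measurable_fun_pair.
  exact: (measurableT_comp (@measurable_shift1 a) measurable_fst).
exact: (measurableT_comp (@measurable_shift_rV n v) measurable_snd).
Qed.

(** Induction on the dimension: a translation of a product acts on the two factors, and a
    product measure is determined by its values on rectangles. *)
Lemma lebesgue_rV_shift n (y : 'rV[R]_n) (A : set 'rV[R]_n) : measurable A ->
  lebesgue_rV n (shift_rV y @^-1` A) = lebesgue_rV n A.
Proof.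
elim: n y A => [|n IH] y A mA.
  congr (lebesgue_rV _ _); apply/seteqP; split=> x /=; rewrite /shift_rV;
  by rewrite (_ : x + y = x)//; apply/rowP => -[].
have [a [v ->]] := cons_rV_surj y.
rewrite [LHS]/= [RHS]/= /lebesgue_step /pushforward.
have mcA : measurable (@cons_rV R n @^-1` A).
  by rewrite -[X in measurable X]setTI; exact: measurable_cons_rV.
have key X : measurable X ->
    (lebesgue_measure \x lebesgue_rV n)%E (shift_prod a v @^-1` X) =
    (lebesgue_measure \x lebesgue_rV n)%E X.
  move=> mX; apply/esym; have mp := measurable_shift_prod a v.
  apply: (@product_measure_unique _ _ _ _ _ lebesgue_measure (lebesgue_rV n)
    (pushforward (lebesgue_measure \x lebesgue_rV n)%E (shift_prod a v))) mX.
  move=> B C mB mC; rewrite -[LHS]/((lebesgue_measure \x lebesgue_rV n)%E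
    ((shift1 a @^-1` B) `*` (shift_rV v @^-1` C))).
  rewrite product_measure1E//; last 2 first.
  - by rewrite -[X in measurable X]setTI; exact: measurable_shift1.
  - by rewrite -[X in measurable X]setTI; exact: measurable_shift_rV.
  by congr (_ * _)%E; [exact: lebesgue_measure_shift|exact: IH].
rewrite -[RHS]key//; congr (product_measure1 _ _ _).
by apply/seteqP; split => -[b w] /=; rewrite /shift_rV -cons_rVD.
Qed.

Context {n : nat}.
Local Notation E := 'rV[R]_n.
Local Notation mu := (@lebesgue_rV R n).
Local Notation integ f := (mu.-integrable setT (EFin \o f)).

Lemma ae_shift (y : E) (P : E -> Prop) : {ae mu, forall x, P x} -> {ae mu, forall x, P (x + y)}.
Proof.
move=> [B [mB B0 PB]]; exists (shift_rV y @^-1` B); split.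
- by rewrite -[X in measurable X]setTI; exact: measurable_shift_rV.
- by rewrite lebesgue_rV_shift.
- by move=> x /= nP; exact: PB.
Qed.

Lemma measurable_shift (y : E) d' (T' : measurableType d') (f : E -> T') :
  measurable_fun setT f -> measurable_fun setT (fun x : E => f (x + y)).
Proof. by move=> mf; exact: (measurableT_comp mf (@measurable_shift_rV n y)). Qed.

Lemma ge0_integral_shift (y : E) (f : E -> \bar R) : measurable_fun setT f ->
  (forall x, 0 <= f x)%E -> (\int[mu]_x f (x + y)%R = \int[mu]_x f x)%E.
Proof.
move=> mf f0.
have <- : (\int[pushforward mu (shift_rV y)]_x f x = \int[mu]_x f x)%E.
  have mp := @measurable_shift_rV n y.
  by apply: (@eq_measure_integral _ _ _ setT mu (pushforward mu (shift_rV y))) => A mA _; exact: lebesgue_rV_shift.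
by rewrite ge0_integral_pushforward//; exact: measurable_shift_rV.
Qed.

Lemma integ_shift (y : E) f : integ f -> integ (fun x => f (x + y)).
Proof.
move=> fi; have mf := integ_measurable fi; apply/integrableP; split.
  by apply/measurable_EFinP; exact: measurable_shift.
case/integrableP: fi => _; rewrite -(@ge0_integral_shift y)//.
by apply: measurableT_comp => //; exact/measurable_EFinP.
Qed.

Lemma Rintegral_shift (y : E) (f : E -> R) : integ f ->
  \int[mu]_x f (x + y) = \int[mu]_x f x.
Proof.
move=> fi; have mf := integ_measurable fi; rewrite /Rintegral; congr fine.
have <- : (\int[pushforward mu (shift_rV y)]_x (f x)%:E = \int[mu]_x (f x)%:E)%E.
  have mp := @measurable_shift_rV n y.
  by apply: (@eq_measure_integral _ _ _ setT mu (pushforward mu (shift_rV y))) => A mA _; exact: lebesgue_rV_shift.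
rewrite integral_pushforward//.
- exact: measurable_shift_rV.
- exact/measurable_EFinP.
- exact: integ_shift.
Qed.

Lemma sqint_shift (y : E) f : sqint mu f -> sqint mu (fun x => f (x + y)).
Proof.
by move=> [mf fi]; split; [exact: measurable_shift|exact: (integ_shift y fi)].
Qed.

Lemma dot_shift (y : E) f g : sqint mu f -> sqint mu g ->
  dot mu (fun x => f (x + y)) (fun x => g (x + y)) = dot mu f g.
Proof. by move=> fi gi; rewrite /dot (Rintegral_shift y (integ_mul fi gi)). Qed.

End lebesgue_translation.

Section boxes.
Context {R : realType}.

Lemma measurable_rect n (A : 'I_n -> set R) : (forall i, measurable (A i)) ->
  measurable [set x : 'rV[R]_n | forall i, A i (x 0 i)].
Proof.
move=> mA; rewrite (_ : [set x | _] = \bigcap_(i in [set: 'I_n])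
    ((fun x : 'rV[R]_n => x 0 i) @^-1` A i)).
  apply: fin_bigcap_measurable => // i _.
  by rewrite -[X in measurable X]setTI; exact: measurable_entry.
by apply/seteqP; split=> [x Ax i _|x Ax i]; [exact: Ax|exact: (Ax i)].
Qed.

(** The recursion in the dimension for product sets; it reduces measures of boxes to
    lengths of intervals. *)
Lemma lebesgue_rV_rectS n (A : 'I_n.+1 -> set (measurableTypeR R)) :
  (forall i, measurable (A i)) ->
  (lebesgue_rV n.+1 [set x : 'rV[R]_n.+1 | forall i, A i (x 0%R i)] =
   lebesgue_measure (A ord0) *
   lebesgue_rV n [set x : 'rV[R]_n | forall i, A (lift ord0 i) (x 0%R i)])%E.
Proof.
move=> mA; rewrite [LHS]/= /lebesgue_step /pushforward.
rewrite (_ : _ @^-1` _ = A ord0 `*` [set x : 'rV[R]_n | forall i, A (lift ord0 i) (x 0 i)]).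
  rewrite product_measure1E//.
  by apply: (@measurable_rect n (fun i => A (lift ord0 i))) => i; exact: mA.
apply/seteqP; split=> [p /= Ap|p /= [A0 AS] i].
  by split=> [|i /=]; [rewrite -(cons_rV0 p)|rewrite -cons_rVS].
by case: (unliftP ord0 i) => [j|] ->; rewrite ?cons_rV0 ?cons_rVS.
Qed.

Lemma lebesgue_rV_rect_lty n (A : 'I_n -> set R) : (forall i, measurable (A i)) ->
  (forall i, @lebesgue_measure R (A i) < +oo)%E ->
  (lebesgue_rV n [set x : 'rV[R]_n | forall i, A i (x 0%R i)] < +oo)%E.
Proof.
elim: n A => [|n IH] A mA Ay; first by rewrite /= diracE ltry.
rewrite lebesgue_rV_rectS// lte_mul_pinfty//.
  by rewrite ge0_fin_numE.
exact: (IH (fun i => A (lift ord0 i))).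
Qed.

Lemma lebesgue_rV_rect_gt0 n (A : 'I_n -> set R) : (forall i, measurable (A i)) ->
  (forall i, 0 < @lebesgue_measure R (A i))%E ->
  (0 < lebesgue_rV n [set x : 'rV[R]_n | forall i, A i (x 0%R i)])%E.
Proof.
elim: n A => [|n IH] A mA Ay; first by rewrite /= diracE mem_set// => -[].
by rewrite lebesgue_rV_rectS// mule_gt0//; exact: (IH (fun i => A (lift ord0 i))).
Qed.

Context {N : nat}.
Local Notation E := 'rV[R]_N.
Local Notation mu := (@lebesgue_rV R N).

Definition box (a b : 'I_N -> R) : set E := [set x | forall i, a i < x 0 i < b i].

(** Closed cubes are used for truncation: they are compact and exhaust the space. *)
Definition cube (n : nat) : set E := [set x | forall i, `|x 0 i| <= n%:R].

Lemma boxE a b : box a b = [set x | forall i, `]a i, b i[%classic (x 0 i)].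
Proof. by apply/seteqP; split => x /= H i; have := H i; rewrite in_itv. Qed.

Lemma cubeE n : cube n = [set x | forall i, `[(- n%:R : R), n%:R]%classic (x 0 i)].
Proof.
by apply/seteqP; split => x /= H i; have := H i; rewrite in_itv/= ler_norml.
Qed.

Lemma measurable_box a b : measurable (box a b).
Proof. by rewrite boxE; exact: (@measurable_rect N (fun i => `]a i, b i[%classic)). Qed.

Lemma measurable_cube n : measurable (cube n).
Proof. by rewrite cubeE; exact: (@measurable_rect N (fun=> `[(- n%:R : R), n%:R]%classic)). Qed.

Lemma cube_lty n : (mu (cube n) < +oo)%E.
Proof.
rewrite cubeE; apply: (@lebesgue_rV_rect_lty N (fun=> `[(- n%:R : R), n%:R]%classic)) => // i.
by rewrite lebesgue_measure_itv/=; case: ifP; rewrite ltry.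
Qed.

Lemma box_gt0 a b : (forall i, a i < b i) -> (0 < mu (box a b))%E.
Proof.
move=> ab; rewrite boxE; apply: (@lebesgue_rV_rect_gt0 N (fun i => `]a i, b i[%classic)) => // i.
by rewrite lebesgue_measure_itv/= lte_fin ab -EFinB lte_fin subr_gt0.
Qed.

Lemma cube_mono m n : (m <= n)%N -> cube m `<=` cube n.
Proof. by move=> mn x Hx i; rewrite (le_trans (Hx i))// ler_nat. Qed.

Lemma cube_compact n : compact (cube n).
Proof.
rewrite cubeE; apply: (@rV_compact _ N (fun=> `[(- n%:R : R), n%:R]%classic)) => i.
exact: segment_compact.
Qed.

Lemma in_cube (x : E) : exists n, forall m, (n <= m)%N -> cube m x.
Proof.
have [n Hn] : exists n : nat, \sum_i `|x 0 i| <= n%:R.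
  by exists (Num.bound (\sum_i `|x 0 i|)); rewrite ltW// archi_boundP// sumr_ge0.
exists n => m nm i; rewrite (le_trans _ (le_trans Hn _)) ?ler_nat//.
by rewrite (bigD1 i)//= lerDl sumr_ge0.
Qed.

Lemma compact_in_cube (K : set E) : compact K -> exists n, K `<=` cube n.
Proof.
move=> /compact_bounded[M [Mr KM]].
have [n Hn] : exists n : nat, M < n%:R.
  exists (Num.bound `|M|); rewrite (le_lt_trans (ler_norm M))//.
  exact/archi_boundP.
exists n => x /(KM _ Hn) /= xn i; apply: le_trans xn; rewrite /Num.norm/= mx_normrE.
exact: (@le_bigmax _ _ _ 0 (fun ij : 'I_1 * 'I_N => `|x ij.1 ij.2|) (0, i)).
Qed.

End boxes.

Import HBNNSimple.

(** * From boxes to arbitrary functions *)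

Section box_induction.
Context {R : realType} {N : nat}.
Local Notation E := 'rV[R]_N.
Local Notation mu := (@lebesgue_rV R N).
Local Notation integ f := (mu.-integrable setT (EFin \o f)).

Definition boxes : set (set E) := [set B | exists ab : ('I_N -> R) * ('I_N -> R), B = box ab.1 ab.2].

Lemma boxes_setI_closed : setI_closed boxes.
Proof.
move=> _ _ [[a b] ->] [[a' b'] ->].
exists (fun i => Num.max (a i) (a' i), fun i => Num.min (b i) (b' i)).
apply/seteqP; split=> x /=.
  by move=> [H H'] i; have := H i; have := H' i; rewrite lt_min gt_max => /andP[-> ->] /andP[-> ->].
by move=> H; split=> i; have := H i; rewrite /= lt_min gt_max => /andP[/andP[? ?] /andP[? ?]]; apply/andP.
Qed.

(** Boxes form a pi-system generating the sigma-algebra, which is what the Dynkin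
    induction below needs. *)
Lemma measurable_rV_boxes : @measurable _ E = <<s boxes >>.
Proof.
apply/seteqP; split; last first.
  apply: smallest_sub; first exact: sigma_algebra_measurable.
  by move=> _ [[a b] ->]; exact: measurable_box.
apply: smallest_sub; first exact: smallest_sigma_algebra.
move=> B [[i j] _ [Y mY <-]] /=.
have mf : measurable_fun (setT : set (g_sigma_algebraType boxes))
    (fun x : g_sigma_algebraType boxes => (x : E) i j).
  apply: (measurability (@RGenOpens.G R) (RGenOpens.measurableE R)).
  move=> _ [_ [a [b ->]] <-]; rewrite setTI.
  rewrite (_ : _ @^-1` _ = \bigcup_k (box (fun l => if l == j then a else - k%:R)
      (fun l => if l == j then b else k%:R) : set (g_sigma_algebraType boxes))).
    apply: bigcupT_measurable => k; apply: sub_sigma_algebra.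
    by exists (fun l => if l == j then a else - k%:R, fun l => if l == j then b else k%:R).
  apply/seteqP; split=> x /=.
    rewrite in_itv/= => xab; have [n Hn] := in_cube (x : E).
    exists n.+1 => //= l; case: eqP => [->|_]; first by rewrite -(ord1 i).
    by rewrite -ltr_norml (le_lt_trans (Hn n (leqnn _) l))// ltr_nat.
  by move=> [k _ /(_ j)]; rewrite eqxx in_itv/= (ord1 i).
have := mf measurableT Y mY; by [].
Qed.

Lemma sqint_indic (A : set E) : measurable A -> (mu A < +oo)%E -> sqint mu (\1_A : E -> R).
Proof.
move=> mA Ay; split; first exact: measurable_indic.
rewrite (_ : (fun x => _) = \1_A :> (E -> R)); last first.
  by apply/funext => x; rewrite indicE; case: (_ \in _); rewrite ?expr1n ?expr0n.
apply/integrableP; split; first by apply/measurable_EFinP; exact: measurable_indic.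
under eq_integral do rewrite /= ger0_norm//.
by rewrite integral_indic// setIT.
Qed.

Let B n : set E := box (fun=> - n%:R) (fun=> n%:R).

Let mB n : measurable (B n). Proof. exact: measurable_box. Qed.

Lemma box_lty a b : (mu (box a b) < +oo)%E.
Proof.
rewrite boxE; apply: (@lebesgue_rV_rect_lty _ N (fun i => `]a i, b i[%classic)) => // i.
by rewrite lebesgue_measure_itv/=; case: ifP; rewrite ltry.
Qed.

Lemma cube_sub_box n : cube n `<=` B n.+1.
Proof.
by move=> x Hx i; rewrite -ltr_norml (le_lt_trans (Hx i))// ltr_nat.
Qed.

Variable P : (E -> R) -> Prop.
Hypothesis Plin : forall a f g, P f -> P g -> P (fun x => a * f x + g x).
Hypothesis Pbox : forall a b, P \1_(box a b).
Hypothesis Plim : forall (F : nat -> E -> R) (f : E -> R) (M : R) n, (forall k, measurable_fun setT (F k)) ->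
  (forall k x, `|F k x| <= M * \1_(cube n) x) -> (forall x, F k x @[k --> \oo] --> f x) ->
  (forall k, P (F k)) -> P f.

Let P0 : P (fun=> 0).
Proof.
have := Plin (-1) (Pbox (fun=> 0) (fun=> 0)) (Pbox (fun=> 0) (fun=> 0)).
by under eq_fun do rewrite mulN1r addNr.
Qed.

Let Pset n A : measurable A -> P \1_(A `&` B n).
Proof.
rewrite measurable_rV_boxes; move: A.
apply: (@dynkin_induction _ E boxes (fun A => P \1_(A `&` B n)) measurable_rV_boxes).
- exact: boxes_setI_closed.
- by rewrite setTI; exact: Pbox.
- move=> A bA; have [] := @boxes_setI_closed A (B n) bA.
    by exists (fun=> - n%:R, fun=> n%:R).
  by move=> [a b] ->; exact: Pbox.
- move=> A _ PA; have := Plin (-1) PA (Pbox (fun=> - n%:R) (fun=> n%:R)).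
  rewrite -/(B n); congr P; apply/funext => x; rewrite !indicE !in_setI in_setC.
  by case: (x \in A); case: (x \in B n); rewrite /=; ring.
- move=> F mF tF PF.
  pose U m := [set x | exists2 k, (k < m)%N & F k x].
  have UE m x : \sum_(k < m) \1_(F k `&` B n) x = (\1_(U m `&` B n) x : R).
    have [[[k km Fk] Bx]|nU] := pselect ((U m `&` B n) x).
      rewrite [RHS]indicE mem_set; last by split => //; exists k.
      rewrite (bigD1 (Ordinal km))//= indicE mem_set// big1 ?addr0// => i ik.
      rewrite indicE memNset// => -[Fi _]; move/eqP: ik; apply; apply: val_inj => /=.
      by apply: tF => //; exists x.
    rewrite [RHS]indicE memNset// big1// => i _.
    by rewrite indicE memNset// => -[Fi Bx]; apply: nU; split => //; exists i.
  apply: (@Plim (fun m x => \sum_(k < m) \1_(F k `&` B n) x) _ 1 n).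
  + by move=> m; apply: measurable_sum => i; apply: measurable_indic; exact: measurableI.
  + move=> m x; rewrite UE mul1r ger0_norm ?indicE ?ler0n// ler_nat.
    case: (x \in cube n) / (boolP (x \in cube n)) => [_|xc]; first by rewrite leq_b1.
    rewrite memNset// => -[_ Bx]; move: xc; rewrite notin_setE; apply => i.
    by rewrite ler_norml; have /andP[/ltW -> /ltW ->] := Bx i.
  + move=> x; under eq_fun do rewrite UE.
    apply: cvg_near_cst.
    have [[[k _ Fk] Bx]|nU] := pselect ((\bigcup_k F k `&` B n) x).
      exists k.+1 => // m /= km; rewrite !indicE !mem_set//; split => //; first by exists k.
      by exists k.
    apply: nearW => m; rewrite !indicE !memNset// => -[[k _ Fk] Bx].
    by apply: nU; split => //; exists k.
  + elim=> [|m IH]; first by under eq_fun do rewrite big_ord0.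
    under eq_fun do rewrite big_ord_recr/= addrC -[X in X + _]mul1r.
    exact: Plin.
Qed.

Let P_sum (I : Type) (r : seq I) (F : I -> E -> R) : (forall i, P (F i)) ->
  P (fun x => \sum_(i <- r) F i x).
Proof.
move=> PF; elim: r => [|i r IH]; first by under eq_fun do rewrite big_nil.
under eq_fun do rewrite big_cons -[X in X + _]mul1r.
exact: Plin.
Qed.

Let Pnonneg (f : E -> R) M n : measurable_fun setT f ->
  (forall x, 0 <= f x <= M * \1_(B n) x) -> P f.
Proof.
move=> mf f0; have mEf : measurable_fun setT (EFin \o f) by exact/measurable_EFinP.
pose F k : E -> R := nnsfun_approx measurableT mEf k.
have f0' x : setT x -> (0 <= (EFin \o f) x)%E by move=> _; rewrite lee_fin; case/andP: (f0 x).
have Ff x : F k x @[k --> \oo] --> f x.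
  have := @cvg_nnsfun_approx _ _ _ _ measurableT _ mEf f0' x Logic.I.
  by move/fine_cvg.
have leFf k x : 0 <= F k x <= f x.
  rewrite fun_ge0/= -lee_fin /F nnsfun_approxE.
  exact: (le_approx k f0').
have FB k x : ~ B n x -> F k x = 0.
  move=> nB; have /andP[F0 Fl] := leFf k x; apply/eqP; rewrite eq_le F0 andbT.
  apply: (le_trans Fl); case/andP: (f0 x) => _.
  by rewrite indicE memNset// mulr0.
apply: (@Plim F f `|M| n).
- by move=> k; exact: measurable_funP.
- move=> k x; have /andP[F0 Fl] := leFf k x; rewrite ger0_norm//.
  have /andP[_ fM] := f0 x; apply: (le_trans Fl); apply: (le_trans fM).
  have [Bx|Bx] := pselect (B n x); last first.
    by rewrite indicE memNset// mulr0 mulr_ge0// indicE ler0n.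
  rewrite !indicE !mem_set ?mulr1 ?ler_norm// => i.
  by rewrite ler_norml; have /andP[/ltW -> /ltW ->] := Bx i.
- exact: Ff.
- move=> k.
  have -> : F k = fun x => \sum_(y <- finmap.enum_fset (fset_set (range (F k))))
      (y * \1_(F k @^-1` [set y] `&` B n) x + 0).
    apply/funext => x; rewrite [LHS]fimfunE fsbig_finite; last exact: fimfunP.
    apply: eq_bigr => y _; rewrite addr0.
    have [->|y0] := eqVneq y 0; first by rewrite !mul0r.
    congr (_ * _); rewrite !indicE in_setI.
    have [Bx|Bx] := pselect (B n x); first by rewrite (mem_set Bx) andbT.
    rewrite (memNset Bx) andbF memNset// => /= Fy.
    by move/eqP: y0; apply; rewrite -Fy; exact: FB.
  apply: P_sum => y; apply: Plin => //; apply: Pset.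
  by rewrite -[X in measurable X]setTI; exact: measurable_funP.
Qed.

(** Monotone class argument: a linear property that holds for boxes and survives bounded
    limits holds for measurable sets by the pi-lambda theorem, then for simple functions,
    then for their limits. *)
Theorem bounded_box_ind (f : E -> R) M n : measurable_fun setT f ->
  (forall x, `|f x| <= M * \1_(cube n) x) -> P f.
Proof.
move=> mf fM.
have Pp (g : E -> R) : measurable_fun setT g -> (forall x, `|g x| <= M * \1_(cube n) x) ->
    P (fun x => Num.max (g x) 0).
  move=> mg gM; apply: (@Pnonneg _ `|M| n.+1); first exact: measurable_maxr.
  move=> x; rewrite le_max lexx orbT/= ge_max (le_trans (ler_norm _) (le_trans (gM x) _))/=.
    by rewrite mulr_ge0// indicE ler0n.
  rewrite (@le_trans _ _ (`|M| * \1_(cube n) x))// ?ler_wpM2r ?ler_norm ?indicE ?ler0n//.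
  rewrite ler_wpM2l// ler_nat; case: (boolP (x \in cube n)) => //.
  by rewrite inE => /cube_sub_box xB; rewrite mem_set.
have Pf : P (fun x => -1 * Num.max (- f x) 0 + Num.max (f x) 0).
  apply: Plin; last exact: Pp.
  apply: (Pp (fun x => - f x)); first exact: measurableT_comp.
  by move=> x; rewrite normrN.
suff -> : f = fun x => -1 * Num.max (- f x) 0 + Num.max (f x) 0 by [].
apply/funext => x; rewrite mulN1r.
by rewrite /Num.max; case: ltP => ?; case: ltP => ?; lra.
Qed.

Hypothesis Plim2 : forall (F : nat -> E -> R) (f g : E -> R),
  (forall k, measurable_fun setT (F k)) -> sqint mu g ->
  (forall k x, `|F k x| <= `|g x|) -> (forall x, F k x @[k --> \oo] --> f x) ->
  (forall k, P (F k)) -> P f.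

(** Truncate both the values of f and its support, and let the truncation go to
    infinity. *)
Theorem sqint_box_ind (f : E -> R) : sqint mu f -> P f.
Proof.
move=> fi; have mf := fi.1.
pose A k : set E := [set x | `|f x| <= k%:R] `&` cube k.
have mA k : measurable (A k).
  apply: measurableI; last exact: measurable_cube.
  rewrite (_ : [set x | _] = f @^-1` `[- k%:R, k%:R]); last first.
    by apply/seteqP; split => x /=; rewrite in_itv/= ler_norml.
  by rewrite -[X in measurable X]setTI; exact: mf.
pose F k x := f x * \1_(A k) x.
have mF k : measurable_fun setT (F k).
  by apply: measurable_funM => //; exact: measurable_indic.
apply: (@Plim2 F f f) => //.
- by move=> k x; rewrite normrM ler_piMr// indicE; case: (_ \in _); rewrite ?normr1 ?normr0.
- move=> x; apply: cvg_near_cst; have [n Hn] := in_cube x.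
  exists (maxn n (Num.bound (f x))) => // k /=; rewrite geq_max => /andP[nk bk].
  rewrite /F indicE mem_set ?mulr1//; split => /=; last exact: Hn.
  by rewrite (le_trans (ltW (unstable.ltr_norm_bound _)))// ler_nat.
- move=> k; apply: (@bounded_box_ind _ k%:R k) => // x.
  rewrite normrM !indicE; have [[fx cx]|nA] := pselect (A k x).
    by rewrite !mem_set// normr1 !mulr1.
  by rewrite (memNset nA) normr0 mulr0 mulr_ge0.
Qed.

End box_induction.

Section separability.
Context {R : realType} {N : nat}.
Local Notation E := 'rV[R]_N.
Local Notation mu := (@lebesgue_rV R N).
Local Notation dist f g := (dot mu (fun x => f x - g x) (fun x => f x - g x)).

Let step := (rat * ({ffun 'I_N -> rat} * {ffun 'I_N -> rat}))%type.

Let rbox (ab : {ffun 'I_N -> rat} * {ffun 'I_N -> rat}) : set E :=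
  box (fun i => ratr (ab.1 i)) (fun i => ratr (ab.2 i)).

Let Q (s : seq step) (x : E) : R := \sum_(t <- s) ratr t.1 * \1_(rbox t.2) x.

Let sqint_box a b : sqint mu (\1_(box a b) : E -> R).
Proof. apply: sqint_indic; [exact: measurable_box|exact: box_lty]. Qed.

Let Qi s : sqint mu (Q s).
Proof. by apply: sqint_sum => t; apply: sqintZ; exact: sqint_box. Qed.

Let P f := sqint mu f /\ forall e, 0 < e -> exists s, dist f (Q s) < e.

Let Pclosed f : sqint mu f -> (forall e, 0 < e -> exists2 h, P h & dist f h < e) -> P f.
Proof.
move=> fi fh; split => // e e0; have e4 : 0 < e / 4 by rewrite divr_gt0.
have [h [hi Ph] fhe] := fh _ e4; have [s hs] := Ph _ e4; exists s.
have := dist_triangle fi hi (Qi s); move: fhe hs; set a := dot _ _ _; set b := dot _ _ _; lra.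
Qed.

Let Plim2 : forall (F : nat -> E -> R) (f g : E -> R),
  (forall k, measurable_fun setT (F k)) -> sqint mu g ->
  (forall k x, `|F k x| <= `|g x|) -> (forall x, F k x @[k --> \oo] --> f x) ->
  (forall k, P (F k)) -> P f.
Proof.
move=> F f g mF gi Fg Ff PF.
have mf : measurable_fun setT f.
  by exact: (measurable_fun_cvg mF (fun x _ => Ff x)).
have [||fi cv] := sqint_dominated mF mf _ gi _.
- exact: aeW.
- by apply: aeW => x n; exact: Fg.
apply: Pclosed => // e e0.
move/cvgrPdist_lt : cv => /(_ _ e0)[n _ /(_ n (leqnn n))].
rewrite sub0r normrN ger0_norm ?dot_ge0// => H; exists (F n) => //.
by apply: le_lt_trans H; rewrite le_eqVlt; apply/orP; left; apply/eqP/eq_Rintegral => x _; ring.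
Qed.

Let Plin : forall a f g, P f -> P g -> P (fun x => a * f x + g x).
Proof.
move=> a f g Pf Pg; have [[fi Qf] [gi Qg]] := (Pf, Pg).
have rat_case (r : rat) : P (fun x => ratr r * f x + g x).
  split; first exact: sqint_lin.
  move=> e e0; pose C : R := 4 * (ratr r ^+ 2 + 1).
  have C0 : 0 < C by rewrite mulr_gt0// ltr_wpDl// sqr_ge0.
  have eC : 0 < e / C by rewrite divr_gt0.
  have [s hs] := Qf _ eC; have [t ht] := Qg _ eC.
  pose u := [seq (r * z.1, z.2) | z <- s] ++ t.
  have QE x : Q u x = ratr r * Q s x + Q t x.
    rewrite /Q big_cat big_map/= mulr_sumr; congr (_ + _).
    by apply: eq_bigr => z _; rewrite rmorphM/= mulrA.
  exists u.
  have Bf := sqintB fi (Qi s); have Bg := sqintB gi (Qi t).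
  have := dist_triangle (sqintZ (ratr r) Bf) (@sqint0 _ E R mu) (sqintZ (-1) Bg).
  have -> : dist (fun x => ratr r * f x + g x) (Q u) =
      dist (fun x => ratr r * (f x - Q s x)) (fun x => -1 * (g x - Q t x)).
    by apply: eq_Rintegral => x _; rewrite QE; ring.
  have -> : dist (fun x => ratr r * (f x - Q s x)) (fun=> 0) = ratr r ^+ 2 * dist f (Q s).
    by rewrite -dotZZ//; apply: eq_Rintegral => x _; ring.
  have -> : dist (fun=> 0) (fun x => -1 * (g x - Q t x)) = dist g (Q t).
    by apply: eq_Rintegral => x _; ring.
  move: hs ht; rewrite !ltr_pdivlMr// /C.
  have := dot_ge0 mu (fun x => f x - Q s x); have := dot_ge0 mu (fun x => g x - Q t x).
  have := sqr_ge0 (ratr r : R).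
  move: (dot mu (fun x => f x - Q s x) _) (dot mu (fun x => g x - Q t x) _)
    (dot mu (fun x => ratr r * _ - _) _) (ratr r ^+ 2) => d1 d2 d3 q *; nra.
apply: Pclosed; first exact: sqint_lin.
move=> e e0; pose C := dot mu f f + 1.
have C0 : 0 < C by rewrite ltr_wpDl// dot_ge0.
pose d := Num.min 1 (e / C).
have d0 : 0 < d by rewrite lt_min ltr01 divr_gt0.
have [r] : exists q : rat, ratr q \in `]a, (a + d)[%R by apply: rat_in_itvoo; rewrite ltrDl.
rewrite in_itv/= => /andP[ar rd]; exists (fun x => ratr r * f x + g x) => //.
have -> : dist (fun x => a * f x + g x) (fun x => ratr r * f x + g x) =
    (a - ratr r) ^+ 2 * dot mu f f.
  by rewrite -dotZZ//; apply: eq_Rintegral => x _; ring.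
have d1 : d <= 1 by rewrite ge_min lexx.
have dC : d * C <= e by rewrite -ler_pdivlMr// ge_min lexx orbT.
have f0 := dot_ge0 mu f.
have : (a - ratr r) ^+ 2 <= d ^+ 2.
  by rewrite -[leLHS]sqrrN opprB lerXn2r ?nnegrE; lra.
move: dC; rewrite /C; move: (dot mu f f) f0 ((a - ratr r) ^+ 2) => D D0 q dC qd.
have : q <= d by rewrite (le_trans qd)// expr2 ler_piMr// ltW.
move=> qd'; have : q * D <= d * D by rewrite ler_wpM2r.
nra.
Qed.

Let Pbox a b : P \1_(box a b).
Proof.
have Pr ab : P \1_(rbox ab).
  split; first exact: sqint_box.
  move=> e e0; exists [:: (1, ab)].
  rewrite [dot _ _ _](_ : _ = 0)//.
  rewrite -[RHS](mul0r (fine (mu setT))) -[in RHS]Rintegral_cst//.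
  by apply: eq_Rintegral => x _; rewrite /Q big_seq1 rmorph1 mul1r subrr mulr0.
have inv0 k : (0 : R) < k.+1%:R^-1 by rewrite invr_gt0 ltr0n.
have /choice[p Hp] : forall k : nat, exists p : {ffun 'I_N -> rat},
    forall i, a i < ratr (p i) < a i + k.+1%:R^-1.
  move=> k; have /choice[p Hp] : forall i, exists q : rat, a i < ratr q < a i + k.+1%:R^-1.
    move=> i; have [q] : exists q : rat, ratr q \in `]a i, (a i + k.+1%:R^-1)[%R.
      by apply: rat_in_itvoo; rewrite ltrDl.
    by rewrite in_itv/=; exists q.
  by exists [ffun i => p i] => i; rewrite ffunE.
have /choice[q Hq] : forall k : nat, exists p : {ffun 'I_N -> rat},
    forall i, b i - k.+1%:R^-1 < ratr (p i) < b i.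
  move=> k; have /choice[q Hq] : forall i, exists q : rat, b i - k.+1%:R^-1 < ratr q < b i.
    move=> i; have [q] : exists q : rat, ratr q \in `](b i - k.+1%:R^-1), b i[%R.
      by apply: rat_in_itvoo; rewrite ltrBlDr ltrDl.
    by rewrite in_itv/=; exists q.
  by exists [ffun i => q i] => i; rewrite ffunE.
have sub k : rbox (p k, q k) `<=` box a b.
  move=> x /= H i; have /andP[H1 H2] := H i.
  have /andP[P1 _] := Hp k i; have /andP[_ Q1] := Hq k i.
  by rewrite (lt_trans P1 H1) (lt_trans H2 Q1).
apply: (@Plim2 (fun k => \1_(rbox (p k, q k))) _ \1_(box a b)).
- by move=> k; apply: measurable_indic; exact: measurable_box.
- exact: sqint_box.
- move=> k x; rewrite !indicE !ger0_norm ?ler0n// ler_nat.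
  by case: (boolP (_ \in rbox _)) => //; rewrite inE => /sub xB; rewrite mem_set.
- move=> x; apply: cvg_near_cst.
  have [xB|xB] := pselect (box a b x); last first.
    by apply: nearW => k; rewrite !indicE !memNset// => /sub.
  have : \forall k \near \oo, forall i : 'I_N, ratr (p k i) < x 0 i < ratr (q k i).
    apply: filter_forall => i; have /andP[ax xb] := xB i.
    have dd0 : 0 < Num.min (x 0 i - a i) (b i - x 0 i) by rewrite lt_min !subr_gt0 ax.
    have := near_infty_natSinv_lt (PosNum dd0); apply: filterS => k /=.
    rewrite lt_min => /andP[H1 H2].
    have /andP[_ P1] := Hp k i; have /andP[Q1 _] := Hq k i.
    apply/andP; split.
      by apply: (lt_trans P1); rewrite -ltrBrDl.
    by apply: (lt_trans _ Q1); rewrite ltrBrDr -ltrBrDl.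
  by apply: filterS => k xk; rewrite !indicE !mem_set.
- by move=> k.
Qed.

(** Rational combinations of indicators of boxes with rational vertices are countable in
    number and dense. *)
Theorem sqint_separable : exists2 q : nat -> E -> R, (forall n, sqint mu (q n)) &
  forall f e, sqint mu f -> 0 < e -> exists n, dist f (q n) < e.
Proof.
exists (fun n => if unpickle n is Some s then Q s else fun=> 0).
  by move=> n; case: unpickle => [s|]; [exact: Qi|exact: sqint0].
move=> f e fi e0.
have [_ /(_ _ e0)[s Hs]] : P f.
  apply: (@sqint_box_ind R N P Plin Pbox _ Plim2 f fi) => F g M n mF FM Fg PF.
  apply: (@Plim2 F g (fun x => M * \1_(cube n) x)) => //.
    by apply: sqintZ; apply: sqint_indic; [exact: measurable_cube|exact: cube_lty].
  by move=> k x; rewrite (le_trans (FM k x))// ler_norm.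
by exists (pickle s); rewrite pickleK.
Qed.

End separability.

(** * Smooth functions *)

Section one_variable.
Context {R : realType}.

Lemma derivable1_cvg (f : R -> R) (x d : R) : is_derive x (1 : R) f d -> f y @[y --> x] --> f x.
Proof.
move=> fd; have /derivable1_diffP/differentiable_continuous : derivable f x 1 by [].
by [].
Qed.

(** A smooth function of one variable is given together with all its derivatives, so that
    the chain rule can be iterated by shifting the index. *)
Definition smooth_family (F : nat -> R -> R) := forall n (x : R), is_derive x (1 : R) (F n) (F n.+1 x).

(** The n-th derivative of cos is cos (x + n pi / 2). *)
Definition cos_family (n : nat) (x : R) := cos (x + n%:R * (pi / 2)).

Lemma cos_family_smooth : smooth_family cos_family.
Proof.
move=> n x.
have E : is_derive x (1 : R) (cos \o (fun y => y + n%:R * (pi / 2)))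
    (- sin (x + n%:R * (pi / 2)) * 1).
  apply: is_derive1_comp; exact: is_derive_shift.
apply: is_derive_eq E _; rewrite mulr1 -cosDpihalf /cos_family.
by congr cos; ring.
Qed.

(** The derivatives of exp (-1/x) are P_n (1/x) exp (-1/x), with P_n given by
    this recursion. *)
Fixpoint expinv_poly (n : nat) : {poly R} :=
  if n is m.+1 then 'X ^+ 2 * (expinv_poly m - (expinv_poly m)^`()) else 1.

Definition expinv (n : nat) (x : R) : R :=
  if 0 < x then (expinv_poly n).[x^-1] * expR (- x^-1) else 0.

(** The exponential dominates each monomial, by one term of its power series. *)
Lemma poly_expRN_bounded (p : {poly R}) : exists C, forall t, 0 < t -> `|p.[t]| * expR (- t) <= C.
Proof.
exists (\sum_(i < size p) `|p`_i| * i`!%:R) => t t0.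
rewrite horner_coef; apply: (@le_trans _ _ ((\sum_(i < size p) `|p`_i * t ^+ i|) * expR (- t))).
  by rewrite ler_wpM2r ?expR_ge0// ler_norm_sum.
rewrite mulr_suml; apply: ler_sum => i _.
rewrite normrM -mulrA ler_wpM2l// (ger0_norm (exprn_ge0 _ (ltW t0))).
rewrite expRN ler_pdivrMr ?expR_gt0//; case: (nat_of_ord i) => [|n].
  by rewrite expr0 fact0 mul1r (le_trans _ (expR_ge1Dx t))// lerDl ltW.
have := expR_ge1Dxn n (ltW t0).
rewrite -lerBrDl => H.
have F0 : 0 < n.+1`!%:R :> R by rewrite ltr0n fact_gt0.
rewrite mulrC -ler_pdivrMr//; lra.
Qed.

(** The only delicate point is 0, where the difference quotient from the right is
    Q (1/h) exp (-1/h) h with Q a polynomial, hence O(h). *)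
Lemma expinv_smooth : smooth_family expinv.
Proof.
move=> n x.
have [x0|x0|->] := ltgtP x 0.
- have N0 : \forall y \near x, cst 0 y = expinv n y.
    near=> y; rewrite /expinv ltNge (_ : y <= 0)//; apply: ltW; near: y.
    exact: lt_nbhsl.
  have E : expinv n.+1 x = 0 by rewrite /expinv ltNge (ltW x0).
  rewrite E; apply: DeriveDef.
    by apply: (near_eq_derivable _ (derivable_cst 0 _ _)).
  by rewrite -(near_eq_derive (1 : R) N0) derive_cst.
- pose p := expinv_poly n.
  have N0 : \forall y \near x, (fun y => (horner p \o GRing.inv) y * (expR \o (fun z => - z^-1)) y) y = expinv n y.
    near=> y; rewrite /expinv (_ : 0 < y)//; near: y.
    exact: lt_nbhsr.
  have xN : x != 0 by rewrite gt_eqF.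
  have Dinv : is_derive x (1 : R) (fun y : R => y^-1) (- x ^- 2).
    have := @is_deriveV R id x 1 1 xN (is_derive_id _ _).
    by move=> H; apply: is_derive_eq H _; rewrite -[LHS]/(_ * _) mulr1.
  have D1 : is_derive x (1 : R) (horner p \o (fun y : R => y^-1)) (p^`().[x^-1] * - x ^- 2).
    exact: is_derive1_comp.
  have D2 : is_derive x (1 : R) (expR \o (fun z : R => - z^-1)) (expR (- x^-1) * - (- x ^- 2)).
    exact: is_derive1_comp.
  have D := is_deriveM D1 D2.
  have E : expinv n.+1 x = (horner p \o (fun y : R => y^-1)) x *: (expR (- x^-1) * - (- x ^- 2)) +
      (expR \o (fun z : R => - z^-1)) x *: (p^`().[x^-1] * - x ^- 2).
    rewrite /expinv x0 /= hornerM hornerXn hornerD hornerN -/p -!exprVn.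
    rewrite -![_ *: _]/(_ * _); ring.
  rewrite E; apply: DeriveDef.
    by apply: (near_eq_derivable N0).
  by rewrite -(near_eq_derive (1 : R) N0) derive_val.
- have -> : expinv n.+1 0 = 0 by rewrite /expinv ltxx.
  have [C HC] := poly_expRN_bounded ('X ^+ 2 * expinv_poly n).
  have C0 : 0 <= C.
    by apply: le_trans (HC 1 ltr01); rewrite mulr_ge0// expR_ge0.
  have cv : h^-1 *: ((expinv n \o shift 0) (h *: 1) - expinv n 0) @[h --> 0^'] --> (0 : R).
    apply/cvgrPdist_le => e e0; near=> h.
    rewrite sub0r normrN /= addr0 /expinv ltxx subr0.
    rewrite -![_ *: _]/(_ * _) mulr1.
    have [h0|h0] := ltP 0 h; last by rewrite mulr0 normr0 ltW.
    have hi : 0 < h^-1 by rewrite invr_gt0.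
    have := HC _ hi; rewrite hornerM hornerXn !normrM (ger0_norm (expR_ge0 _)).
    rewrite (ger0_norm (ltW hi)) -!mulrA => H.
    apply: (@le_trans _ _ (h * C)).
      by rewrite -ler_pdivrMl//.
    have : `|h| <= e / (C + 1).
      near: h; apply: dnbhs0_le; rewrite divr_gt0//; lra.
    rewrite (ger0_norm (ltW h0)) ler_pdivlMr; last lra.
    nra.
  apply: DeriveDef; first by apply/cvg_ex; exists 0.
  exact/cvg_lim.
Unshelve. all: by end_near. Qed.

Lemma expinv_gt0 x : 0 < x -> 0 < expinv 0 x.
Proof. by move=> x0; rewrite /expinv x0 hornerC mul1r expR_gt0. Qed.

Lemma expinv_eq0 n x : x <= 0 -> expinv n x = 0.
Proof. by move=> x0; rewrite /expinv ltNge x0. Qed.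

Lemma expinv_ge0 x : 0 <= expinv 0 x.
Proof. by have [x0|x0] := leP x 0; [rewrite expinv_eq0|exact/ltW/expinv_gt0]. Qed.

Lemma expinv_le1 x : expinv 0 x <= 1.
Proof.
have [x0|x0] := leP x 0; first by rewrite expinv_eq0.
rewrite /expinv x0 hornerC mul1r -expR0 ler_expR lerNl oppr0 invr_ge0 ltW//.
Qed.

Lemma expinv_cvg1 x : 0 < x -> expinv 0 (k.+1%:R * x) @[k --> \oo] --> (1 : R).
Proof.
move=> x0.
have E : (fun k : nat => expinv 0 (k.+1%:R * x)) = expR \o (fun k : nat => - (x^-1 * k.+1%:R^-1)).
  by apply/funext => k /=; rewrite /expinv mulr_gt0 ?ltr0n// hornerC mul1r invfM mulrC.
rewrite E -[X in _ --> X]expR0; apply: continuous_cvg; first exact: continuous_expR.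
rewrite -oppr0 -[X in - X](mulr0 x^-1); apply: cvgN; apply: cvgM; first exact: cvg_cst.
exact: cvg_harmonic.
Qed.

End one_variable.

Section directional.
Context {R : realType} {N : nat}.
Local Notation E := 'rV[R]_N.
Local Notation e_ i := (delta_mx 0 i : E).

(** Directional derivatives are derivatives of functions of one variable; the calculus of
    one variable then applies. *)
Lemma is_derive_line (f : E -> R) (x v : E) (d : R) :
  is_derive x v f d <-> is_derive (0 : R) (1 : R) (fun t : R => f (t *: v + x)) d.
Proof.
have E : (fun h : R => h^-1 *: ((f \o shift x) (h *: v) - f x)) =
    (fun h : R => h^-1 *: (((fun t : R => f (t *: v + x)) \o shift (0 : R)) (h *: (1 : R)) -
      (fun t : R => f (t *: v + x)) 0)).
  by apply/funext => h /=; rewrite addr0 scale0r add0r [h *: 1]mulr1.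
split=> -[D V]; apply: DeriveDef.
- by rewrite /derivable -E.
- by rewrite /derive -E.
- by rewrite /derivable E.
- by rewrite /derive E.
Qed.

Lemma is_derive_along (f : E -> R) (x v : E) (s : R) (d : R) :
  is_derive (s *: v + x) v f d -> is_derive s (1 : R) (fun t : R => f (t *: v + x)) d.
Proof.
move=> /is_derive_line D.
have -> : (fun t : R => f (t *: v + x)) =
    (fun t : R => f (t *: v + (s *: v + x))) \o shift (- s).
  by apply/funext => t /=; rewrite addrA -scalerDl subrK.
rewrite -[d]mulr1; apply: is_derive1_comp; last exact: is_derive_shift.
by rewrite /= subrr.
Qed.

Lemma is_derive_shiftE (f : E -> R) (x v a : E) (d : R) :
  is_derive (x + a) v f d -> is_derive x v (fun y => f (y + a)) d.
Proof.
move=> /is_derive_line D; apply/is_derive_line.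
by under eq_fun do rewrite -addrA.
Qed.

Lemma is_derive_comp_dir (F : R -> R) (f : E -> R) (x v : E) (dF df : R) :
  is_derive (f x) (1 : R) F dF -> is_derive x v f df -> is_derive x v (F \o f) (dF * df).
Proof.
move=> DF /is_derive_line Df; apply/is_derive_line.
apply: (@is_derive1_comp R F (fun t : R => f (t *: v + x))) Df.
by rewrite scale0r add0r.
Qed.

Definition smooth (f : E -> R) := forall k, Ck k f.

Lemma continuous_addf (f g : E -> R) : continuous f -> continuous g ->
  continuous (fun x => f x + g x).
Proof. by move=> cf cg x; exact: (@cvgD _ _ _ (nbhs x) _ f g _ _ (cf x) (cg x)). Qed.

Lemma continuous_mulf (f g : E -> R) : continuous f -> continuous g ->
  continuous (fun x => f x * g x).
Proof. by move=> cf cg x; exact: (@cvgM _ _ (nbhs x) _ f g _ _ (cf x) (cg x)). Qed.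

Lemma continuous_shiftf (f : E -> R) (a : E) : continuous f ->
  continuous (fun x : E => f (x + a)).
Proof.
move=> cf x; have ca : {for x, continuous (fun x : E => x + a)}.
  exact: (@cvgD _ _ _ (nbhs x) _ id (cst a) _ _ (@cvg_id _ _) (@cvg_cst _ _ _ (nbhs x) _)).
exact: (continuous_comp ca (cf _)).
Qed.

Lemma Ck_continuous k (f : E -> R) : Ck k f -> continuous f.
Proof. by case: k => [[]|k []]. Qed.

Lemma Ck_S k (f : E -> R) : Ck k.+1 f -> Ck k f.
Proof.
elim: k f => [f [cf _]|k IH f [cf df]]; first by [].
by split=> // i; have [d /IH] := df i.
Qed.

Lemma Ck_cst k (c : R) : Ck k (fun _ : E => c).
Proof.
elim: k c => [|k IH] c; first by split => //; exact: cst_continuous.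
split=> [|i]; first exact: cst_continuous.
split=> [x|]; first exact: derivable_cst.
rewrite (_ : partial i _ = fun=> 0); first exact: IH.
by apply/funext => x; rewrite /partial derive_cst.
Qed.

Lemma Ck_add k (f g : E -> R) : Ck k f -> Ck k g -> Ck k (fun x => f x + g x).
Proof.
elim: k f g => [|k IH] f g Cf Cg; have cf := Ck_continuous Cf; have cg := Ck_continuous Cg.
  by split => //; exact: continuous_addf.
split=> [|i]; first exact: continuous_addf.
have [df Cdf] := Cf.2 i; have [dg Cdg] := Cg.2 i.
split=> [x|]; first exact: derivableD.
rewrite (_ : partial i _ = fun x => partial i f x + partial i g x); first exact: IH.
by apply/funext => x; rewrite /partial -deriveD.
Qed.

Lemma partialM i (f g : E -> R) x : derivable f x (e_ i) -> derivable g x (e_ i) ->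
  partial i (fun x => f x * g x) x = f x * partial i g x + g x * partial i f x.
Proof. by move=> df dg; rewrite /partial (deriveM df dg). Qed.

Lemma Ck_mul k (f g : E -> R) : Ck k f -> Ck k g -> Ck k (fun x => f x * g x).
Proof.
elim: k f g => [|k IH] f g Cf Cg; have cf := Ck_continuous Cf; have cg := Ck_continuous Cg.
  by split => //; exact: continuous_mulf.
split=> [|i]; first exact: continuous_mulf.
have [df Cdf] := Cf.2 i; have [dg Cdg] := Cg.2 i.
split=> [x|]; first exact: derivableM.
rewrite (_ : partial i _ = fun x => f x * partial i g x + g x * partial i f x).
  by apply: Ck_add; apply: IH => //; exact: Ck_S.
by apply/funext => x; rewrite partialM.
Qed.

Lemma partial_comp i F (f : E -> R) n x : smooth_family F -> derivable f x (e_ i) ->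
  is_derive x (e_ i) (F n \o f) (F n.+1 (f x) * partial i f x).
Proof.
by move=> sF df; apply: is_derive_comp_dir; [exact: sF|exact: derivableP].
Qed.

Lemma Ck_comp F n k (f : E -> R) : smooth_family F -> Ck k f -> Ck k (F n \o f).
Proof.
move=> sF; elim: k n f => [|k IH] n f Cf; have cf := Ck_continuous Cf.
  by split => // x; exact: (continuous_comp (cf x) (derivable1_cvg (sF n (f x)))).
split=> [x|i].
  exact: (continuous_comp (cf x) (derivable1_cvg (sF n (f x)))).
have [df Cdf] := Cf.2 i.
split=> [x|]; first by case: (partial_comp n sF (df x)).
rewrite (_ : partial i _ = fun x => (F n.+1 \o f) x * partial i f x).
  by apply: Ck_mul => //; apply: IH; exact: Ck_S.
by apply/funext => x; case: (partial_comp n sF (df x)).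
Qed.

Lemma Ck_coord k j : Ck k (fun x : E => x 0 j).
Proof.
have D (x : E) i : is_derive x (e_ i) (fun x : E => x 0 j) (i == j)%:R.
  apply/is_derive_line.
  have -> : (fun t : R => (t *: e_ i + x) 0 j) = ((i == j)%:R \*: (id : R -> R)) + cst (x 0 j).
    by apply/funext => t; rewrite !mxE eqxx eq_sym/= mulrC.
  have H := is_deriveD (is_deriveZ (i == j)%:R (is_derive_id (0 : R) (1 : R)))
    (is_derive_cst (x 0 j) (0 : R) (1 : R)).
  by apply: is_derive_eq H _; rewrite addr0; exact: mulr1.
case: k => [|k]; first by split => // x; exact: coord_continuous.
split=> [x|i]; first exact: coord_continuous.
split=> [x|]; first by case: (D x i).
rewrite (_ : partial i _ = fun=> (i == j)%:R); first exact: Ck_cst.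
by apply/funext => x; case: (D x i).
Qed.

Lemma Ck_shift k (f : E -> R) (a : E) : Ck k f -> Ck k (fun x : E => f (x + a)).
Proof.
elim: k f => [|k IH] f Cf; have cf := Ck_continuous Cf.
  by split => //; exact: continuous_shiftf.
split=> [|i]; first exact: continuous_shiftf.
have [df Cdf] := Cf.2 i.
have D x : is_derive x (e_ i) (fun y => f (y + a)) (partial i f (x + a)).
  by apply: is_derive_shiftE; exact: derivableP.
split=> [x|]; first by case: (D x).
rewrite (_ : partial i _ = fun x => partial i f (x + a)); first exact: IH.
by apply/funext => x; case: (D x).
Qed.

Lemma Ck_prod k (I : Type) (r : seq I) (F : I -> E -> R) : (forall i, Ck k (F i)) ->
  Ck k (fun x => \prod_(i <- r) F i x).
Proof.
move=> CF; elim: r => [|i r IH]; first by under eq_fun do rewrite big_nil; exact: Ck_cst.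
by under eq_fun do rewrite big_cons; exact: Ck_mul.
Qed.

Lemma test_functionP (f : E -> R) n : smooth f -> (forall x, ~ cube n x -> f x = 0) ->
  test_function f.
Proof.
move=> sf f0; split=> //; apply: (subclosed_compact _ (@cube_compact R N n)).
  exact: closed_closure.
have cc : closed (@cube R N n).
  by apply: compact_closed; [exact: norm_hausdorff|exact: cube_compact].
rewrite [X in _ `<=` X](iffLR (closure_id _) cc); apply: closureS => x /=.
by apply: contraNP => /f0 ->.
Qed.

Lemma test_support (f : E -> R) : test_function f ->
  exists n, forall x, ~ cube n x -> f x = 0.
Proof.
move=> [_ /compact_in_cube[n Kn]]; exists n => x nx; apply/eqP/negP => /negP fx.
by apply: nx; apply: Kn; exact: subset_closure.
Qed.

Lemma testM (f g : E -> R) : test_function f -> smooth g -> test_function (fun x => f x * g x).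
Proof.
move=> tf sg; have [n Hn] := test_support tf; apply: (@test_functionP _ n).
  by move=> k; apply: Ck_mul; [exact: tf.1|exact: sg].
by move=> x /Hn ->; rewrite mul0r.
Qed.

Lemma test_shift (f : E -> R) (a : E) : test_function f -> test_function (fun x => f (x + a)).
Proof.
move=> tf; have [n Hn] := test_support tf; have [m Hm] := in_cube a.
apply: (@test_functionP _ (n + m)).
  by move=> k; apply: Ck_shift; exact: tf.1.
move=> x xnm; apply: Hn => xan; apply: xnm => i.
have := xan i; have := Hm m (leqnn _) i; rewrite mxE natrD => ai xi.
by rewrite -[x 0 i](addrK (a 0 i)) (le_trans (ler_normB _ _))// lerD.
Qed.

Lemma smooth_derivable (f : E -> R) i x : smooth f -> derivable f x (e_ i).
Proof. by move=> sf; have [_ /(_ i)[+ _]] := sf 1%N. Qed.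

Lemma smooth_partial (f : E -> R) i : smooth f -> smooth (partial i f).
Proof. by move=> sf k; have [_ /(_ i)[_]] := sf k.+1. Qed.

Lemma smooth_continuous (f : E -> R) : smooth f -> continuous f.
Proof. by move=> sf; exact: (Ck_continuous (sf 0%N)). Qed.

Lemma test_smooth (f : E -> R) : test_function f -> smooth f.
Proof. by case. Qed.

Lemma smooth_partialP (f : E -> R) i x : smooth f -> is_derive x (e_ i) f (partial i f x).
Proof. by move=> sf; exact/derivableP/smooth_derivable. Qed.

Lemma test_partial (f : E -> R) i : test_function f -> test_function (partial i f).
Proof.
move=> tf; split; first by move=> k; exact: smooth_partial tf.1 k.
apply: (subclosed_compact _ tf.2); first exact: closed_closure.
rewrite [X in _ `<=` X](iffLR (closure_id _) (@closed_closure _ _)).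
apply: closureS => x /=; apply: contraNP => Kx.
rewrite /partial (@near_eq_derive _ _ _ _ (cst 0)) ?derive_cst//.
have oK : open (~` closure [set x | f x != 0]) by rewrite openC; exact: closed_closure.
have : nbhs x (~` closure [set x | f x != 0]) by exact: open_nbhs_nbhs.
apply: filterS => y Ky; apply/eqP/negP => /negP fy; apply: Ky; exact: subset_closure.
Qed.

Lemma partial_shift (f : E -> R) (a : E) i x : smooth f ->
  partial i (fun y => f (y + a)) x = partial i f (x + a).
Proof.
move=> sf.
by case: (is_derive_shiftE (derivableP (@smooth_derivable f i (x + a) sf))).
Qed.

Lemma test_bounded (f : E -> R) : test_function f ->
  exists M n, 0 <= M /\ forall x, `|f x| <= M * \1_(cube n) x.
Proof.
move=> tf; have [n Hn] := test_support tf.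
have cf : {within cube n, continuous f}.
  by apply: continuous_subspaceT; exact: smooth_continuous tf.1.
have [M [Mr HM]] := compact_bounded (continuous_compact cf (@cube_compact R N n)).
exists (`|M| + 1), n; split; first by rewrite addr_ge0.
move=> x; rewrite indicE; have [xn|xn] := pselect (cube n x).
  rewrite mem_set// mulr1; apply: (HM (`|M| + 1)).
    by rewrite ltr_pwDr// ler_norm.
  by exists x.
by rewrite memNset// mulr0 Hn// normr0.
Qed.

Lemma test_measurable (f : E -> R) : test_function f -> measurable_fun setT f.
Proof. by move=> tf; apply: continuous_measurable_rV; exact: smooth_continuous tf.1. Qed.

Lemma test_sqint (f : E -> R) : test_function f -> sqint (@lebesgue_rV R N) f.
Proof.
move=> tf; have [M [n [M0 fM]]] := test_bounded tf.
apply: (@sqint_le _ _ _ _ _ (fun x => M * \1_(cube n) x)).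
- exact: test_measurable.
- by apply: aeW => x; rewrite (le_trans (fM x))// ler_norm.
- by apply/sqintZ/sqint_indic; [exact: measurable_cube|exact: cube_lty].
Qed.

(** ** Bump functions *)

(** As k grows these functions increase to the indicator of the box, hence they serve both
    as mollifiers (k fixed, box shrinking) and as approximations of indicators. *)
Definition bumpf (a b : 'I_N -> R) (k : nat) (x : E) : R :=
  \prod_i (expinv 0 (k%:R * (x 0 i - a i)) * expinv 0 (k%:R * (b i - x 0 i))).

Lemma bump_out a b k x : ~ box a b x -> bumpf a b k x = 0.
Proof.
move=> nx; have [i Hi] : exists i, ~ (a i < x 0 i < b i) by exact/existsNP.
rewrite /bumpf (bigD1 i)//=; move/negP : Hi; rewrite negb_and -!leNgt.
move=> /orP[H|H].
  by rewrite (@expinv_eq0 _ 0 (_ * (x 0 i - a i))) ?mul0r// mulr_ge0_le0// subr_le0.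
by rewrite (@expinv_eq0 _ 0 (_ * (b i - x 0 i))) ?mulr0 ?mul0r// mulr_ge0_le0// subr_le0.
Qed.

Lemma bump_gt0 a b k x : box a b x -> 0 < bumpf a b k.+1 x.
Proof.
move=> Hx; rewrite /bumpf prodr_gt0// => i _; have /andP[H1 H2] := Hx i.
by rewrite mulr_gt0// expinv_gt0// mulr_gt0 ?ltr0n// subr_gt0.
Qed.

Lemma bump_ge0 a b k x : 0 <= bumpf a b k x.
Proof. by rewrite prodr_ge0// => i _; rewrite mulr_ge0// expinv_ge0. Qed.

Lemma bump_le1 a b k x : bumpf a b k x <= 1.
Proof.
rewrite /bumpf (le_trans (@ler_prod _ _ _ _ _ (fun=> 1) _)) ?big1// => i _.
by rewrite mulr_ge0 ?expinv_ge0// mulr_ile1 ?expinv_ge0 ?expinv_le1.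
Qed.

Lemma box_in_cube a b : exists n, box a b `<=` @cube R N n.
Proof.
have [n Hn] := in_cube (\row_i (`|a i| + `|b i|) : E).
exists n => x Hx i; have /andP[H1 H2] := Hx i; have := Hn n (leqnn _) i; rewrite mxE.
rewrite ger0_norm ?addr_ge0// => H; rewrite ler_norml.
have := ler_norm (b i); have := ler_norm (- a i); rewrite normrN.
have := normr_ge0 (a i); have := normr_ge0 (b i) => *; apply/andP; split; lra.
Qed.

Lemma bump_smooth a b k : smooth (bumpf a b k).
Proof.
move=> m; apply: Ck_prod => i.
have F1 : Ck m (fun x : E => k%:R * (x 0 i - a i)).
  by apply: Ck_mul; [exact: Ck_cst|apply: Ck_add; [exact: Ck_coord|exact: Ck_cst]].
have F2 : Ck m (fun x : E => k%:R * (b i - x 0 i)).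
  apply: Ck_mul; first exact: Ck_cst.
  apply: Ck_add; first exact: Ck_cst.
  under eq_fun do rewrite -mulN1r; apply: Ck_mul; [exact: Ck_cst|exact: Ck_coord].
by apply: Ck_mul; [exact: (Ck_comp 0 (@expinv_smooth R) F1)|exact: (Ck_comp 0 (@expinv_smooth R) F2)].
Qed.

Lemma bump_test a b k : test_function (bumpf a b k).
Proof.
have [n Hn] := box_in_cube a b; apply: (@test_functionP _ n); first exact: bump_smooth.
by move=> x nx; apply: bump_out => /Hn.
Qed.

Lemma bump_cvg a b x : bumpf a b k.+1 x @[k --> \oo] --> (\1_(box a b) x : R).
Proof.
have [xB|xB] := pselect (box a b x); last first.
  rewrite indicE memNset//; under eq_fun do rewrite bump_out//; exact: cvg_cst.
rewrite indicE mem_set//= [X in _ --> X](_ : _ = \prod_(i < N) (1 : R)); last by rewrite big1.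
apply: cvg_big => [|i _]; first exact: mul_continuous.
rewrite -[X in _ --> X](mulr1 (1 : R)); have /andP[H1 H2] := xB i.
by apply: cvgM; apply: expinv_cvg1; rewrite subr_gt0.
Qed.

End directional.

(** * Mollification *)

Section mollification.
Context {R : realType} {N : nat}.
Local Notation E := 'rV[R]_N.
Local Notation mu := (@lebesgue_rV R N).
Local Notation integ f := (mu.-integrable setT (EFin \o f)).
Local Notation e_ i := (delta_mx 0 i : E).

(** Dominated convergence is about sequences, continuity about filters; this is the
    bridge between them. *)
Lemma seq_cvg (f : E -> R) (x : E) :
  (forall u : nat -> E, (forall k, ball x 1 (u k)) -> u k @[k --> \oo] --> x ->
    f (u k) @[k --> \oo] --> f x) -> f y @[y --> x] --> f x.
Proof.
move=> H; apply/(@cvgrPdist_lt _ _ _ (nbhs x)) => e e0; apply/not_notP => nH.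
have /choice[u Hu] : forall k : nat, exists y, ball x k.+1%:R^-1 y /\ e <= `|f x - f y|.
  move=> k; apply/not_notP => nk; apply: nH.
  have : nbhs x (ball x (k.+1%:R^-1 : R)) by apply: nbhsx_ballx; rewrite invr_gt0.
  apply: filterS => y xy; rewrite ltNge; apply/negP => ef; apply: nk.
  by exists y.
have ux : u k @[k --> \oo] --> x.
  apply/cvg_ballP => d d0; have := near_infty_natSinv_lt (PosNum d0).
  by apply: filterS => k /= kd; apply: le_ball (ltW kd) _ (Hu k).1.
have u1 k : ball x 1 (u k).
  by apply: le_ball (Hu k).1; rewrite invf_le1// ler1n.
have /cvgrPdist_lt/(_ e e0)[k _ /(_ k (leqnn k))] := H u u1 ux.
by rewrite ltNge (Hu k).2.
Qed.

Lemma Lp_loc1P (f : E -> R) : Lp_loc 1 f <->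
  measurable_fun setT f /\ forall n, integ (fun x => f x * \1_(cube n) x).
Proof.
have E1 (K : set E) : f \_ K = fun x => f x * \1_K x.
  by apply/funext => x; rewrite patchE indicE; case: ifP => xK; rewrite ?mulr1 ?mulr0.
split=> [lf|[mf fi] K cK].
  have fi n : integ (fun x => f x * \1_(cube n) x).
    by rewrite -E1; apply/Lfun1_integrable/lf; exact: cube_compact.
  split=> //; apply: (measurable_fun_cvg (fun n => integ_measurable (fi n))) => x _.
  apply: cvg_near_cst; have [n Hn] := in_cube x; exists n => // m /= nm.
  by rewrite indicE mem_set ?mulr1//; exact: Hn.
apply/Lfun1_integrable; have [n Kn] := compact_in_cube cK.
apply: (integ_le _ _ (integrable_norm (fi n))).
  rewrite E1; apply: measurable_funM => //; apply: measurable_indic.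
  rewrite -(setCK K); apply: measurableC; apply: open_measurable_rV; rewrite openC.
  by apply: compact_closed cK; exact: norm_hausdorff.
move=> x; rewrite E1 /= !normrM ler_wpM2l// !indicE !ger0_norm// ler_nat.
by case: (boolP (x \in K)) => //; rewrite inE => /Kn xn; rewrite mem_set.
Qed.

Lemma loc1_measurable (f : E -> R) : Lp_loc 1 f -> measurable_fun setT f.
Proof. by move=> /Lp_loc1P[]. Qed.

Lemma loc1_mul (f h : E -> R) M n : Lp_loc 1 f -> measurable_fun setT h ->
  (forall x, `|h x| <= M * \1_(cube n) x) -> integ (fun x => f x * h x).
Proof.
move=> /Lp_loc1P[mf fi] mh hM.
apply: (integ_le _ _ (integZ M (integrable_norm (fi n)))); first exact: measurable_funM.
move=> x /=; rewrite !normrM (ger0_norm (_ : 0 <= \1_(cube n) x :> R)) ?indicE//.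
by rewrite mulrCA ler_wpM2l// -indicE.
Qed.

Lemma loc1_test (f h : E -> R) : Lp_loc 1 f -> test_function h -> integ (fun x => f x * h x).
Proof.
move=> lf th; have [M [n [M0 hM]]] := test_bounded th.
by apply: (loc1_mul lf _ hM); exact: test_measurable.
Qed.

Lemma loc1_le (f g : E -> R) : measurable_fun setT f -> {ae mu, forall x, `|f x| <= `|g x|} ->
  Lp_loc 1 g -> Lp_loc 1 f.
Proof.
move=> mf fg /Lp_loc1P[mg gi]; apply/Lp_loc1P; split=> // n.
apply: (integ_ae_le _ _ (integrable_norm (gi n))).
  by apply: measurable_funM => //; apply: measurable_indic; exact: measurable_cube.
by apply: filterS fg => x fg /=; rewrite !normrM ler_wpM2r.
Qed.

Lemma loc1_lin a (f g : E -> R) : Lp_loc 1 f -> Lp_loc 1 g -> Lp_loc 1 (fun x => a * f x + g x).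
Proof. by apply: Lp_loc_lincomb. Qed.

Lemma loc1B (f g : E -> R) : Lp_loc 1 f -> Lp_loc 1 g -> Lp_loc 1 (fun x => f x - g x).
Proof.
by move=> lf lg; have := loc1_lin (-1) lg lf; under eq_fun do rewrite mulN1r addrC.
Qed.

Lemma continuous_loc1 (f : E -> R) : continuous f -> Lp_loc 1 f.
Proof.
move=> cf; have mf := continuous_measurable_rV cf; apply/Lp_loc1P; split=> // n.
have cw : {within cube n, continuous f} by exact: continuous_subspaceT.
have [M [Mr HM]] := compact_bounded (continuous_compact cw (@cube_compact R N n)).
have i1 : sqint mu (\1_(cube n) : E -> R).
  by apply: sqint_indic; [exact: measurable_cube|exact: cube_lty].
have i2 := integZ (`|M| + 1) (integ_mul i1 i1); apply: (integ_le _ _ i2).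
  by apply: measurable_funM => //; case: i1.
move=> x; rewrite normrM (ger0_norm (_ : 0 <= \1_(cube n) x :> R)) ?indicE//.
have [xn|xn] := pselect (cube n x); last by rewrite (memNset xn) !mulr0.
rewrite (mem_set xn) !mulr1; apply: (HM (`|M| + 1)); last by exists x.
by rewrite ltr_pwDr// ler_norm.
Qed.

(** Local square integrability with cubes in place of arbitrary compact sets. *)
Definition loc2 (f : E -> R) :=
  measurable_fun setT f /\ forall n, sqint mu (fun x => f x * \1_(cube n) x).

Lemma indic01 (A : set E) x : \1_A x = 0 :> R \/ \1_A x = 1 :> R.
Proof. by rewrite indicE; case: (_ \in _); [right|left]. Qed.

Lemma sqint_cube n : sqint mu (\1_(cube n) : E -> R).
Proof. by apply: sqint_indic; [exact: measurable_cube|exact: cube_lty]. Qed.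

Lemma sqint_loc2 (f : E -> R) : sqint mu f -> loc2 f.
Proof.
move=> fi; split=> [|n]; first by case: fi.
apply: (sqint_le _ _ fi).
  by apply: measurable_funM; [case: fi|case: (sqint_cube n)].
by apply: aeW => x; case: (indic01 (cube n) x) => ->; rewrite ?mulr0 ?mulr1 ?normr0.
Qed.

Lemma loc2_mul (f g : E -> R) : loc2 f -> loc2 g -> Lp_loc 1 (fun x => f x * g x).
Proof.
move=> [mf fi] [mg gi]; apply/Lp_loc1P; split=> [|n]; first exact: measurable_funM.
have := integ_mul (fi n) (gi n); apply: integ_ae.
  by apply: measurable_funM; [exact: measurable_funM|case: (sqint_cube n)].
apply: aeW => x; case: (indic01 (cube n) x) => ->; ring.
Qed.

Lemma loc2_cst c : loc2 (fun=> c).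
Proof. by split=> // n; apply: sqintZ; exact: sqint_cube. Qed.

Lemma loc2_loc1 (f : E -> R) : loc2 f -> Lp_loc 1 f.
Proof.
by move=> fi; have := loc2_mul fi (loc2_cst 1); under eq_fun do rewrite mulr1.
Qed.

Lemma loc2_bounded (f h : E -> R) M n : loc2 f -> measurable_fun setT h ->
  (forall x, `|h x| <= M * \1_(cube n) x) -> sqint mu (fun x => f x * h x).
Proof.
move=> [mf fi] mh hM; apply: (sqint_le _ _ (sqintZ M (fi n))); first exact: measurable_funM.
apply: aeW => x /=; rewrite mulrCA [leLHS]normrM [leRHS]normrM ler_wpM2l//.
by rewrite (le_trans (hM x))// ler_norm.
Qed.

Lemma loc2_test (f h : E -> R) : loc2 f -> test_function h -> sqint mu (fun x => f x * h x).
Proof.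
move=> lf th; have [M [n [M0 hM]]] := test_bounded th.
by apply: (loc2_bounded lf _ hM); exact: test_measurable.
Qed.

Lemma loc2_le (f g : E -> R) : measurable_fun setT f -> {ae mu, forall x, `|f x| <= `|g x|} ->
  loc2 g -> loc2 f.
Proof.
move=> mf fg [mg gi]; split=> // n; apply: sqint_le (gi n).
  by apply: measurable_funM => //; case: (sqint_cube n).
by apply: filterS fg => x fg /=; rewrite !normrM ler_wpM2r.
Qed.

Lemma loc2_lin a (f g : E -> R) : loc2 f -> loc2 g -> loc2 (fun x => a * f x + g x).
Proof.
move=> [mf fi] [mg gi]; split=> [|n]; first by apply: measurable_funD => //; exact: measurable_funM.
by have := sqint_lin a (fi n) (gi n); under eq_fun do rewrite mulrA -mulrDl.
Qed.

Lemma cube_shift n l (x y : E) : cube n (x - y) -> cube l y -> cube (n + l) x.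
Proof.
move=> H1 H2 i; rewrite -[x 0 i](subrK (y 0 i)) (le_trans (ler_normD _ _))// natrD lerD//.
by have := H1 i; rewrite !mxE.
Qed.

Lemma loc2_shift (f : E -> R) (y : E) : loc2 f -> loc2 (fun x : E => f (x + y)).
Proof.
move=> [mf fi]; split=> [|n]; first exact: measurable_shift.
have [l Hl] := in_cube (- y).
have := sqint_shift y (fi (n + l)%N); apply: sqint_le.
  by apply: measurable_funM; [exact: measurable_shift|case: (sqint_cube n)].
apply: aeW => x; have [xn|xn] := pselect (cube n x); last first.
  by rewrite [\1_(cube n) x]indicE (memNset xn) mulr0 normr0.
rewrite !indicE (mem_set xn) mem_set//; apply: (@cube_shift n l _ y).
  by rewrite addrK.
by move=> i; have := Hl l (leqnn _) i; rewrite mxE normrN.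
Qed.

Lemma loc1_shift (f : E -> R) (y : E) : Lp_loc 1 f -> Lp_loc 1 (fun x : E => f (x + y)).
Proof.
move=> /Lp_loc1P[mf fi]; apply/Lp_loc1P; split=> [|n]; first exact: measurable_shift.
have [l Hl] := in_cube (- y).
have := integrable_norm (integ_shift y (fi (n + l)%N)); apply: integ_le.
  by apply: measurable_funM; [exact: measurable_shift|case: (sqint_cube n)].
move=> x; have [xn|xn] := pselect (cube n x); last first.
  by rewrite [\1_(cube n) x]indicE (memNset xn) mulr0 normr0 /=.
rewrite /= !indicE (mem_set xn) mem_set//; apply: (@cube_shift n l _ y).
  by rewrite addrK.
by move=> i; have := Hl l (leqnn _) i; rewrite mxE normrN.
Qed.

(** On a set of finite measure, |f|^2 <= |f|^p + 1. *)
Lemma Lp_loc_loc2 (p : R) (f : E -> R) : 2 <= p -> Lp_loc p f -> loc2 f.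
Proof.
move=> p2 lf.
have p1 : 1 <= p by lra.
have key n : sqint mu (fun x => f x * \1_(cube n) x).
  have E1 : f \_ (cube n) = fun x => f x * \1_(cube n) x.
    by apply/funext => x; rewrite patchE indicE; case: ifP => xK; rewrite ?mulr1 ?mulr0.
  have := lf _ (@cube_compact R N n); rewrite E1 => L.
  have mfn : measurable_fun setT (fun x => f x * \1_(cube n) x).
    by move: L; rewrite inE => /andP[/[!inE]].
  split=> //; have ip := Lfun_integrable p1 L.
  have i1 := integ_mul (sqint_cube n) (sqint_cube n).
  apply: (integ_le _ _ (integD ip i1)); first exact: measurable_funX.
  move=> x; case: (indic01 (cube n) x) => ->.
    by rewrite !mulr0 expr0n normr0 addr0 powR_ge0.
  rewrite !mulr1 ger0_norm ?sqr_ge0// -(real_normK (num_real (f x))).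
  have [f1|f1] := leP (`|f x|) 1.
    rewrite (le_trans _ (_ : 1 <= _))// ?lerDr ?powR_ge0// expr_le1//.
  rewrite -powR_mulrn// ler_wpDr//; apply: ler_powR => //; exact: ltW.
split=> //; apply: (measurable_fun_cvg (fun n => (key n).1)) => x _.
apply: cvg_near_cst; have [n Hn] := in_cube x; exists n => // m /= nm.
by rewrite indicE mem_set ?mulr1//; exact: Hn.
Qed.

(** The convolution of phi with the reflection of rho: the shifted argument is that of the
    smooth factor, so derivatives fall on rho with a sign, exactly as in the definition of
    a weak derivative. *)
Definition corr (phi rho : E -> R) (x : E) : R := \int[mu]_t (phi t * rho (t - x)).

Lemma shift_bound (rho : E -> R) M n l (t u : E) : 0 <= M ->
  (forall x, `|rho x| <= M * \1_(cube n) x) -> cube l u ->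
  `|rho (t - u)| <= M * \1_(cube (n + l)) t.
Proof.
move=> M0 HM ul; apply: (le_trans (HM _)); rewrite ler_wpM2l// !indicE ler_nat.
by case: (boolP (t - u \in cube n)) => //; rewrite inE => tu; rewrite mem_set//; exact: cube_shift ul.
Qed.

Lemma measurable_subr (rho : E -> R) (x : E) : measurable_fun setT rho ->
  measurable_fun setT (fun t : E => rho (t - x)).
Proof. exact: measurable_shift. Qed.

Lemma corr_continuous phi rho : Lp_loc 1 phi -> test_function rho -> continuous (corr phi rho).
Proof.
move=> lphi trho x; have [M [n [M0 HM]]] := test_bounded trho.
have [l Hl] := in_cube x; apply: seq_cvg => u u1 ux.
have ul k : cube l.+1 (u k).
  move=> i; rewrite -natr1 -[u k 0 i](subrK (x 0 i)) addrC (le_trans (ler_normD _ _))//.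
  rewrite lerD//; first exact: Hl.
  have [_ /(_ 0 i)] := u1 k; rewrite /ball/= distrC => /ltW.
  by rewrite /ball_/=.
have mr := test_measurable trho.
have mphi := loc1_measurable lphi.
have [||||| _ +] := @Rdominated _ _ _ mu (fun k t => phi t * rho (t - u k))
   (fun t => phi t * rho (t - x)) (fun t => `|phi t * (M * \1_(cube (n + l.+1)) t)|).
- by move=> k; apply: measurable_funM => //; exact: measurable_subr.
- by apply: measurable_funM => //; exact: measurable_subr.
- apply: aeW => t; apply: cvgM; first exact: cvg_cst.
  have cr : {for t - x, continuous rho} by exact: smooth_continuous trho.1 _.
  have tu : t - u k @[k --> \oo] --> t - x by apply: cvgB => //; exact: cvg_cst.
  exact: (cvg_comp _ _ tu cr).
- apply: integrable_norm; apply: (@loc1_mul _ _ M (n + l.+1)) => //.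
    by apply: measurable_funM => //; case: (sqint_cube (n + l.+1)).
  by move=> y; rewrite ger0_norm// mulr_ge0// indicE.
- apply: aeW => t k; rewrite !normrM ler_wpM2l//.
  by rewrite (le_trans (shift_bound t M0 HM (ul k)))// -normrM ler_norm.
by [].
Qed.

(** Differentiation under the integral sign; the domination is uniform for step lengths
    below 1 because all shifted supports stay in one cube. *)
Lemma corr_derive phi rho i x : Lp_loc 1 phi -> test_function rho ->
  is_derive x (e_ i) (corr phi rho) (- corr phi (partial i rho) x).
Proof.
move=> lphi trho; apply/is_derive_line.
have td := test_partial i trho.
have [M [n [M0 HM]]] := test_bounded td.
have [l Hl] := in_cube x.
have mphi := loc1_measurable lphi.
pose f (h : R) (t : E) := phi t * rho (t - (h *: e_ i + x)).
have cub (h : R) : `]-1, 1[%classic h -> cube l.+1 (h *: e_ i + x).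
  rewrite /= in_itv/= -ltr_norml => h1 j; rewrite !mxE -natr1 addrC (le_trans (ler_normD _ _))//.
  rewrite lerD//; first exact: Hl.
  rewrite normrM; case: (_ && _); rewrite ?normr1 ?normr0 ?mulr1 ?mulr0//; exact: ltW.
have D (h : R) t : is_derive h (1 : R) (f^~ t) (- (phi t * partial i rho (t - (h *: e_ i + x)))).
  have D1 : is_derive (- h) (1 : R) (fun s : R => rho (s *: e_ i + (t - x)))
      (partial i rho (- h *: e_ i + (t - x))).
    by apply: is_derive_along; apply: smooth_partialP; exact: test_smooth.
  have DN : is_derive h (1 : R) (fun s : R => - s) (-1).
    have := is_deriveN (is_derive_id h (1 : R)); by [].
  have D2 := is_derive1_comp D1 DN.
  have D3 := is_deriveZ (phi t) D2.
  have -> : f^~ t = phi t \*: ((fun s : R => rho (s *: e_ i + (t - x))) \o (fun s : R => - s)).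
    apply/funext => s; rewrite /f /=; congr (_ * rho _).
    by rewrite scaleNr opprD addrA [t - _]addrC -addrA.
  apply: is_derive_eq D3 _; rewrite mulrN1 -[_ *: _]/(_ * _) mulrN; congr (- (_ * partial i rho _)).
  by rewrite scaleNr opprD addrCA.
have I0 : `](-1), 1[%classic (0 : R) by rewrite /= in_itv/= ltrN10 ltr01.
have pE h t : partial1of2 f h t = - (phi t * partial i rho (t - (h *: e_ i + x))).
  by rewrite partial1of2E; case: (D h t).
pose G (t : E) : R := `|phi t * (M * \1_(cube (n + l.+1)) t)|.
have H1 h : `](-1), 1[%classic h -> integ (f h).
  by move=> _; apply: loc1_test => //; exact: test_shift.
have H2 h t : `](-1), 1[%classic h -> setT t -> derivable (f^~ t) h 1.
  by move=> _ _; case: (D h t).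
have H3 t : 0 <= G t by exact: normr_ge0.
have H4 : integ G.
  apply: integrable_norm; apply: (@loc1_mul _ _ M (n + l.+1)) => //.
    by apply: measurable_funM => //; case: (sqint_cube (n + l.+1)).
  by move=> y; rewrite ger0_norm// mulr_ge0// indicE.
have H5 h t : `](-1), 1[%classic h -> setT t -> `|partial1of2 f h t| <= G t.
  move=> /cub hl _; rewrite pE /G normrN !normrM ler_wpM2l//.
  by rewrite (le_trans (shift_bound t M0 HM hl))// -normrM ler_norm.
apply: DeriveDef.
  exact: (derivable_under_integral measurableT I0 H1 H2 H3 H4 H5).
rewrite -derive1E (differentiation_under_integral measurableT I0 H1 H2 H3 H4 H5).
under eq_Rintegral do rewrite pE scale0r add0r -mulN1r.
by rewrite RintegralZl// ?mulN1r//; apply: loc1_test => //; exact: test_shift.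
Qed.

Lemma corr_smooth phi rho : Lp_loc 1 phi -> test_function rho -> smooth (corr phi rho).
Proof.
move=> lphi trho k; elim: k rho trho => [|k IH] rho trho.
  by split=> //; exact: corr_continuous.
split=> [|i]; first exact: corr_continuous.
have D x := corr_derive i x lphi trho.
split=> [x|]; first by case: (D x).
rewrite (_ : partial i _ = fun x => -1 * corr phi (partial i rho) x).
  by apply: Ck_mul; [exact: Ck_cst|apply: IH; exact: test_partial].
by apply/funext => x; rewrite mulN1r; case: (D x).
Qed.

Lemma corr_partial phi rho i x : Lp_loc 1 phi -> test_function rho ->
  partial i (corr phi rho) x = - corr phi (partial i rho) x.
Proof. by move=> lphi trho; case: (corr_derive i x lphi trho). Qed.

Lemma corrE phi rho x : Lp_loc 1 phi -> test_function rho ->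
  corr phi rho x = \int[mu]_t (phi (t + x) * rho t).
Proof.
move=> lphi trho; rewrite /corr -(Rintegral_shift x (loc1_test lphi (test_shift (- x) trho))).
by apply: eq_Rintegral => t _; rewrite addrK.
Qed.

(** ** Approximate identities *)

Let mbump (n : nat) : E -> R := @bumpf R N (fun=> - n.+1%:R^-1) (fun=> n.+1%:R^-1) 1%N.

Let mass n : R := \int[mu]_t mbump n t.

Let mbump_integ n : integ (mbump n).
Proof.
have := loc1_test (continuous_loc1 (@cst_continuous _ _ (1 : R))) (bump_test (fun=> - n.+1%:R^-1) (fun=> n.+1%:R^-1) 1).
by under eq_fun do rewrite mul1r.
Qed.

Let mass_gt0 n : 0 < mass n.
Proof.
rewrite lt_neqAle Rintegral_ge0 ?andbT => [|x _]; last exact: bump_ge0.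
apply/negP => /eqP/esym/(Rintegral_eq0 (mbump_integ n) (fun x => bump_ge0 _ _ _ x)) [B [mB B0 HB]].
have : (0 < mu (@box R N (fun=> (- n.+1%:R^-1)%R) (fun=> (n.+1%:R^-1)%R)))%E.
  by apply: box_gt0 => i; rewrite gtrN// invr_gt0.
apply/negP; rewrite -leNgt -B0 le_measure ?inE//; first exact: measurable_box.
by move=> x /(bump_gt0 0) H; apply: HB => /= H0; move: H; rewrite -/(mbump n x) H0 ltxx.
Qed.

Definition mollifier n (x : E) : R := (mass n)^-1 * mbump n x.

Lemma mollifier_test n : test_function (mollifier n).
Proof.
have tb := bump_test (fun=> - n.+1%:R^-1) (fun=> n.+1%:R^-1) 1.
have : test_function (fun x => mbump n x * (mass n)^-1).
  by apply: testM => // k; exact: Ck_cst.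
by rewrite /mollifier; under [in X in _ -> X]eq_fun do rewrite mulrC.
Qed.

Lemma mollifier_ge0 n x : 0 <= mollifier n x.
Proof. by rewrite mulr_ge0 ?invr_ge0 ?(ltW (mass_gt0 n))// bump_ge0. Qed.

Lemma mollifier_integ n : integ (mollifier n).
Proof. exact: integZ. Qed.

Lemma mollifier_mass n : \int[mu]_t mollifier n t = 1.
Proof. by rewrite RintegralZl//= mulVf// gt_eqF//; exact: mass_gt0. Qed.

Lemma mollifier_out n x : ~ box (fun=> - n.+1%:R^-1) (fun=> n.+1%:R^-1) x -> mollifier n x = 0.
Proof. by move=> nx; rewrite /mollifier /mbump bump_out// mulr0. Qed.

(** The averaged functions may depend on n, provided that near the origin they are close
    to c uniformly in all large n. *)
Lemma mollifier_average (T : nat -> E -> R) (c : R) :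
  (forall n, integ (fun s => T n s * mollifier n s)) ->
  (forall e, 0 < e -> exists2 d, 0 < d & exists n0, forall n (s : E), (n0 <= n)%N ->
    (forall i, `|s 0 i| < d) -> `|T n s - c| <= e) ->
  \int[mu]_s (T n s * mollifier n s) @[n --> \oo] --> c.
Proof.
move=> iT HT; apply/cvgrPdist_le => e e0; have [d d0 [n0 Hd]] := HT _ e0.
have [n1 _ Hn1] := near_infty_natSinv_lt (PosNum d0).
exists (maxn n0 n1) => // n /=; rewrite geq_max => /andP[n0n n1n].
have -> : c - \int[mu]_s (T n s * mollifier n s) = \int[mu]_s ((c - T n s) * mollifier n s).
  rewrite -[X in X - _]mulr1 -(mollifier_mass n) -RintegralZl//; last exact: mollifier_integ.
  rewrite -RintegralB//; last exact/integZ/mollifier_integ.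
  by apply: eq_Rintegral => s _; rewrite mulrBl.
have ii : integ (fun s => (c - T n s) * mollifier n s).
  have := integD (integZ c (mollifier_integ n)) (integZ (-1) (iT n)).
  by under eq_fun do rewrite mulN1r -mulNr -mulrDl.
apply: (le_trans (le_normr_Rintegral measurableT ii)).
rewrite -[leRHS]mulr1 -(mollifier_mass n) -RintegralZl//; last exact: mollifier_integ.
apply: le_Rintegral => //; [exact: integrable_norm|exact/integZ/mollifier_integ|].
move=> s _; rewrite normrM (ger0_norm (mollifier_ge0 n s)).
have [sb|sb] := pselect (box (fun=> - n.+1%:R^-1) (fun=> n.+1%:R^-1) s); last first.
  by rewrite mollifier_out// !mulr0.
rewrite ler_wpM2r ?mollifier_ge0// distrC; apply: Hd => // i.
by rewrite ltr_norml (lt_trans _ (_ : - n.+1%:R^-1 < _)) ?ltrN2;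
  have /andP[H1 H2] := sb i; rewrite ?H1 ?(lt_trans H2)//; exact: Hn1.
Qed.

Lemma mollify_cvg phi x : continuous phi ->
  corr phi (mollifier n) x @[n --> \oo] --> phi x.
Proof.
move=> cphi; have lphi := continuous_loc1 cphi.
have -> : (fun n => corr phi (mollifier n) x) =
    fun n => \int[mu]_t (phi (t + x) * mollifier n t).
  by apply/funext => n; rewrite corrE//; exact: mollifier_test.
apply: (@mollifier_average (fun n t => phi (t + x))).
  by move=> n; apply: loc1_test; [exact: loc1_shift|exact: mollifier_test].
move=> e e0; have cx : {for x, continuous phi} by exact: cphi.
have /cvgrPdist_le/(_ e e0)/nbhs_ballP[d /= d0 Hd] := cx.
exists d => //; exists 0%N => n s _ sd; rewrite distrC; apply: Hd.
by split=> // i j; rewrite (ord1 i) !mxE /ball/= -opprB normrN addrK; exact: sd.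
Qed.

End mollification.

(** * Weak derivatives *)

(** Many identities below are first proved for approximations and then passed to the
    limit. *)
Lemma cvg_eq_lim (R : realType) (a b : nat -> R) (l m : R) : (forall n, a n = b n) ->
  a n @[n --> \oo] --> l -> b n @[n --> \oo] --> m -> l = m.
Proof. by move=> /funext -> al bm; exact: (cvg_unique (@Rhausdorff R) al bm). Qed.

Section weak_derivatives.
Context {R : realType} {N : nat}.
Local Notation E := 'rV[R]_N.
Local Notation mu := (@lebesgue_rV R N).
Local Notation integ f := (mu.-integrable setT (EFin \o f)).
Local Notation e_ i := (delta_mx 0 i : E).

Section test_induction.
Variable P : (E -> R) -> Prop.
Hypothesis Plim : forall (F : nat -> E -> R) (f : E -> R) (M : R) n,
  (forall k, measurable_fun setT (F k)) ->
  (forall k x, `|F k x| <= M * \1_(cube n) x) -> (forall x, F k x @[k --> \oo] --> f x) ->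
  (forall k, P (F k)) -> P f.
Hypothesis Ptest : forall f, test_function f -> P f.

(** The two induction principles over boxes become induction principles over test
    functions. *)
Lemma test_box a b : P \1_(box a b).
Proof.
have [n Hn] := box_in_cube a b.
apply: (@Plim (fun k => bumpf a b k.+1) _ 1 n).
- by move=> k; apply: test_measurable; exact: bump_test.
- move=> k x; rewrite mul1r ger0_norm ?bump_ge0//.
  have [xb|xb] := pselect (box a b x); last by rewrite bump_out// indicE.
  by rewrite (le_trans (bump_le1 _ _ _ _))// indicE mem_set//; exact: Hn.
- by move=> x; exact: bump_cvg.
- by move=> k; apply: Ptest; exact: bump_test.
Qed.
End test_induction.

(** The integral of g against every bounded function of compact support vanishes, by
    induction from test functions; taking the indicators of {g >= 0} and {g <= 0} inside
    cubes gives g = 0. *)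
Lemma fundamental_lemma (g : E -> R) : Lp_loc 1 g ->
  (forall eta, test_function eta -> \int[mu]_x (g x * eta x) = 0) ->
  {ae mu, forall x, g x = 0}.
Proof.
move=> lg Hg; have mg := loc1_measurable lg.
pose P f := integ (fun x => g x * f x) /\ \int[mu]_x (g x * f x) = 0.
have Plim (F : nat -> E -> R) (f : E -> R) (M : R) n :
    (forall k, measurable_fun setT (F k)) ->
    (forall k x, `|F k x| <= M * \1_(cube n) x) -> (forall x, F k x @[k --> \oo] --> f x) ->
    (forall k, P (F k)) -> P f.
  move=> mF FM Ff PF.
  have mf : measurable_fun setT f by exact: (measurable_fun_cvg mF (fun x _ => Ff x)).
  have [||||| i cv] := @Rdominated _ _ _ mu (fun k x => g x * F k x) (fun x => g x * f x)
    (fun x => `|g x * (M * \1_(cube n) x)|).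
  - by move=> k; exact: measurable_funM.
  - exact: measurable_funM.
  - by apply: aeW => x; apply: cvgM; [exact: cvg_cst|exact: Ff].
  - apply: integrable_norm; apply: (@loc1_mul _ _ _ _ `|M| n) => //.
      by apply: measurable_funM => //; case: (@sqint_cube R N n).
    by move=> x; rewrite normrM (ger0_norm (_ : 0 <= \1_(cube n) x :> R)) ?indicE.
  - by apply: aeW => x k; rewrite !normrM ler_wpM2l// -normrM (le_trans (FM k x))// ler_norm.
  split => //; rewrite -(cvg_lim _ cv)//; apply/cvg_lim => //.
  by under eq_fun do rewrite (PF _).2; exact: cvg_cst.
have Plin a f h : P f -> P h -> P (fun x => a * f x + h x).
  move=> [fi f0] [hi h0].
  have E1 : (fun x => g x * (a * f x + h x)) = fun x => a * (g x * f x) + g x * h x.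
    by apply/funext => x; ring.
  rewrite /P E1; split; first by apply: integD => //; exact: integZ.
  by rewrite RintegralD//; [rewrite RintegralZl// f0 h0 mulr0 addr0|exact: integZ].
have Ptest f : test_function f -> P f.
  by move=> tf; split; [exact: loc1_test|exact: Hg].
have Pall (f : E -> R) n : measurable_fun setT f -> (forall x, `|f x| <= 1 * \1_(cube n) x) -> P f.
  by apply: bounded_box_ind => //; exact: test_box.
(* with s = 1 or -1 this treats the sets where g >= 0 and where g <= 0 alike *)
have half (s : R) (A : set R) n : measurable A -> (forall y, A y -> 0 <= s * y) ->
    {ae mu, forall x, cube n x -> A (g x) -> s * g x = 0}.
  move=> mA A0; pose B := g @^-1` A `&` cube n.
  have mB : measurable B.
    apply: measurableI; last exact: measurable_cube.
    by rewrite -[X in measurable X]setTI; exact: mg.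
  have [||i0 I0] := Pall \1_B n.
  - exact: measurable_indic.
  - move=> x; rewrite mul1r !indicE ger0_norm// ler_nat.
    by case: (boolP (x \in B)) => //; rewrite inE => -[_ xn]; rewrite mem_set.
  have := Rintegral_eq0 (integZ s i0) _ _.
  move=> /(_ _ _)/(filterS _); apply.
  - move=> x H xn xA; move: H; rewrite indicE mem_set//= ?mulr1//.
  - move=> x; have [[xA xn]|xB] := pselect (B x).
      by rewrite indicE mem_set// mulr1; exact: A0.
    by rewrite indicE memNset// !mulr0.
  - by rewrite RintegralZl// I0 mulr0.
have : {ae mu, forall x, forall n, cube n x -> g x = 0}.
  apply: ae_foralln => n.
  have p := half 1 `[0, +oo[%classic n; have q := half (-1) `]-oo, 0]%classic n.
  apply: filterS2 (p _ _) (q _ _) => //.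
  - move=> x H1 H2 xn; have [g0|g0] := leP 0 (g x).
      by rewrite -[LHS]mul1r; apply: H1 => //=; rewrite in_itv/= g0.
    apply/eqP; rewrite -oppr_eq0 -mulN1r; apply/eqP/H2 => //=.
    by rewrite in_itv/= ltW.
  - by move=> y /=; rewrite in_itv/= andbT mul1r.
  - by move=> y /=; rewrite in_itv/= mulN1r oppr_ge0.
apply: filterS => x H; have [n Hn] := in_cube x; exact: (H n (Hn n (leqnn _))).
Qed.

Lemma weak_partial_uniq i (f f' g g' : E -> R) : {ae mu, forall x, f x = f' x} ->
  weak_partial i f g -> weak_partial i f' g' -> {ae mu, forall x, g x = g' x}.
Proof.
move=> ff [lf lg fg] [lf' lg' fg'].
have : {ae mu, forall x, g x - g' x = 0}.
  apply: fundamental_lemma; first exact: loc1B.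
  move=> eta teta; have td := test_partial i teta.
  have -> : \int[mu]_x ((g x - g' x) * eta x) =
      \int[mu]_x (g x * eta x) - \int[mu]_x (g' x * eta x).
    rewrite -RintegralB//; [|exact: loc1_test..].
    by apply: eq_Rintegral => x _; rewrite mulrBl.
  have := fg _ teta; have := fg' _ teta.
  have -> : \int[mu]_x (f x * partial i eta x) = \int[mu]_x (f' x * partial i eta x).
    apply: Rintegral_ae; [exact: integ_measurable (loc1_test lf td)|
      exact: integ_measurable (loc1_test lf' td)|].
    by apply: filterS ff => x ->.
  by move=> -> /eqP; rewrite eqr_opp => /eqP ->; rewrite subrr.
by apply: filterS => x /eqP; rewrite subr_eq0 => /eqP.
Qed.

Lemma weak_partial_ae i (f f' g g' : E -> R) : measurable_fun setT f' -> measurable_fun setT g' ->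
  {ae mu, forall x, f x = f' x} -> {ae mu, forall x, g x = g' x} ->
  weak_partial i f g -> weak_partial i f' g'.
Proof.
move=> mf mg ff gg [lf lg fg].
have lf' : Lp_loc 1 f' by apply: loc1_le lf => //; apply: filterS ff => x ->.
have lg' : Lp_loc 1 g' by apply: loc1_le lg => //; apply: filterS gg => x ->.
split=> // eta teta; have td := test_partial i teta.
have E1 (u v h : E -> R) : test_function h -> Lp_loc 1 u -> Lp_loc 1 v ->
    {ae mu, forall x, u x = v x} -> \int[mu]_x (u x * h x) = \int[mu]_x (v x * h x).
  move=> th lu lv uv; apply: Rintegral_ae; [exact: integ_measurable (loc1_test lu th)|
      exact: integ_measurable (loc1_test lv th)|].
  by apply: filterS uv => x ->.
by rewrite -(E1 f f')// -(E1 g g')// fg.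
Qed.

Lemma weak_partial_shift i (f g : E -> R) (y : E) : weak_partial i f g ->
  weak_partial i (fun x : E => f (x + y)) (fun x : E => g (x + y)).
Proof.
move=> [lf lg fg]; split; [exact: loc1_shift..|move=> eta teta].
have ts := test_shift (- y) teta.
have E1 (u h : E -> R) : Lp_loc 1 u -> test_function h ->
    \int[mu]_x (u (x + y) * h x) = \int[mu]_x (u x * h (x - y)).
  move=> lu th; rewrite -(Rintegral_shift y (loc1_test lu (test_shift (- y) th))).
  by apply: eq_Rintegral => x _; rewrite addrK.
rewrite !E1//; last exact: test_partial.
rewrite -(fg _ ts); apply: eq_Rintegral => x _; congr (_ * _).
exact/esym/(partial_shift (- y) i x teta.1).
Qed.

(** The integral of a translate of rho does not depend on the translation; differentiate
    with respect to it. *)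
Lemma integral_partial0 i (rho : E -> R) : test_function rho -> \int[mu]_x partial i rho x = 0.
Proof.
move=> trho; have l1 := continuous_loc1 (@cst_continuous E _ (1 : R)).
have C x : corr (cst 1) rho x = corr (cst 1) rho 0.
  rewrite /corr -(Rintegral_shift x (loc1_test l1 (test_shift (- x) trho))).
  by apply: eq_Rintegral => t _; rewrite addrK subr0.
have := corr_partial i 0 l1 trho.
rewrite (_ : corr (cst 1) rho = cst (corr (cst 1) rho 0)); last exact/funext.
rewrite /partial derive_cst => /esym/eqP; rewrite oppr_eq0 /corr => /eqP <-.
by apply: eq_Rintegral => x _; rewrite mul1r subr0.
Qed.

(** Integration by parts: the integral of the derivative of a product with a test
    function vanishes. *)
Lemma weak_partial_smooth i (f : E -> R) : smooth f -> weak_partial i f (partial i f).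
Proof.
move=> sf; have lf := continuous_loc1 (smooth_continuous sf).
have lg := continuous_loc1 (smooth_continuous (smooth_partial i sf)).
split=> // eta teta; have tp := testM teta sf.
have := integral_partial0 i tp.
have -> : \int[mu]_x partial i (fun x => eta x * f x) x =
    \int[mu]_x (partial i f x * eta x) + \int[mu]_x (f x * partial i eta x).
  rewrite -RintegralD//; [|exact: loc1_test|exact: loc1_test lf (test_partial i teta)].
  apply: eq_Rintegral => x _.
  rewrite partialM; [ring|exact: smooth_derivable teta.1|exact: smooth_derivable].
by move=> /eqP; rewrite addrC addr_eq0 => /eqP.
Qed.

(** ** Mollified square-integrable functions converge weakly *)

Let T (g h : E -> R) (s : E) := \int[mu]_x (g (x + s) * h x).

Lemma translation_bound (g h : E -> R) s : sqint mu g -> sqint mu h ->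
  T g h s ^+ 2 <= dot mu g g * dot mu h h.
Proof.
move=> gi hi; have gs := sqint_shift s gi.
by rewrite -(dot_shift s gi gi); exact: cauchy_schwarz.
Qed.

Lemma translation_lin (g f h : E -> R) a s : sqint mu g -> sqint mu f -> sqint mu h ->
  T g (fun x => a * f x + h x) s = a * T g f s + T g h s.
Proof.
move=> gi fi hi; have gs := sqint_shift s gi.
rewrite /T -RintegralZl//; last exact: integ_mul.
rewrite -RintegralD//; [|exact/integZ/integ_mul|exact: integ_mul].
by apply: eq_Rintegral => x _; ring.
Qed.

(** Continuity of translations in the weak sense. For a test function h it is continuity
    of a convolution, and the set of good h is closed under L^2 limits. *)
Lemma translation_continuous (g h : E -> R) : sqint mu g -> sqint mu h ->
  forall e : R, 0 < e -> exists2 d : R, 0 < d &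
    forall s : E, (forall i, `|s 0 i| < d) -> `|T g h s - T g h 0| <= e.
Proof.
move=> gi hi.
pose P h := sqint mu h /\ forall e : R, 0 < e -> exists2 d : R, 0 < d &
    forall s : E, (forall i, `|s 0 i| < d) -> `|T g h s - T g h 0| <= e.
have Plim2 (F : nat -> E -> R) (f k : E -> R) :
    (forall j, measurable_fun setT (F j)) -> sqint mu k ->
    (forall j x, `|F j x| <= `|k x|) -> (forall x, F j x @[j --> \oo] --> f x) ->
    (forall j, P (F j)) -> P f.
  move=> mF ki Fk Ff PF.
  have mf : measurable_fun setT f by exact: (measurable_fun_cvg mF (fun x _ => Ff x)).
  have [||fi cv] := sqint_dominated mF mf _ ki _.
  - exact: aeW.
  - by apply: aeW => x n; exact: Fk.
  split => // e e0; pose C := dot mu g g + 1.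
  have C0 : 0 < C by rewrite ltr_wpDl// dot_ge0.
  have c0 : 0 < (e / 4) ^+ 2 / C by rewrite divr_gt0// exprn_gt0// divr_gt0.
  move/cvgrPdist_lt : cv => /(_ _ c0)[n _ /(_ n (leqnn n))].
  rewrite sub0r normrN ger0_norm ?dot_ge0// => H.
  have Fi := (PF n).1; have Bi := sqintB Fi fi.
  have close s : `|T g f s - T g (F n) s| <= e / 4.
    have -> : T g f s - T g (F n) s = - T g (fun x => F n x - f x) s.
      have -> : (fun x => F n x - f x) = fun x => -1 * f x + F n x.
        by apply/funext => x; ring.
      by rewrite translation_lin//; ring.
    rewrite normrN -(ler_pXn2r (n := 2))// ?nnegrE ?(ltW (divr_gt0 e0 _))//.
    rewrite real_normK ?num_real// (le_trans (translation_bound s gi Bi))//.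
    move: H; rewrite ltr_pdivlMr// /C; have := dot_ge0 mu g.
    have := dot_ge0 mu (fun x => F n x - f x).
    move: (dot mu g g) (dot mu _ _) ((e / 4) ^+ 2) => a b c; nra.
  have e4 : 0 < e / 4 by rewrite divr_gt0.
  have [d d0 Hd] := (PF n).2 _ e4; exists d => // s sd.
  have := Hd s sd; have := close s; have := close 0.
  rewrite -[in T g f s - T g f 0](subrK (T g (F n) s) (T g f s)).
  set a := T g f s; set b := T g (F n) s; set c := T g f 0; set d' := T g (F n) 0.
  move=> H1 H2 H3.
  have -> : a - b + b - c = (a - b) + (b - d') - (c - d') by ring.
  apply: (le_trans (ler_normB _ _)); have := ler_normD (a - b) (b - d'); lra.
have Plim (F : nat -> E -> R) (f : E -> R) (M : R) n :
    (forall k, measurable_fun setT (F k)) ->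
    (forall k x, `|F k x| <= M * \1_(cube n) x) -> (forall x, F k x @[k --> \oo] --> f x) ->
    (forall k, P (F k)) -> P f.
  move=> mF FM Ff PF; apply: (Plim2 F f (fun x => M * \1_(cube n) x)) => //.
    by apply: sqintZ; exact: sqint_cube.
  by move=> k x; rewrite (le_trans (FM k x))// ler_norm.
have Plin a f k : P f -> P k -> P (fun x => a * f x + k x).
  move=> [fi Pf] [ki Pk]; split; first exact: sqint_lin.
  move=> e e0; have e2 : 0 < e / 2 by rewrite divr_gt0.
  have A0 : 0 < `|a| + 1 by rewrite ltr_wpDl.
  have [d1 d10 H1] := Pf _ (divr_gt0 e2 A0); have [d2 d20 H2] := Pk _ e2.
  exists (Num.min d1 d2); first by rewrite lt_min d10.
  move=> s sd; have s1 i : `|s 0 i| < d1 by have := sd i; rewrite lt_min => /andP[].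
  have s2 i : `|s 0 i| < d2 by have := sd i; rewrite lt_min => /andP[].
  rewrite !translation_lin//.
  have -> : a * T g f s + T g k s - (a * T g f 0 + T g k 0) =
    a * (T g f s - T g f 0) + (T g k s - T g k 0) by ring.
  rewrite (le_trans (ler_normD _ _))// [leRHS](splitr e) lerD//; last exact: H2.
  rewrite normrM; have := H1 s s1; rewrite ler_pdivlMr//; apply: le_trans.
  by rewrite mulrC ler_wpM2l// lerDl.
have Ptest f : test_function f -> P f.
  move=> tf; split; first exact: test_sqint.
  have lg := loc2_loc1 (sqint_loc2 gi).
  move=> e e0; have c0 : {for 0, continuous (corr g f)} by exact: corr_continuous.
  have /cvgrPdist_le/(_ e e0)/nbhs_ballP[d /= d0 Hd] := c0.
  have TE s : T g f s = corr g f s by rewrite corrE.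
  exists d => // s sd; rewrite !TE distrC; apply: Hd.
  by split=> // i j; rewrite (ord1 i) mxE /ball/= sub0r normrN; exact: sd.
have : P h by apply: (@sqint_box_ind R N P Plin (test_box Plim Ptest) Plim Plim2 h hi).
by case.
Qed.

(** Mollifying g and pairing with h amounts to averaging the pairings of h with the
    translates of g. *)
Lemma translation_fubini (g h rho : E -> R) : sqint mu g -> sqint mu h -> test_function rho ->
  [/\ integ (fun x => corr g rho x * h x), integ (fun s => T g h s * rho s) &
  \int[mu]_x (corr g rho x * h x) = \int[mu]_s (T g h s * rho s)].
Proof.
move=> gi hi trho; have lg := loc2_loc1 (sqint_loc2 gi).
have mr := test_measurable trho.
have irho : integ (fun s => `|rho s|).
  apply: integrable_norm.
  have := loc1_test (continuous_loc1 (@cst_continuous E _ (1 : R))) trho.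
  by under eq_fun do rewrite mul1r.
pose f (z : E * E) := h z.1 * (g (z.2 + z.1) * rho z.2).
have madd : measurable_fun setT (fun z : E * E => z.2 + z.1).
  apply: measurable_matrixP => i j.
  have -> : (fun z : E * E => (z.2 + z.1) i j) = (fun z => z.2 i j + z.1 i j).
    by apply/funext => z; rewrite mxE.
  apply: measurable_funD.
    exact: (measurableT_comp (measurable_entry i j) measurable_snd).
  exact: (measurableT_comp (measurable_entry i j) measurable_fst).
have mf : measurable_fun setT f.
  apply: measurable_funM; first exact: (measurableT_comp hi.1 measurable_fst).
  apply: measurable_funM; first exact: (measurableT_comp gi.1 madd).
  exact: (measurableT_comp mr measurable_snd).
have mEf : measurable_fun setT (EFin \o f) by exact/measurable_EFinP.
have inner s : integ (fun x => h x * (g (s + x) * rho s)).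
  have := integZ (rho s) (integ_mul hi (sqint_shift s gi)).
  by apply: integ_ae; [|apply: aeW => x; rewrite addrC; ring];
    apply: measurable_funM; [exact: hi.1|apply: measurable_funM => //;
    under eq_fun do rewrite addrC; exact: measurable_shift gi.1].
have iF : (mu \x mu)%E.-integrable setT (EFin \o f).
  apply/integrable21ltyP => //.
  pose K := dot mu h h + dot mu g g.
  have bound s : (\int[mu]_x `|(EFin \o f) (x, s)| <= (K * `|rho s|)%:E)%E.
    have -> : (\int[mu]_x `|(EFin \o f) (x, s)| =
        \int[mu]_x (EFin \o (fun x => `|h x * (g (s + x)%R * rho s)|%R)) x)%E by [].
    have ni := integrable_norm (inner s).
    rewrite -(fineK (integrable_fin_num measurableT ni)) lee_fin.
    rewrite -[leLHS]/(\int[mu]_x `|h x * (g (s + x) * rho s)|).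
    have i1 := integ_mul hi hi; have i2 := integ_mul (sqint_shift s gi) (sqint_shift s gi).
    have i3 := integD i1 i2.
    apply: (@le_trans _ _ (\int[mu]_x (`|rho s| * (h x * h x + g (x + s) * g (x + s))))).
      apply: le_Rintegral => //; first exact: integZ.
      move=> x _; rewrite !normrM (addrC s x) mulrA mulrC ler_wpM2l//.
      rewrite -[h x * h x]expr2 -[g (x + s) * g (x + s)]expr2.
      rewrite -(real_normK (num_real (h x))) -(real_normK (num_real (g (x + s)))).
      have := sqr_ge0 (`|h x| - `|g (x + s)|).
      have := normr_ge0 (h x); have := normr_ge0 (g (x + s)); nra.
    have E1 : \int[mu]_x (g (x + s) * g (x + s)) = dot mu g g by exact: dot_shift.
    by rewrite RintegralZl// RintegralD// mulrC E1.
  have mG : measurable_fun setT (fun s => \int[mu]_x `|(EFin \o f) (x, s)|)%E.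
    apply: (@measurable_fun_fubini_tonelli_G _ _ _ _ _ mu (abse \o (EFin \o f))) => //.
      exact: measurableT_comp.
    by move=> z; exact: abse_ge0.
  have ir := integZ K irho.
  apply: (@le_lt_trans _ _ (\int[mu]_s (K * `|rho s|)%:E)%E).
    apply: ge0_le_integral => //.
    - by move=> s _; exact: integral_ge0.
    - exact: (measurable_int _ ir).
  by have := integrable_fin_num measurableT ir; rewrite fin_numElt => /andP[].
have in1 x : (\int[mu]_s (EFin \o f) (x, s) = (corr g rho x * h x)%:E)%E.
  have isi : integ (fun s => h x * (g (s + x) * rho s)).
    by apply: integZ; apply: loc1_test => //; exact: loc1_shift.
  rewrite -(fineK (integrable_fin_num measurableT isi)) -[fine _]/(\int[mu]_s (h x * (g (s + x) * rho s))).
  rewrite RintegralZl; [|by []|by apply: loc1_test => //; exact: loc1_shift].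
  by rewrite -corrE// mulrC.
have in2 s : (\int[mu]_x (EFin \o f) (x, s) = (T g h s * rho s)%:E)%E.
  rewrite -(fineK (integrable_fin_num measurableT (inner s))).
  rewrite -[fine _]/(\int[mu]_x (h x * (g (s + x) * rho s))) mulrC -RintegralZl//.
    by congr EFin; apply: eq_Rintegral => x _; rewrite addrC; ring.
  by apply: integ_mul => //; exact: sqint_shift.
split.
- have := integrable_fubini_F iF; rewrite /fubini_F.
  by rewrite (_ : (fun y => _) = EFin \o (fun x => corr g rho x * h x))//; exact/funext.
- have mG : measurable_fun setT (fun s => T g h s * rho s).
    apply/measurable_EFinP; have := measurable_fubini_G iF; rewrite /fubini_G.
    by rewrite (_ : (fun y => _) = EFin \o (fun s => T g h s * rho s))//; exact/funext.
  apply: (integ_le mG _ (integZ (dot mu g g * dot mu h h + 1) irho)) => s.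
  rewrite normrM ler_wpM2r//.
  have := translation_bound s gi hi; rewrite -(real_normK (num_real (T g h s))).
  by have := sqr_ge0 (`|T g h s| - 1); have := normr_ge0 (T g h s); nra.
- have := Fubini iF; under eq_integral do rewrite in1.
  by under [in RHS]eq_integral do rewrite in2; rewrite /Rintegral => ->.
Qed.

(** By the previous identity the pairings are averages of T g h_n near the origin, which
    are close to T g h 0 for large n. *)
Lemma mollify_weak (g h : E -> R) (hn : nat -> E -> R) : sqint mu g -> sqint mu h ->
  (forall n, sqint mu (hn n)) ->
  dot mu (fun x => hn n x - h x) (fun x => hn n x - h x) @[n --> \oo] --> (0 : R) ->
  \int[mu]_x (corr g (mollifier n) x * hn n x) @[n --> \oo] --> \int[mu]_x (g x * h x).
Proof.
move=> gi hi hni hc.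
have F n := translation_fubini gi (hni n) (@mollifier_test R N n).
have -> : (fun n => \int[mu]_x (corr g (mollifier n) x * hn n x)) =
    fun n => \int[mu]_s (T g (hn n) s * mollifier n s).
  by apply/funext => n; case: (F n).
apply: mollifier_average => [n|e e0]; first by case: (F n).
have e2 : 0 < e / 2 by rewrite divr_gt0.
have [d d0 Hd] := translation_continuous gi hi e2; exists d => //.
pose C := dot mu g g + 1.
have C0 : 0 < C by rewrite ltr_wpDl// dot_ge0.
have c0 : 0 < (e / 2) ^+ 2 / C by rewrite divr_gt0// exprn_gt0.
move/cvgrPdist_lt : hc => /(_ _ c0)[n0 _ Hn0]; exists n0 => n s n0n sd.
have := Hn0 n n0n; rewrite sub0r normrN ger0_norm ?dot_ge0// => H.
have Bi := sqintB (hni n) hi.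
have close : `|T g (hn n) s - T g h s| <= e / 2.
  have -> : T g (hn n) s - T g h s = T g (fun x => hn n x - h x) s.
    have -> : (fun x => hn n x - h x) = fun x => -1 * h x + hn n x.
      by apply/funext => x; ring.
    by rewrite translation_lin//; ring.
  rewrite -(ler_pXn2r (n := 2))// ?nnegrE ?(ltW e2)//.
  rewrite real_normK ?num_real// (le_trans (translation_bound s gi Bi))//.
  move: H; rewrite ltr_pdivlMr// /C; have := dot_ge0 mu g.
  have := dot_ge0 mu (fun x => hn n x - h x).
  move: (dot mu g g) (dot mu _ _) ((e / 2) ^+ 2) => a b c; nra.
have T0 : T g h 0 = \int[mu]_x (g x * h x) by apply: eq_Rintegral => x _; rewrite addr0.
have := Hd s sd; rewrite T0 => H2.
rewrite -(subrK (T g h s) (T g (hn n) s)) -addrA (le_trans (ler_normD _ _))//.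
by rewrite [leRHS]splitr lerD.
Qed.

(** ** The product rule for unimodular factors *)

Lemma mollify_partial i (phi g : E -> R) n x : continuous phi -> weak_partial i phi g ->
  partial i (corr phi (mollifier n)) x = corr g (mollifier n) x.
Proof.
move=> cphi [lphi lg fg].
rewrite corr_partial//; last exact: mollifier_test.
have ts := test_shift (- x) (@mollifier_test R N n).
have E1 : \int[mu]_t (phi t * partial i (mollifier n) (t - x)) =
    \int[mu]_t (phi t * partial i (fun y : E => mollifier n (y - x)) t).
  apply: eq_Rintegral => t _.
  by rewrite (partial_shift (- x) i t (@mollifier_test R N n).1).
by rewrite {1}/corr E1 (fg _ ts) opprK.
Qed.

(** If phi is mollified, cos (phi_n) is smooth, so cos (phi_n) eta is a test function and
    the formula is the definition of the weak derivative of w. In the limit the mollified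
    gradient of phi converges only weakly in L^2 on compact sets, but it is paired with
    w eta sin (phi_n), which converges strongly. *)
Lemma weak_partial_cos i (phi g w w' : E -> R) : continuous phi -> weak_partial i phi g ->
  loc2 g -> weak_partial i w w' -> loc2 w ->
  weak_partial i (fun x => cos (phi x) * w x)
    (fun x => cos (phi x) * w' x - sin (phi x) * g x * w x).
Proof.
move=> cphi wphi lg ww lw.
have [lphi lg1 fg] := wphi; have [lw1 lw' fw] := ww.
have mphi := loc1_measurable lphi; have mw := loc1_measurable lw1.
have mw' := loc1_measurable lw'; have mg := loc1_measurable lg1.
have mcos : measurable_fun setT (fun x => cos (phi x)).
  apply: measurableT_comp => //; exact: continuous_measurable_fun (@continuous_cos R).
have msin : measurable_fun setT (fun x => sin (phi x)).
  apply: measurableT_comp => //; exact: continuous_measurable_fun (@continuous_sin R).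
have c1 (t : R) : `|cos t| <= 1 by rewrite ler_norml cos_geN1 cos_le1.
have s1 (t : R) : `|sin t| <= 1 by rewrite ler_norml sin_geN1 sin_le1.
have L1 : Lp_loc 1 (fun x => cos (phi x) * w x).
  apply: (loc1_le _ _ lw1); first exact: measurable_funM.
  by apply: aeW => x; rewrite normrM ler_piMl.
have L2 : Lp_loc 1 (fun x => cos (phi x) * w' x).
  apply: (loc1_le _ _ lw'); first exact: measurable_funM.
  by apply: aeW => x; rewrite normrM ler_piMl.
have L3 : Lp_loc 1 (fun x => sin (phi x) * g x * w x).
  apply: (loc1_le _ _ (loc2_mul lg lw)).
    by apply: measurable_funM => //; exact: measurable_funM.
  by apply: aeW => x; rewrite -mulrA normrM ler_piMl.
split=> //; first exact: loc1B.
move=> eta teta.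
have meta := test_measurable teta; have tpeta := test_partial i teta.
have mpeta := test_measurable tpeta.
have [l Hl] := test_support teta.
pose phin n := corr phi (mollifier n).
have sphin n : smooth (phin n) by apply: corr_smooth => //; exact: mollifier_test.
have cE (t : R) : cos_family 0 t = cos t by rewrite /cos_family mul0r addr0.
have cE1 (t : R) : cos_family 1 t = - sin t by rewrite /cos_family mul1r cosDpihalf.
have scos n : smooth (fun x => cos (phin n x)).
  move=> k; have := Ck_comp 0 (@cos_family_smooth R) (sphin n k).
  by rewrite (_ : cos_family 0 \o _ = fun x => cos (phin n x))//; apply/funext => x /=.
have teta_n n : test_function (fun x => eta x * cos (phin n x)) by exact: testM.
have dcos n x : partial i (fun x => cos (phin n x)) x = - sin (phin n x) * corr g (mollifier n) x.
  have [_ E1] := partial_comp 0 (@cos_family_smooth R) (@smooth_derivable _ _ (phin n) i x (sphin n)).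
  have E2 : (fun x => cos (phin n x)) = cos_family 0 \o phin n by apply/funext => y /=.
  by rewrite E2 [LHS]E1 (mollify_partial n x cphi wphi) cE1.
(* near the support of eta, the mollification sees g only inside a cube one larger *)
pose g1 x := g x * \1_(cube (l + 1)%N) x.
have g1i : sqint mu g1 by case: lg => _; apply.
have corr_g1 n x : cube l x -> corr g (mollifier n) x = corr g1 (mollifier n) x.
  move=> xl; apply: eq_Rintegral => t _; rewrite /g1.
  have [tb|tb] := pselect (box (fun=> - n.+1%:R^-1) (fun=> n.+1%:R^-1) (t - x)); last first.
    by rewrite mollifier_out// !mulr0.
  rewrite indicE mem_set ?mulr1// addnC; apply: cube_shift xl => j.
  rewrite (@le_trans _ _ n.+1%:R^-1)//; last by rewrite invf_le1// ler1n.
  by rewrite ler_norml; have /andP[/ltW -> /ltW ->] := tb j.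
have mphin n : measurable_fun setT (phin n).
  by apply: continuous_measurable_rV; exact: smooth_continuous.
have mcosn n : measurable_fun setT (fun x => cos (phin n x)).
  by apply: continuous_measurable_rV; exact: smooth_continuous.
have msinn n : measurable_fun setT (fun x => sin (phin n x)).
  apply: measurableT_comp => //; exact: continuous_measurable_fun (@continuous_sin R).
pose hn n x := w x * eta x * sin (phin n x).
pose h x := w x * eta x * sin (phi x).
have we : sqint mu (fun x => w x * eta x) by exact: loc2_test.
have hni n : sqint mu (hn n).
  apply: (sqint_le _ _ we); first by apply: measurable_funM => //; case: we.
  by apply: aeW => x; rewrite normrM ler_piMr.
have phc x : phin n x @[n --> \oo] --> phi x by exact: mollify_cvg.
have sc x : sin (phin n x) @[n --> \oo] --> sin (phi x).
  exact: (cvg_comp _ _ (phc x) (@continuous_sin R (phi x))).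
have cc x : cos (phin n x) @[n --> \oo] --> cos (phi x).
  exact: (cvg_comp _ _ (phc x) (@continuous_cos R (phi x))).
have [|||||hi hc] := @sqint_dominated _ _ _ mu hn h (fun x => w x * eta x).
- by move=> n; case: (hni n).
- by apply: measurable_funM => //; case: we.
- by apply: aeW => x; apply: cvgM => //; exact: cvg_cst.
- exact: we.
- by apply: aeW => x n; rewrite normrM ler_piMr.
have limB := mollify_weak g1i hi hni hc.
have [|||||_ limA] := @Rdominated _ _ _ mu (fun n x => w x * (cos (phin n x) * partial i eta x))
    (fun x => w x * (cos (phi x) * partial i eta x)) (fun x => `|w x * partial i eta x|).
- by move=> n; apply: measurable_funM => //; exact: measurable_funM.
- by apply: measurable_funM => //; exact: measurable_funM.
- by apply: aeW => x; apply: cvgM; [exact: cvg_cst|apply: cvgM => //; exact: cvg_cst].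
- by apply: integrable_norm; exact: loc1_test.
- by apply: aeW => x n; rewrite !normrM ler_wpM2l// ler_piMl.
have [|||||_ limC] := @Rdominated _ _ _ mu (fun n x => w' x * (eta x * cos (phin n x)))
    (fun x => w' x * (eta x * cos (phi x))) (fun x => `|w' x * eta x|).
- by move=> n; apply: measurable_funM => //; exact: measurable_funM.
- by apply: measurable_funM => //; exact: measurable_funM.
- by apply: aeW => x; apply: cvgM; [exact: cvg_cst|apply: cvgM => //; exact: cvg_cst].
- by apply: integrable_norm; exact: loc1_test.
- by apply: aeW => x n; rewrite !normrM ler_wpM2l// ler_piMr.
have eqn n : \int[mu]_x (w x * (cos (phin n x) * partial i eta x)) -
    \int[mu]_x (corr g1 (mollifier n) x * hn n x) =
    - \int[mu]_x (w' x * (eta x * cos (phin n x))).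
  rewrite -(fw _ (teta_n n)) -RintegralB//.
  - apply: eq_Rintegral => x _.
    rewrite partialM; [|exact: smooth_derivable teta.1|exact: smooth_derivable].
    have [xl|xl] := pselect (cube l x); first by rewrite -corr_g1// dcos /hn; ring.
    by rewrite /hn Hl//; ring.
  - apply: loc1_test => //; have := testM tpeta (scos n).
    by under [in X in X -> _]eq_fun do rewrite mulrC.
  - by case: (translation_fubini g1i (hni n) (@mollifier_test R N n)).
have H := cvg_eq_lim eqn (cvgB limA limB) (cvgN limC).
have iC : integ (fun x => w' x * (eta x * cos (phi x))).
  have := loc1_test L2 teta; apply: integ_ae; last by apply: aeW => x; ring.
  by apply: measurable_funM => //; exact: measurable_funM.
have iB := integ_mul g1i hi.
have -> : \int[mu]_x ((cos (phi x) * w' x - sin (phi x) * g x * w x) * eta x) =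
    \int[mu]_x (w' x * (eta x * cos (phi x))) - \int[mu]_x (g1 x * h x).
  rewrite -RintegralB//; apply: eq_Rintegral => x _; rewrite /g1 /h.
  have [xl|xl] := pselect (cube l x); last by rewrite Hl//; ring.
  rewrite indicE mem_set; last by apply: (cube_mono _ xl); rewrite addn1.
  by rewrite mulr1; ring.
rewrite opprB -[in RHS]addrC -H.
by rewrite subrK; apply: eq_Rintegral => x _; ring.
Qed.

(** The previous lemma for the phase phi - pi / 2. *)
Lemma weak_partial_sin i (phi g w w' : E -> R) : continuous phi -> weak_partial i phi g ->
  loc2 g -> weak_partial i w w' -> loc2 w ->
  weak_partial i (fun x => sin (phi x) * w x)
    (fun x => sin (phi x) * w' x + cos (phi x) * g x * w x).
Proof.
move=> cphi wphi lg ww lw.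
pose phi' x := phi x - pi / 2.
have cphi' : continuous phi' by apply: continuous_addf => //; exact: cst_continuous.
have wphi' : weak_partial i phi' g.
  have wc := weak_partial_smooth i (fun k => @Ck_cst R N k (- (pi / 2))).
  have := weak_partial_lincomb 1 wphi wc.
  have -> : (fun x => 1 * phi x + - (pi / 2)) = phi' by apply/funext => x; rewrite mul1r.
  suff -> : (fun x => 1 * g x + partial i (fun=> - (pi / 2)) x) = g by [].
  by apply/funext => x; rewrite /partial derive_cst mul1r addr0.
have := weak_partial_cos cphi' wphi' lg ww lw.
have -> : (fun x => cos (phi' x) * w x) = fun x => sin (phi x) * w x.
  by apply/funext => x; rewrite /phi' cosBpihalf.
suff -> : (fun x => cos (phi' x) * w' x - sin (phi' x) * g x * w x) =
    fun x => sin (phi x) * w' x + cos (phi x) * g x * w x by [].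
by apply/funext => x; rewrite /phi' cosBpihalf sinBpihalf !mulNr opprK.
Qed.

(** Mollifications of phi have vanishing classical gradient, hence are constant, and they
    converge to phi pointwise. *)
Lemma zero_gradient_cst (phi : E -> R) (g : 'I_N -> E -> R) : continuous phi ->
  (forall i, weak_partial i phi (g i)) -> (forall i, {ae mu, forall x, g i x = 0}) ->
  forall x, phi x = phi 0.
Proof.
move=> cphi wphi g0.
pose phin n := corr phi (mollifier n).
have sphin n : smooth (phin n).
  by apply: corr_smooth; [exact: continuous_loc1|exact: mollifier_test].
have dphin n i x : partial i (phin n) x = 0.
  rewrite (mollify_partial n x cphi (wphi i)) /corr.
  rewrite (@Rintegral_ae _ _ _ mu _ (fun=> 0)).
  - by rewrite Rintegral_cst// mul0r.
  - have [_ lg _] := wphi i.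
    by have := loc1_test lg (test_shift (- x) (@mollifier_test R N n)) => /integ_measurable.
  - exact: measurable_cst.
  - by apply: filterS (g0 i) => t ->; rewrite mul0r.
have line n i x (t : R) : phin n (t *: e_ i + x) = phin n x.
  transitivity (phin n (0 *: e_ i + x)); last by rewrite scale0r add0r.
  apply: (@is_derive_0_is_cst R (fun t : R => phin n (t *: e_ i + x)) t 0) => s.
  apply: is_derive_along; have := smooth_partialP i (s *: e_ i + x) (sphin n).
  by rewrite dphin.
have cst_n n x : phin n x = phin n 0.
  have sumE : x = \sum_(i < N) x 0 i *: e_ i + 0 by rewrite addr0; exact: row_sum_delta.
  rewrite {1}sumE.
  elim: (index_enum _) => [|i r IH]; first by rewrite big_nil add0r.
  by rewrite big_cons -addrA line.
move=> x; exact: (cvg_eq_lim (fun n => cst_n n x) (@mollify_cvg R N phi x cphi)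
  (@mollify_cvg R N phi 0 cphi)).
Qed.

End weak_derivatives.

(** * The magnetic Sobolev space *)

Section l2_dimension.
Context d (T : measurableType d) (R : realType) (mu : {measure set T -> \bar R}).
Context (H : lmodType R) (I : finType) (J : H -> I -> T -> R).
Hypothesis Jlin : forall a u v c,
  {ae mu, forall x, J (a *: u + v) c x = a * J u c x + J v c x}.

Lemma rcoord_sum (K : Type) (r : seq K) (a : K -> R) (e : K -> H) c :
  {ae mu, forall x, J (\sum_(k <- r) a k *: e k) c x = \sum_(k <- r) a k * J (e k) c x}.
Proof.
elim: r => [|k r IH].
  rewrite big_nil; apply: filterS (Jlin (-1) 0 0 c) => x.
  by rewrite scaler0 addr0 big_nil => ->; ring.
rewrite big_cons; apply: filterS2 IH (Jlin (a k) (e k) (\sum_(k <- r) a k *: e k) c) => x E1 ->.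
by rewrite big_cons E1.
Qed.

(** A family whose coordinates have disjoint supports is linearly independent, and
    more than n independent vectors do not fit in a span of n vectors. *)
Lemma l2_infinite_dimensional (e : nat -> H) (c : I) (B : nat -> set T) :
  (forall k, ~ mu.-negligible (B k)) ->
  (forall k, {ae mu, forall x, B k x -> J (e k) c x != 0}) ->
  (forall k l, k != l -> {ae mu, forall x, B k x -> J (e l) c x = 0}) ->
  @infinite_dimensional R H.
Proof.
move=> B0 Bk Bl n b; apply: contrapT => /forallNP spanb.
have /choice[m Hm] : forall k : 'I_n.+1, exists m : 'I_n -> R, e k = \sum_i m i *: b i.
  by move=> k; have /existsNP[m /contrapT Em] := spanb (e k); exists m.
pose M := (\matrix_(k < n.+1, i < n) m k i)%R.
(* the n+1 rows of M lie in a space of dimension n *)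
have kM : kermx M != 0.
  by rewrite kermx_eq0 /row_free neq_ltn ltnS (leq_trans (rank_leq_col M)).
have [k rk] : exists k, row k (kermx M) != 0.
  apply/existsP; rewrite -negb_forall; apply: contra kM => /forallP H0.
  by apply/eqP/row_matrixP => k; rewrite row0; exact/eqP.
set v := row k (kermx M) in rk.
have vM : v *m M = 0 by apply/sub_kermxP; exact: row_sub.
have [l vl] : exists l, v 0 l != 0.
  apply/existsP; rewrite -negb_forall; apply: contra rk => /forallP H0.
  by apply/eqP/rowP => j; rewrite [RHS]mxE; exact/eqP.
have S0 : \sum_(k < n.+1) v 0 k *: e k = 0.
  under eq_bigr do rewrite Hm scaler_sumr.
  rewrite exchange_big /= big1// => i _.
  under eq_bigr do rewrite scalerA.
  rewrite -scaler_suml; have := congr1 (fun X : 'rV_n => X 0 i) vM.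
  rewrite [LHS]mxE [RHS]mxE => vM0.
  have -> : \sum_(k < n.+1) v 0 k * m k i = 0.
    by rewrite -[RHS]vM0; apply: eq_bigr => j _; rewrite [M j i]mxE.
  by rewrite scale0r.
have Z0 : {ae mu, forall x, J 0 c x = 0}.
  apply: filterS (Jlin (-1) 0 0 c) => x.
  by rewrite scaler0 addr0 => ->; ring.
apply: (B0 l); apply: (negligibleS _ (_ : mu.-negligible (~` [set x | B l x -> False]))).
  by move=> x Bx /(_ Bx).
have Bl' : {ae mu, forall x, forall j : 'I_n.+1, j != l -> B l x -> J (e j) c x = 0}.
  have := @filter_forall _ 'I_n.+1 (fun j x => j != l -> B l x -> J (e j) c x = 0)
    (almost_everywhere mu) _.
  apply=> j; have [->|jl] := eqVneq j l; first by apply: aeW.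
  have lj : nat_of_ord l != j by rewrite eq_sym.
  by apply: filterS (Bl l j lj) => x Hx _.
have Sl := rcoord_sum (index_enum 'I_n.+1) (fun k => v 0 k) (fun k => e k) c.
rewrite S0 in Sl.
suff : {ae mu, forall x, B l x -> False} by [].
apply: filterS2 (filterI (filterI Z0 (Bk l)) Bl') Sl => x [[z0 bk] bl] sl Bx.
have := bk Bx; apply/negP; rewrite negbK.
move: sl; rewrite z0 (bigD1 l)//= big1 => [|j jl]; last by rewrite bl// mulr0.
by rewrite addr0 => /esym/eqP; rewrite mulf_eq0 (negbTE vl).
Qed.

End l2_dimension.

Section real_coordinates.
Context {R : realType} {N : nat}.
Local Notation E := 'rV[R]_N.
Local Notation mu := (@lebesgue_rV R N).
Local Notation integ f := (mu.-integrable setT (EFin \o f)).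
Local Notation dist f g := (dot mu (fun x => f x - g x) (fun x => f x - g x)).

Lemma Lfun2P (f : E -> R) : f \in Lfun mu 2%:E <-> sqint mu f.
Proof.
split=> [Lf|[mf fi]].
  split; last exact: Lfun2_integrable_sqr.
  by case/andP: Lf => /[!inE].
apply/andP; rewrite !inE; split=> //=.
rewrite /finite_norm unlock; apply: poweR_lty.
case/integrableP: fi => _; apply: le_lt_trans; rewrite le_eqVlt; apply/orP; left; apply/eqP.
apply: eq_integral => x _ /=; rewrite powR_mulrn// real_normK ?num_real//.
by rewrite ger0_norm ?sqr_ge0.
Qed.

Lemma dot_cvg (F : nat -> E -> R) (f g : E -> R) : (forall n, sqint mu (F n)) -> sqint mu f ->
  sqint mu g -> dist (F n) f @[n --> \oo] --> (0 : R) ->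
  dot mu (F n) g @[n --> \oo] --> dot mu f g.
Proof.
move=> Fi fi gi; move/cvgrPdist_lt => Fc; apply/cvgrPdist_lt => e e0.
have C0 : 0 < dot mu g g + 1 by rewrite ltr_wpDl// dot_ge0.
have [n0 _ Hn0] := Fc _ (divr_gt0 (exprn_gt0 2 e0) C0); exists n0 => // n n0n.
have := Hn0 n n0n; rewrite sub0r normrN ger0_norm ?dot_ge0// ltr_pdivlMr// => H.
have Bi := sqintB (Fi n) fi.
have -> : dot mu f g - dot mu (F n) g = - dot mu (fun x => F n x - f x) g.
  have := dot_lin (-1) fi (Fi n) gi.
  have -> : (fun x => -1 * f x + F n x) = fun x => F n x - f x.
    by apply/funext => x; ring.
  by move=> ->; ring.
rewrite normrN -(ltr_pXn2r (n := 2))// ?nnegrE ?(ltW e0)// real_normK ?num_real//.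
apply: le_lt_trans (cauchy_schwarz Bi gi) _; apply: le_lt_trans H.
by rewrite ler_wpM2l ?dot_ge0// lerDl.
Qed.

(** [part] false is the real part and [part] true the imaginary part; with a boolean
    index the equations for both parts of a magnetic gradient take one form. *)
Definition part (b : bool) (z : Rcomplex R) : R :=
  if b then complex.Im z else complex.Re z.

Lemma L2P (u : E -> Rcomplex R) : L2 u <-> forall b, sqint mu (fun x => part b (u x)).
Proof.
split=> [[Lr Li] [|]|H]; [exact/Lfun2P..|].
by split; apply/Lfun2P; [exact: (H false)|exact: (H true)].
Qed.

Lemma magnetic_gradientP (A : E -> E) u g : magnetic_gradient A u g <->
  forall i b, weak_partial i (fun x => part b (u x))
    (fun x => (-1) ^+ b * (A x 0 i * part (~~ b) (u x)) + part b (g x 0 i)).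
Proof.
have Er i : (fun x => complex.Re (g x 0 i - 'i%C * (A x 0 i)%:C%C * u x)) =
    fun x => (-1) ^+ false * (A x 0 i * part true (u x)) + part false (g x 0 i).
  apply/funext => x; rewrite /part; case: (g x 0 i) (u x) => [a b] [c d] /=; ring.
have Ei i : (fun x => complex.Im (g x 0 i - 'i%C * (A x 0 i)%:C%C * u x)) =
    fun x => (-1) ^+ true * (A x 0 i * part false (u x)) + part true (g x 0 i).
  apply/funext => x; rewrite /part; case: (g x 0 i) (u x) => [a b] [c d] /=; ring.
split=> [H i [|]|H i].
- by have [_] := H i; rewrite Ei.
- by have [+ _] := H i; rewrite Er.
- by split; rewrite ?Er ?Ei; [exact: (H i false)|exact: (H i true)].
Qed.

Lemma sqr_norm_part (z : Rcomplex R) : `|z| ^+ 2 = part false z ^+ 2 + part true z ^+ 2.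
Proof. by case: z => p q; rewrite /Num.norm/= sqr_sqrtr// addr_ge0 ?sqr_ge0. Qed.

Lemma part_eq (z w : Rcomplex R) : (forall b, part b z = part b w) -> z = w.
Proof. by case: z w => [p q] [r s] H; have := H false; have := H true => /= -> ->. Qed.

Lemma partZ a b (z : Rcomplex R) : part b (a *: z) = a * part b z.
Proof. by case: z b => [? ?] []. Qed.

Lemma big_option (I : finType) (F : option I -> R) :
  \sum_k F k = F None + \sum_i F (Some i).
Proof.
rewrite (bigD1 None)//=; congr (_ + _).
by rewrite (reindex_omap Some id) => [|[i|]]//; apply: eq_bigl => i; rewrite eqxx.
Qed.

Lemma part_lin a b (z w : Rcomplex R) : part b (a *: z + w) = a * part b z + part b w.
Proof. by case: z w b => [? ?] [? ?] []. Qed.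

End real_coordinates.

Section magnetic_sobolev_space.
Context {R : realType} {N : nat}.
Local Notation E := 'rV[R]_N.
Local Notation mu := (@lebesgue_rV R N).
Local Notation integ f := (mu.-integrable setT (EFin \o f)).
Local Notation dist f g := (dot mu (fun x => f x - g x) (fun x => f x - g x)).
Variables (A : E -> E) (V : E -> R) (c : R).
Hypothesis loc2A : forall i, loc2 (fun x => A x 0 i).
Hypothesis loc1V : Lp_loc 1 V.
Hypothesis c0 : 0 < c.
Hypothesis Vc : {ae mu, forall x, c <= V x}.
Local Notation H1 := (H1_space A V).
Let mA i : measurable_fun setT (fun x => A x 0 i) := (loc2A i).1.
Let mV : measurable_fun setT V := loc1_measurable loc1V.

(** The weak gradient determines the magnetic gradient since A is a function; only
    measurability of the parts of the gradient has to be extracted from the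
    distributional equation. *)
Lemma magnetic_gradient_measurable u g i b : magnetic_gradient A u g ->
  measurable_fun setT (fun x => part b (g x 0 i)).
Proof.
move=> /magnetic_gradientP ug; have [_ lg _] := ug i b.
have [lu _ _] := ug i (~~ b).
have := loc1_measurable lg.
pose h x := (-1) ^+ b * (A x 0 i * part (~~ b) (u x)).
have mh : measurable_fun setT h.
  by apply: measurable_funM => //; apply: measurable_funM => //; exact: loc1_measurable lu.
move=> mk; have := measurable_funB mk mh.
by rewrite [X in measurable_fun _ X](_ : _ = fun x => part b (g x 0 i))//;
  apply/funext => x /=; rewrite /h; ring.
Qed.

Lemma magnetic_gradient_uniq u u' g g' i b : {ae mu, forall x, u x = u' x} ->
  magnetic_gradient A u g -> magnetic_gradient A u' g' ->
  {ae mu, forall x, part b (g x 0 i) = part b (g' x 0 i)}.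
Proof.
move=> uu /magnetic_gradientP ug /magnetic_gradientP ug'.
have uub : {ae mu, forall x, part b (u x) = part b (u' x)} by apply: filterS uu => x ->.
have := weak_partial_uniq uub (ug i b) (ug' i b).
by apply: filterS2 uu => x ->; exact: addrI.
Qed.

Lemma repr_mem (U : H1) : mem_H1 A V (repr U).
Proof. by apply/asboolP; exact: (valP (repr U)). Qed.

(** Equality in the quotient is equality almost everywhere; the next lemmas let one compute
    with representatives. *)
Lemma pi_ae (u v : H1fun A V) : \pi_H1 u = \pi_H1 v <-> {ae mu, forall x, u x = v x}.
Proof.
have E0 : (u - v \in @ae_zero R N A V) = (\pi_H1 u == \pi_H1 v) by exact: Quotient.idealrBE.
split=> [/eqP|H].
  rewrite -E0 => /asboolP; apply: filterS => x H.
  by apply/eqP; rewrite -subr_eq0; apply/eqP; exact: H.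
apply/eqP; rewrite -E0; apply/asboolP; apply: filterS H => x H.
by rewrite -[RHS](subrr (u x)) {2}H.
Qed.

Lemma repr_pi (u : H1fun A V) : {ae mu, forall x, repr (\pi_H1 u) x = u x}.
Proof. by apply/pi_ae; rewrite reprK. Qed.

Lemma repr_lin a (U W : H1) :
  {ae mu, forall x, repr (a *: U + W) x = a *: repr U x + repr W x}.
Proof.
have E0 : a *: U + W = \pi_H1 (a *: repr U + repr W).
  by rewrite -[in LHS](reprK W) Quotient.pi_add.
by rewrite E0; exact: repr_pi.
Qed.

Lemma repr_class u : mem_H1 A V u -> {ae mu, forall x, repr (H1_class A V u) x = u x}.
Proof.
move=> Hu; have := repr_pi (insubd 0 u); apply: filterS => x ->.
by rewrite insubdK//; exact/asboolP.
Qed.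

Lemma grad_repr (U : H1) : magnetic_gradient A (repr U) (magnetic_grad A (repr U)).
Proof. by have [_ _ [g ug _]] := repr_mem U; exact: (xgetPex _ (ex_intro _ g ug)). Qed.

Lemma repr_sqint (U : H1) b : sqint mu (fun x => part b (repr U x)).
Proof. by have [/L2P + _ _] := repr_mem U. Qed.

Lemma grad_sqint (U : H1) i b : sqint mu (fun x => part b (magnetic_grad A (repr U) x 0 i)).
Proof.
have [_ _ [g ug Lg]] := repr_mem U; have /L2P/(_ b) := Lg i.
apply: sqint_ae; first exact: magnetic_gradient_measurable (grad_repr U).
by apply: (magnetic_gradient_uniq i b _ ug (grad_repr U)); exact: aeW.
Qed.

Lemma grad_class (u : E -> Rcomplex R) g i b : mem_H1 A V u -> magnetic_gradient A u g ->
  {ae mu, forall x, part b (magnetic_grad A (repr (H1_class A V u)) x 0 i) = part b (g x 0 i)}.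
Proof.
move=> Hu ug; apply: (magnetic_gradient_uniq i b _ (grad_repr _) ug); exact: repr_class.
Qed.

(** Multiplication by the square root of V turns the weighted part of the scalar
    product into an unweighted one. *)
Definition ccoord (U : H1) (k : option 'I_N) (x : E) : Rcomplex R :=
  if k is Some i then magnetic_grad A (repr U) x 0 i else Num.sqrt (V x) *: repr U x.

Definition rcoord (U : H1) (k : option 'I_N * bool) (x : E) : R :=
  part k.2 (ccoord U k.1 x).

Let rcoordN U b : rcoord U (None, b) = fun x => Num.sqrt (V x) * part b (repr U x).
Proof. by apply/funext => x; rewrite /rcoord /= partZ. Qed.

Let msqrtV : measurable_fun setT (fun x => Num.sqrt (V x)).
Proof. by apply: measurableT_comp mV; exact: continuous_measurable_fun (@sqrt_continuous R). Qed.

Lemma sqint_sqrtV (p : E -> R) : measurable_fun setT p -> integ (fun x => V x * p x ^+ 2) ->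
  sqint mu (fun x => Num.sqrt (V x) * p x).
Proof.
move=> mp ip; split; first exact: measurable_funM.
have m2 : measurable_fun setT (fun x => (Num.sqrt (V x) * p x) ^+ 2).
  by apply: measurable_funX; exact: measurable_funM.
apply: (integ_ae m2 _ ip); apply: filterS Vc => x Vx.
by rewrite exprMn sqr_sqrtr// (le_trans (ltW c0)).
Qed.

Lemma rcoord_sqint U k : sqint mu (rcoord U k).
Proof.
case: k => [[i|] b]; first exact: grad_sqint.
rewrite rcoordN; have mb := (repr_sqint U b).1; apply: sqint_sqrtV => //.
have [_ iV _] := repr_mem U.
apply: (integ_le _ _ (integrable_norm iV)).
  by apply: measurable_funM => //; exact: measurable_funX.
move=> x /=; rewrite sqr_norm_part [leLHS]normrM [leRHS]normrM ler_wpM2l//.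
rewrite !ger0_norm ?addr_ge0 ?sqr_ge0//.
by case: b {mb}; rewrite ?lerDl ?lerDr sqr_ge0.
Qed.

Lemma rcoord_lin a U W k :
  {ae mu, forall x, rcoord (a *: U + W) k x = a * rcoord U k x + rcoord W k x}.
Proof.
have RL := repr_lin a U W.
case: k => [[i|] b]; last first.
  by rewrite !rcoordN; apply: filterS RL => x ->; rewrite part_lin; ring.
have GL := magnetic_gradient_lincomb a (grad_repr U) (grad_repr W).
have := magnetic_gradient_uniq i b RL (grad_repr _) GL.
by apply: filterS => x H; rewrite [LHS]H mxE part_lin.
Qed.

Lemma rcoord_ip U W : H1_ip A V U W = \sum_k dot mu (rcoord U k) (rcoord W k).
Proof.
rewrite -(pair_bigA _ (fun k b => dot mu (rcoord U (k, b)) (rcoord W (k, b)))) big_option big_bool.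
rewrite /H1_ip /cintegral; congr (_ + _).
  rewrite [LHS]/= [RHS]/= /dot -RintegralD//; [|exact: integ_mul (rcoord_sqint U (None, _)) (rcoord_sqint W (None, _))..].
  have mp b := (repr_sqint U b).1; have mq b := (repr_sqint W b).1.
  apply: Rintegral_ae.
  - have -> : (fun x => complex.Re (V x *: (repr U x * ((repr W x)^*)%C))) =
      (fun x => V x * (part false (repr U x) * part false (repr W x) +
        part true (repr U x) * part true (repr W x))).
      apply/funext => x; rewrite /part; case: (repr U x) (repr W x) => [a b] [e f] /=; ring.
    by apply: measurable_funM => //; apply: measurable_funD; exact: measurable_funM.
  - have mc Z b := (rcoord_sqint Z (None, b)).1.
    by apply: measurable_funD; exact: measurable_funM.
  - apply: filterS Vc => x Vx.
    have E := sqr_sqrtr (le_trans (ltW c0) Vx); rewrite !rcoordN /part.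
    move: (Num.sqrt (V x)) E => s <-.
    case: (repr U x) (repr W x) => [a b] [e f] /=; ring.
have -> : (fun x => complex.Re (\sum_i magnetic_grad A (repr U) x 0 i * ((magnetic_grad A (repr W) x 0 i)^*)%C)) =
   fun x => \sum_(i < N) \sum_b rcoord U (Some i, b) x * rcoord W (Some i, b) x.
  apply/funext => x /=; rewrite (raddf_sum (@complex.Re R)); apply: eq_bigr => i _.
  rewrite big_bool /rcoord /= /part.
  case: (magnetic_grad _ (repr U) x 0 i) (magnetic_grad _ (repr W) x 0 i) => [a b] [e f] /=; ring.
have int i b := integ_mul (rcoord_sqint U (Some i, b)) (rcoord_sqint W (Some i, b)).
have sumI (r : seq 'I_N) : integ (fun x => \sum_(i <- r) \sum_b rcoord U (Some i, b) x * rcoord W (Some i, b) x) /\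
    \int[mu]_x (\sum_(i <- r) \sum_b rcoord U (Some i, b) x * rcoord W (Some i, b) x) =
    \sum_(i <- r) \sum_b dot mu (rcoord U (Some i, b)) (rcoord W (Some i, b)).
  elim: r => [|i r [Hi He]].
    have -> : (fun x => \sum_(i <- [::]) \sum_b rcoord U (Some i, b) x * rcoord W (Some i, b) x) = fun=> 0.
      by apply/funext => x; rewrite big_nil.
    by rewrite big_nil Rintegral_cst// mul0r; split => //; exact: integrable0.
  have -> : (fun x => \sum_(j <- i :: r) \sum_b rcoord U (Some j, b) x * rcoord W (Some j, b) x) =
     (fun x => (rcoord U (Some i, true) x * rcoord W (Some i, true) x +
       rcoord U (Some i, false) x * rcoord W (Some i, false) x) +
       \sum_(j <- r) \sum_b rcoord U (Some j, b) x * rcoord W (Some j, b) x).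
    by apply/funext => x; rewrite big_cons big_bool.
  have iD := integD (int i true) (int i false).
  split; first exact: integD.
  by rewrite RintegralD// He RintegralD// big_cons big_bool.
exact: (sumI _).2.
Qed.

Lemma rcoord_inj U : (forall k, {ae mu, forall x, rcoord U k x = 0}) -> U = 0.
Proof.
move=> U0; rewrite -(reprK U).
rewrite -(reprK (0 : H1)).
apply/pi_ae; have Ub b := U0 (None, b).
have Z0 := repr_lin (-1) 0 0; rewrite scaler0 addr0 in Z0.
apply: filterS3 (filterI (Ub false) (Ub true)) Z0 Vc => x [f0 t0] z0 Vx; apply: part_eq => b.
have sV : Num.sqrt (V x) != 0 by rewrite sqrtr_eq0 -ltNge (lt_le_trans c0).
have -> : part b (repr (0 : H1) x) = 0 by rewrite z0 part_lin; ring.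
case: b; [move: t0|move: f0]; rewrite rcoordN => /eqP;
  by rewrite mulf_eq0 (negbTE sV) => /eqP.
Qed.

(** Let f be a limit of coordinates. Dividing the components that carry the weight by
    the square root of V gives the parts of a function, and the other components are the
    parts of a magnetic gradient of it, because the distributional equation passes to L^2
    limits: A enters it only through the products A eta, which are in L^2. *)
Lemma rcoord_closed (u : nat -> H1) (f : option 'I_N * bool -> E -> R) :
  (forall k, sqint mu (f k)) ->
  (forall k, dist (rcoord (u n) k) (f k) @[n --> \oo] --> (0 : R)) ->
  exists l, forall k, {ae mu, forall x, rcoord l k x = f k x}.
Proof.
move=> fi fc.
have mf k : measurable_fun setT (f k) by case: (fi k).
pose p b x := (Num.sqrt (V x)) `^ (-1) * f (None, b) x.
have pE x b : c <= V x -> Num.sqrt (V x) * p b x = f (None, b) x.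
  move=> Vx; rewrite /p powR_inv1 ?sqrtr_ge0// mulrA divff ?mul1r//.
  by rewrite sqrtr_eq0 -ltNge (lt_le_trans c0).
have mp b : measurable_fun setT (p b).
  apply: measurable_funM => //.
  exact: (measurableT_comp (measurable_powR (-1)) msqrtV).
(* division by the square root of V contracts squares by 1/c *)
have contr (h : E -> R) : measurable_fun setT h -> sqint mu (fun x => Num.sqrt (V x) * h x) ->
    sqint mu h /\ dot mu h h <= c^-1 * dot mu (fun x => Num.sqrt (V x) * h x) (fun x => Num.sqrt (V x) * h x).
  move=> mh sh.
  have bd : {ae mu, forall x, h x * h x <= c^-1 * ((Num.sqrt (V x) * h x) * (Num.sqrt (V x) * h x))}.
    apply: filterS Vc => x Vx; rewrite mulrACA -!expr2 sqr_sqrtr ?(le_trans (ltW c0))//.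
    by rewrite mulrA ler_peMl ?sqr_ge0// mulrC ler_pdivlMr// mul1r.
  have hi : integ (fun x => h x * h x).
    apply: (integ_ae_le _ _ (integZ c^-1 (integ_mul sh sh))); first exact: measurable_funM.
    by apply: filterS bd => x; rewrite ger0_norm// -expr2 sqr_ge0.
  split; first by split=> //; under eq_fun do rewrite expr2.
  have ish := integ_mul sh sh.
  rewrite /dot -RintegralZl// -subr_ge0 -RintegralB//; last exact: integZ.
  have id := integD (integZ c^-1 ish) (integZ (-1) hi).
  rewrite (@Rintegral_ae _ _ _ mu _ (fun x => `|c^-1 * ((Num.sqrt (V x) * h x) * (Num.sqrt (V x) * h x)) - h x * h x|)).
  - by apply: Rintegral_ge0.
  - by under eq_fun do rewrite -mulN1r; exact: (integ_measurable id).
  - by under eq_fun do rewrite -mulN1r; apply: measurableT_comp => //; exact: (integ_measurable id).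
  - by apply: filterS bd => x H; rewrite ger0_norm// subr_ge0.
have pi b : sqint mu (p b).
  apply: (contr _ (mp b) _).1; apply: sqint_ae (fi (None, b)); first exact: measurable_funM.
  by apply: filterS Vc => x Vx; rewrite pE.
have pc b : dist (fun x => part b (repr (u n) x)) (p b) @[n --> \oo] --> (0 : R).
  have su n := sqintB (rcoord_sqint (u n) (None, b)) (fi (None, b)).
  have E1 n : {ae mu, forall x, rcoord (u n) (None, b) x - f (None, b) x =
      Num.sqrt (V x) * (part b (repr (u n) x) - p b x)}.
    by rewrite rcoordN; apply: filterS Vc => x Vx; rewrite mulrBr pE.
  have mh n := measurable_funB (repr_sqint (u n) b).1 (mp b).
  have sh n : sqint mu (fun x => Num.sqrt (V x) * (part b (repr (u n) x) - p b x)).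
    apply: (sqint_ae _ (E1 n) (su n)); apply: measurable_funM => //; exact: mh.
  apply: (@squeeze_cvgr _ _ _ _ (fun=> 0) (fun n => c^-1 * dist (rcoord (u n) (None, b)) (f (None, b)))).
  - apply: nearW => n; rewrite dot_ge0 /=.
    have [_] := contr _ (mh n) (sh n).
    by rewrite (dot_ae (sh n) (su n) (sh n) (su n))//; apply: filterS (E1 n) => x ->.
  - exact: cvg_cst.
  - rewrite -[X in _ --> X](mulr0 c^-1); apply: cvgM (fc _); exact: cvg_cst.
pose G i b := f (Some i, b).
have wG i b : weak_partial i (p b) (fun x => (-1) ^+ b * (A x 0 i * p (~~ b) x) + G i b x).
  split.
  - exact/loc2_loc1/sqint_loc2.
  - apply: loc1_lin; last exact/loc2_loc1/sqint_loc2/fi.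
    by apply: loc2_mul => //; exact: sqint_loc2.
  move=> eta teta.
  have se := test_sqint teta; have sd := test_sqint (test_partial i teta).
  have sA := loc2_test (loc2A i) teta.
  have run b' n := repr_sqint (u n) b'.
  have gun n := grad_sqint (u n) i b.
  have spl (q h : E -> R) : sqint mu q -> sqint mu h ->
      \int[mu]_x (((-1) ^+ b * (A x 0 i * q x) + h x) * eta x) =
      (-1) ^+ b * dot mu q (fun x => A x 0 i * eta x) + dot mu h eta.
    move=> qi hi; rewrite /dot -RintegralZl//; last exact: integ_mul.
    rewrite -RintegralD//; [|exact/integZ/integ_mul|exact: integ_mul].
    by apply: eq_Rintegral => x _; ring.
  rewrite spl//; last exact: fi.
  have E1 n : dot mu (fun x => part b (repr (u n) x)) (partial i eta) =
     - ((-1) ^+ b * dot mu (fun x => part (~~ b) (repr (u n) x)) (fun x => A x 0 i * eta x) +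
       dot mu (fun x => part b (magnetic_grad A (repr (u n)) x 0 i)) eta).
    rewrite -spl//; have /magnetic_gradientP/(_ i b)[_ _ W] := grad_repr (u n).
    exact: W.
  apply: (cvg_eq_lim E1).
    exact: (dot_cvg (run b) (pi b) sd (pc b)).
  apply: cvgN; apply: cvgD.
    apply: cvgM; first exact: cvg_cst.
    exact: (dot_cvg (run (~~ b)) (pi (~~ b)) sA (pc (~~ b))).
  exact: (dot_cvg gun (fi _) se (fc (Some i, b))).
pose w x : Rcomplex R := Complex (p false x) (p true x).
have wE b x : part b (w x) = p b x by case: b.
pose g x : 'rV[Rcomplex R]_N := \row_i Complex (G i false x) (G i true x).
have gE i b x : part b (g x 0 i) = G i b x by rewrite mxE; case: b.
have wg : magnetic_gradient A w g.
  apply/magnetic_gradientP => i b; have := wG i b.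
  suff -> : (fun x => part b (w x)) = p b.
    suff -> : (fun x => (-1) ^+ b * (A x 0 i * p (~~ b) x) + G i b x) =
      (fun x => (-1) ^+ b * (A x 0 i * part (~~ b) (w x)) + part b (g x 0 i)) by [].
    by apply/funext => x; rewrite wE gE.
  by apply/funext => x; rewrite wE.
have Hw : mem_H1 A V w.
  split.
  - by apply/L2P => b; under eq_fun do rewrite wE.
  - have i2 := integD (fi (None, false)).2 (fi (None, true)).2.
    apply: (integ_ae _ _ i2).
      apply: measurable_funM => //.
      have -> : (fun x => `|w x| ^+ 2) = fun x => p false x ^+ 2 + p true x ^+ 2.
        by apply/funext => x; rewrite sqr_norm_part !wE.
      by apply: measurable_funD; exact: measurable_funX.
    apply: filterS Vc => x Vx; rewrite -(pE _ false Vx) -(pE _ true Vx).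
    rewrite ![(_ * p _ _) ^+ 2]exprMn sqr_sqrtr ?(le_trans (ltW c0))//.
    by rewrite sqr_norm_part !wE mulrDr.
  - exists g => // i; apply/L2P => b; under eq_fun do rewrite gE.
    exact: fi.
exists (H1_class A V w) => -[[i|] b]; last first.
  by rewrite rcoordN; apply: filterS2 (repr_class Hw) Vc => x -> Vx; rewrite wE pE.
by apply: filterS (grad_class i b Hw wg) => x H; rewrite [LHS]H gE.
Qed.

(** ** Infinitely many independent elements *)

Lemma real_test_mem (f : E -> R) : test_function f ->
  mem_H1 A V (fun x => Complex (f x) 0 : Rcomplex R).
Proof.
move=> tf; have sf := test_smooth tf.
have Z : (fun=> 0) = (fun x => -1 * (0 : R) + 0) :> (E -> R) by apply/funext => x; ring.
split.
- by apply/L2P => -[]; [exact: sqint0|exact: test_sqint].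
- have := loc1_test loc1V (testM tf sf).
  suff -> : (fun x => (V x * `|Complex (f x) 0 : Rcomplex R| ^+ 2)%:E) =
     EFin \o (fun x => V x * (f x * f x)) by [].
  by apply/funext => x /=; congr EFin; rewrite sqr_norm_part /=; ring.
- pose g x : 'rV[Rcomplex R]_N := \row_i Complex (partial i f x) (A x 0 i * f x).
  exists g; last first.
    move=> i; apply/L2P => -[] /=; under eq_fun do rewrite /g mxE /=.
      exact: loc2_test.
    exact/test_sqint/test_partial.
  apply/magnetic_gradientP => i -[] /=.
    have -> : (fun x => (-1) ^+ true * (A x 0 i * f x) + part true (g x 0 i)) = fun=> 0.
      by apply/funext => x; rewrite mxE /=; ring.
    have := weak_partial_smooth i (fun k => @Ck_cst R N k 0).
    suff -> : partial i (fun _ : E => 0 : R) = fun=> 0 by [].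
    by apply/funext => x; rewrite /partial derive_cst.
  have -> : (fun x => (-1) ^+ false * (A x 0 i * 0) + part false (g x 0 i)) = partial i f.
    by apply/funext => x; rewrite mxE /=; ring.
  exact: weak_partial_smooth.
Qed.

(** Everything is inherited from L^2 through the coordinates; the independent elements are
    bump functions on the cubes (k, k+1)^N. *)
Theorem H1_separable_infinite_hilbert : (0 < N)%N -> separable_infinite_hilbert (H1_ip A V).
Proof.
move=> N0; split.
- exact: (l2_inner_product rcoord_sqint rcoord_lin rcoord_ip rcoord_inj).
- apply: (l2_complete rcoord_sqint rcoord_lin rcoord_ip); exact: rcoord_closed.
- apply: (l2_separable rcoord_sqint rcoord_lin rcoord_ip); exact: sqint_separable.
pose lo (k : nat) (_ : 'I_N) : R := k%:R; pose hi (k : nat) (_ : 'I_N) : R := k.+1%:R.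
pose B k := box (lo k) (hi k); pose f k := bumpf (lo k) (hi k) 1.
pose w k x : Rcomplex R := Complex (f k x) 0.
have Hw k : mem_H1 A V (w k) by apply: real_test_mem; exact: bump_test.
apply: (@l2_infinite_dimensional _ _ _ mu H1 _ rcoord rcoord_lin (fun k => H1_class A V (w k)) (None, false) B).
- move=> k; have mB : measurable (B k) by exact: measurable_box.
  move=> /(measure_negligible mB) Bk0.
  have : (0 < mu (B k))%E by apply: box_gt0 => i; rewrite ltr_nat.
  by rewrite Bk0 ltxx.
- move=> k; rewrite rcoordN; apply: filterS2 (repr_class (Hw k)) Vc => x -> Vx Bx.
  rewrite mulf_neq0//; first by rewrite sqrtr_eq0 -ltNge (lt_le_trans c0).
  by rewrite gt_eqF//; exact: bump_gt0.
- move=> k l kl; rewrite rcoordN; apply: filterS (repr_class (Hw l)) => x -> Bx.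
  rewrite /part /w /= /f bump_out ?mulr0// => Bl.
  have /andP[k1 k2] := Bx (Ordinal N0); have /andP[l1 l2] := Bl (Ordinal N0).
  have := lt_trans k1 l2; have := lt_trans l1 k2; rewrite !ltr_nat !ltnS => lk kl'.
  by move/negP: kl; apply; rewrite eqn_leq lk kl'.
Qed.

End magnetic_sobolev_space.

(** * Magnetic translations *)

Section unimodular.
Context {R : realType}.
Local Notation C := (Rcomplex R).

(** The real scalar product of the plane; it is invariant under rotations. *)
Definition hdot (z w : C) : R := part false z * part false w + part true z * part true w.

Lemma expiM t (z : C) b :
  part b (expi t * z) = cos t * part b z - (-1) ^+ b * (sin t * part (~~ b) z).
Proof. by case: z b => [p q] [] /=; ring. Qed.

Lemma expi_lin t a (z w : C) : expi t * (a *: z + w) = a *: (expi t * z) + expi t * w.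
Proof. by apply: part_eq => b; rewrite part_lin !expiM !part_lin; ring. Qed.

Lemma expiD s t : expi (s + t) = expi s * expi t :> C.
Proof. by apply: part_eq => -[]; rewrite expiM /= ?sinD ?cosD; ring. Qed.

Lemma hdot_expi t (z w : C) : hdot (expi t * z) (expi t * w) = hdot z w.
Proof.
rewrite /hdot !expiM; case: z w => [p q] [u v] /=.
transitivity ((cos t ^+ 2 + sin t ^+ 2) * (p * u + q * v)); first ring.
by rewrite cos2Dsin2 mul1r.
Qed.

Lemma hdot_bound (z w : C) : `|hdot z w| <=
  (`|part false z| + `|part true z|) * (`|part false w| + `|part true w|).
Proof.
rewrite (le_trans (ler_normD _ _))// !normrM.
have := normr_ge0 (part false z); have := normr_ge0 (part true z).
have := normr_ge0 (part false w); have := normr_ge0 (part true w).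
nra.
Qed.

Lemma part_expi_bound t (z : C) b : `|part b (expi t * z)| <= `|part false z| + `|part true z|.
Proof.
have c1 : `|cos t| <= 1 by rewrite ler_norml cos_geN1 cos_le1.
have s1 : `|sin t| <= 1 by rewrite ler_norml sin_geN1 sin_le1.
rewrite expiM (le_trans (ler_normB _ _))// !normrM normrX normrN1 expr1n mul1r.
by case: b => /=; [rewrite addrC|]; apply: lerD; rewrite ler_piMl.
Qed.

End unimodular.

Section gauge.
Context {R : realType} {N : nat}.
Local Notation E := 'rV[R]_N.
Local Notation C := (Rcomplex R).
Local Notation mu := (@lebesgue_rV R N).
Local Notation integ f := (mu.-integrable setT (EFin \o f)).
Variables (A : E -> E) (V : E -> R).
Hypothesis loc2A : forall i, loc2 (fun x => A x 0 i).

(** [phi] is a phase by which translation along [y] has to be corrected in order to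
    commute with the magnetic gradient. *)
Definition admissible (phi : E -> R) (y : E) : Prop :=
  [/\ continuous phi, {ae mu, forall x, V (x + y) = V x} &
  exists2 g : E -> E, forall i, weak_partial i phi (fun x => g x 0 i) &
    {ae mu, forall x, A (x + y) = A x + g x}].

Lemma weak_partial_cst i (a : R) : weak_partial i (fun _ : E => a) (fun=> 0).
Proof.
have := weak_partial_smooth i (fun k => @Ck_cst R N k a).
suff -> : partial i (fun _ : E => a) = fun=> 0 by [].
by apply/funext => x; rewrite /partial derive_cst.
Qed.

Lemma weak_partialDcst i (f g : E -> R) a : weak_partial i f g ->
  weak_partial i (fun x => f x + a) g.
Proof.
move=> fg; have := weak_partial_lincomb 1 fg (weak_partial_cst i a).
have -> : (fun x => 1 * f x + a) = fun x => f x + a by apply/funext => x; rewrite mul1r.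
suff -> : (fun x => 1 * g x + 0) = g by [].
by apply/funext => x; rewrite mul1r addr0.
Qed.

Lemma weak_partialB i (f f' g g' : E -> R) : weak_partial i f g -> weak_partial i f' g' ->
  weak_partial i (fun x => f x - f' x) (fun x => g x - g' x).
Proof.
move=> fg fg'; have := weak_partial_lincomb (-1) fg' fg.
have sub (h k : E -> R) : (fun x => -1 * h x + k x) = fun x => k x - h x.
  by apply/funext => x; ring.
by rewrite !sub.
Qed.

Lemma weak_partialD i (f f' g g' : E -> R) : weak_partial i f g -> weak_partial i f' g' ->
  weak_partial i (fun x => f x + f' x) (fun x => g x + g' x).
Proof.
move=> fg fg'; have := weak_partial_lincomb 1 fg fg'.
have add (h k : E -> R) : (fun x => 1 * h x + k x) = fun x => h x + k x.
  by apply/funext => x; ring.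
by rewrite !add.
Qed.

Lemma admissible_cst phi y a : admissible phi y -> admissible (fun x => phi x + a) y.
Proof.
move=> [cphi Vy [g wg Ag]]; split=> //.
  by apply: continuous_addf => //; exact: cst_continuous.
by exists g => // i; exact: weak_partialDcst.
Qed.

Lemma admissible_comp phi phi' y y' : admissible phi y -> admissible phi' y' ->
  admissible (fun x => phi x + phi' (x + y)) (y + y').
Proof.
move=> [cphi Vy [g wg Ag]] [cphi' Vy' [g' wg' Ag']]; split.
- by apply: continuous_addf => //; exact: continuous_shiftf.
- by apply: filterS2 Vy (ae_shift y Vy') => x E1 E2; rewrite addrA E2.
exists (fun x => g x + g' (x + y)).
  move=> i; have := weak_partialD (wg i) (weak_partial_shift y (wg' i)).
  suff -> : (fun x => (g x + g' (x + y)) 0 i) = fun x => g x 0 i + g' (x + y) 0 i by [].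
  by apply/funext => x; rewrite mxE.
by apply: filterS2 Ag (ae_shift y Ag') => x E1 E2; rewrite addrA E2 E1 addrA.
Qed.

Lemma admissible_inv phi y : admissible phi y -> admissible (fun x => - phi (x - y)) (- y).
Proof.
move=> [cphi Vy [g wg Ag]]; split.
- have -> : (fun x : E => - phi (x - y)) = fun x : E => -1 * phi (x - y).
    by apply/funext => x; ring.
  by apply: continuous_mulf; [exact: cst_continuous|exact: continuous_shiftf].
- by apply: filterS (ae_shift (- y) Vy) => x; rewrite subrK.
exists (fun x => - g (x - y)).
  move=> i; have := weak_partialB (weak_partial_cst i 0) (weak_partial_shift (- y) (wg i)).
  have -> : (fun x : E => 0 - phi (x - y)) = fun x => - phi (x - y).
    by apply/funext => x; rewrite sub0r.
  suff -> : (fun x : E => 0 - g (x - y) 0 i) = fun x => (- g (x - y)) 0 i by [].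
  by apply/funext => x; rewrite mxE sub0r.
by apply: filterS (ae_shift (- y) Ag) => x; rewrite subrK => ->; rewrite addrK.
Qed.

(** Two admissible phases for one translation have the same gradient, that is, the
    difference of the two values of A. *)
Lemma admissible_uniq phi phi' y : admissible phi y -> admissible phi' y ->
  exists a, phi' = fun x => phi x + a.
Proof.
move=> [cphi _ [g wg Ag]] [cphi' _ [g' wg' Ag']]; exists (phi' 0 - phi 0).
have cB : continuous (fun x => phi' x - phi x).
  have -> : (fun x => phi' x - phi x) = fun x => phi' x + -1 * phi x.
    by apply/funext => x; ring.
  by apply: continuous_addf => //; apply: continuous_mulf => //; exact: cst_continuous.
have wB i := weak_partialB (wg' i) (wg i).
have g0 i : {ae mu, forall x, g' x 0 i - g x 0 i = 0}.
  by apply: filterS2 Ag Ag' => x ->; move/addrI ->; rewrite subrr.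
by apply/funext => x; rewrite -(zero_gradient_cst cB wB g0 x) addrC subrK.
Qed.

Lemma admissible_loc2 (phi : E -> R) y (g : E -> E) : (forall i, weak_partial i phi (fun x => g x 0 i)) ->
  {ae mu, forall x, A (x + y) = A x + g x} -> forall i, loc2 (fun x => g x 0 i).
Proof.
move=> wg Ag i; have [_ lg _] := wg i.
have := loc2_lin (-1) (loc2A i) (loc2_shift y (loc2A i)).
apply: loc2_le; first exact: loc1_measurable lg.
apply: filterS Ag => x H; rewrite H !mxE.
by rewrite mulN1r addrA addNr add0r.
Qed.

(** The gauge covariance of the magnetic gradient: differentiating the phase produces
    i grad(phi) times the function, which is what turns A into A(. + y). *)
Lemma magnetic_gradient_translate phi y (u : E -> C) (G : E -> 'rV[C]_N) : admissible phi y ->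
  (forall b, sqint mu (fun x => part b (u x))) ->
  (forall i b, sqint mu (fun x => part b (G x 0 i))) -> magnetic_gradient A u G ->
  magnetic_gradient A (fun x => expi (phi x) * u (x + y))
    (fun x => \row_i (expi (phi x) * G (x + y) 0 i)).
Proof.
move=> [cphi _ [g wg Ag]] su sG /magnetic_gradientP uG.
have lg := admissible_loc2 wg Ag.
have mphi : measurable_fun setT phi by exact: continuous_measurable_rV.
have mcos : measurable_fun setT (fun x => cos (phi x)).
  apply: measurableT_comp => //; exact: continuous_measurable_fun (@continuous_cos R).
have msin : measurable_fun setT (fun x => sin (phi x)).
  apply: measurableT_comp => //; exact: continuous_measurable_fun (@continuous_sin R).
have mu' b : measurable_fun setT (fun x : E => part b (u (x + y))).
  by have [] := sqint_shift y (su b).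
have mG i b : measurable_fun setT (fun x : E => part b (G (x + y) 0 i)).
  by have [] := sqint_shift y (sG i b).
pose D i (b : bool) (x : E) := (-1) ^+ b * (A (x + y) 0 i * part (~~ b) (u (x + y))) + part b (G (x + y) 0 i).
have wD i b : weak_partial i (fun x => part b (u (x + y))) (D i b).
  exact: (weak_partial_shift y (uG i b)).
have lu b : loc2 (fun x : E => part b (u (x + y))) by exact/sqint_loc2/(sqint_shift y (su b)).
have mE b (z : E -> C) : (forall b, measurable_fun setT (fun x => part b (z x))) ->
    measurable_fun setT (fun x => part b (expi (phi x) * z x)).
  move=> mz; under eq_fun do rewrite expiM.
  by apply: measurable_funB; repeat apply: measurable_funM => //.
apply/magnetic_gradientP => i b.
have := weak_partial_lincomb (- (-1) ^+ b)
  (weak_partial_sin cphi (wg i) (lg i) (wD i (~~ b)) (lu _))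
  (weak_partial_cos cphi (wg i) (lg i) (wD i b) (lu _)).
apply: weak_partial_ae.
- exact: (mE b (fun x => u (x + y))).
- apply: measurable_funD.
    apply: measurable_funM => //; apply: measurable_funM; first by case: (loc2A i).
    exact: (mE (~~ b) (fun x => u (x + y))).
  have -> : (fun x => part b ((\row_i0 (expi (phi x) * G (x + y) 0 i0)) 0 i)) =
    fun x => part b (expi (phi x) * G (x + y) 0 i) by apply/funext => x; rewrite mxE.
  exact: (mE b (fun x => G (x + y) 0 i)).
- by apply: aeW => x; rewrite expiM; ring.
- apply: filterS Ag => x Ax; rewrite mxE !expiM /D Ax mxE; case: b => /=; ring.
Qed.

End gauge.

Section magnetic_translation.
Context {R : realType} {N : nat}.
Local Notation E := 'rV[R]_N.
Local Notation C := (Rcomplex R).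
Local Notation mu := (@lebesgue_rV R N).
Local Notation integ f := (mu.-integrable setT (EFin \o f)).
Variables (A : E -> E) (V : E -> R) (c : R).
Hypothesis loc2A : forall i, loc2 (fun x => A x 0 i).
Hypothesis loc1V : Lp_loc 1 V.
Hypothesis c0 : 0 < c.
Hypothesis Vc : {ae mu, forall x, c <= V x}.
Local Notation H1 := (H1_space A V).
Local Notation admissible := (admissible A V).

(** The operators tau_y are the case of the phases psi_y - psi_y (-y) / 2. Allowing all
    admissible phases makes the family closed under products and inverses. *)
Definition translate (phi : E -> R) (y : E) (U : H1) : H1 :=
  H1_class A V (fun x => expi (phi x) * repr U (x + y)).

Lemma H1_ext (U W : H1) : {ae mu, forall x, repr U x = repr W x} -> U = W.
Proof. by move/pi_ae; rewrite !reprK. Qed.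

Lemma sqint_expi (phi : E -> R) (y : E) (z : E -> C) b : measurable_fun setT phi ->
  (forall b, sqint mu (fun x => part b (z x))) ->
  sqint mu (fun x => part b (expi (phi x) * z (x + y))).
Proof.
move=> mphi sz.
have mcos : measurable_fun setT (fun x => cos (phi x)).
  apply: measurableT_comp => //; exact: continuous_measurable_fun (@continuous_cos R).
have msin : measurable_fun setT (fun x => sin (phi x)).
  apply: measurableT_comp => //; exact: continuous_measurable_fun (@continuous_sin R).
have sy b' := sqint_shift y (sz b'); have my b' := (sy b').1.
have ny b' : sqint mu (fun x => `|part b' (z (x + y))|).
  apply: (sqint_le _ _ (sy b')); first exact: measurableT_comp.
  by apply: aeW => x; rewrite normr_id.
apply: (sqint_le _ _ (sqintD (ny false) (ny true))).
  under eq_fun do rewrite expiM.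
  by apply: measurable_funB; repeat apply: measurable_funM => //.
by apply: aeW => x; rewrite [leRHS]ger0_norm ?addr_ge0// part_expi_bound.
Qed.

Lemma admissible_measurable phi y : admissible phi y -> measurable_fun setT phi.
Proof. by move=> [cphi _ _]; exact: continuous_measurable_rV. Qed.

Lemma translate_gradient phi y (U : H1) : admissible phi y ->
  magnetic_gradient A (fun x => expi (phi x) * repr U (x + y))
    (fun x => \row_i (expi (phi x) * magnetic_grad A (repr U) (x + y) 0 i)).
Proof.
move=> adm.
exact: (magnetic_gradient_translate loc2A adm (repr_sqint U)
  (fun i b => grad_sqint loc2A U i b) (grad_repr U)).
Qed.

Lemma translate_mem phi y (U : H1) : admissible phi y ->
  mem_H1 A V (fun x => expi (phi x) * repr U (x + y)).
Proof.
move=> adm; have mphi := admissible_measurable adm; split.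
- by apply/L2P => b; exact: sqint_expi (repr_sqint U).
- have [_ iV _] := repr_mem U; have := integ_shift y iV.
  apply: integ_ae.
    apply: measurable_funM; first exact: loc1_measurable.
    under eq_fun do rewrite sqr_norm_part.
    have mp b := measurable_funX 2 (sqint_expi y b mphi (repr_sqint U)).1.
    exact: measurable_funD (mp false) (mp true).
  have [_ Vy _] := adm; apply: filterS Vy => x ->; congr (_ * _).
  have := hdot_expi (phi x) (repr U (x + y)) (repr U (x + y)).
  by rewrite /hdot -!expr2 -!sqr_norm_part => ->.
- exists (fun x => \row_i (expi (phi x) * magnetic_grad A (repr U) (x + y) 0 i)).
    exact: translate_gradient.
  move=> i; apply/L2P => b.
  have -> : (fun x => part b ((\row_j (expi (phi x) * magnetic_grad A (repr U) (x + y) 0 j)) 0 i)) =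
    fun x => part b (expi (phi x) * magnetic_grad A (repr U) (x + y) 0 i).
    by apply/funext => x; rewrite mxE.
  exact: (sqint_expi y b mphi (fun b => grad_sqint loc2A U i b)).
Qed.

Lemma translate_repr phi y U : admissible phi y ->
  {ae mu, forall x, repr (translate phi y U) x = expi (phi x) * repr U (x + y)}.
Proof. by move=> adm; exact/repr_class/translate_mem. Qed.

Lemma translate_ccoord phi y U k : admissible phi y ->
  {ae mu, forall x, ccoord (translate phi y U) k x = expi (phi x) * ccoord U k (x + y)}.
Proof.
move=> adm; case: k => [i|] /=.
  have G b := grad_class i b (translate_mem U adm) (translate_gradient U adm).
  apply: filterS2 (G false) (G true) => x Gf Gt.
  by apply: part_eq => -[]; rewrite ?Gf ?Gt mxE.
have [_ Vy _] := adm; apply: filterS2 (translate_repr U adm) Vy => x -> ->.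
by apply: part_eq => b; rewrite expiM !partZ expiM; ring.
Qed.

Lemma ccoord_sqint (U : H1) k b : sqint mu (fun x => part b (ccoord U k x)).
Proof. exact: (rcoord_sqint loc2A loc1V c0 Vc U (k, b)). Qed.

Lemma hdot_integ (f g : E -> C) : (forall b, sqint mu (fun x => part b (f x))) ->
  (forall b, sqint mu (fun x => part b (g x))) -> integ (fun x => hdot (f x) (g x)).
Proof. by move=> sf sg; apply: integD; exact: integ_mul. Qed.

Lemma H1_ipE (U W : H1) :
  H1_ip A V U W = \sum_k \int[mu]_x hdot (ccoord U k x) (ccoord W k x).
Proof.
rewrite (rcoord_ip loc2A loc1V c0 Vc) -(pair_bigA _ (fun k b => dot mu (rcoord U (k, b)) (rcoord W (k, b)))).
apply: eq_bigr => k _; rewrite big_bool /= /hdot RintegralD//; last 2 first.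
- exact: integ_mul (ccoord_sqint U k _) (ccoord_sqint W k _).
- exact: integ_mul (ccoord_sqint U k _) (ccoord_sqint W k _).
by rewrite addrC.
Qed.

Lemma translate_ip phi y U W : admissible phi y ->
  H1_ip A V (translate phi y U) (translate phi y W) = H1_ip A V U W.
Proof.
move=> adm; rewrite !H1_ipE; apply: eq_bigr => k _.
have iUW := hdot_integ (ccoord_sqint U k) (ccoord_sqint W k).
rewrite -(Rintegral_shift y iUW); apply: Rintegral_ae.
- exact/integ_measurable/hdot_integ/ccoord_sqint/ccoord_sqint.
- exact: integ_measurable (integ_shift y iUW).
apply: filterS2 (translate_ccoord U k adm) (translate_ccoord W k adm) => x -> ->.
exact: hdot_expi.
Qed.

Lemma translate_linear phi y a U W : admissible phi y ->
  translate phi y (a *: U + W) = a *: translate phi y U + translate phi y W.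
Proof.
move=> adm; apply: H1_ext.
apply: filterS3 (filterI (translate_repr U adm) (translate_repr W adm))
  (filterI (translate_repr (a *: U + W) adm) (ae_shift y (repr_lin a U W)))
  (repr_lin a (translate phi y U) (translate phi y W)) => x [E1 E2] [E3 E4] E5.
by rewrite E3 E4 E5 E1 E2 expi_lin.
Qed.

Lemma translate_comp phi phi' y y' U : admissible phi y -> admissible phi' y' ->
  translate phi y (translate phi' y' U) =
  translate (fun x => phi x + phi' (x + y)) (y + y') U.
Proof.
move=> adm adm'; apply: H1_ext.
apply: filterS3 (translate_repr (translate phi' y' U) adm)
  (ae_shift y (translate_repr U adm')) (translate_repr U (admissible_comp adm adm')) => x.
by move=> -> -> ->; rewrite expiD mulrA addrA.
Qed.

Lemma translate_inv phi y U : admissible phi y ->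
  translate phi y (translate (fun x => - phi (x - y)) (- y) U) = U.
Proof.
move=> adm; have adm' := admissible_inv adm; apply: H1_ext; rewrite translate_comp//.
apply: filterS (translate_repr U (admissible_comp adm adm')) => x ->.
rewrite addrK subrr addrN addr0; apply: part_eq => b.
by rewrite expiM cos0 sin0; ring.
Qed.

(** An invertible isometry has its inverse as adjoint. *)
Lemma translate_adjoint phi y U W : admissible phi y ->
  H1_ip A V (translate phi y U) W =
  H1_ip A V U (translate (fun x => - phi (x - y)) (- y) W).
Proof. by move=> adm; rewrite -{1}(translate_inv W adm) translate_ip. Qed.

(** exp (i a) T = cos a T + sin a (i T), where i T is the translation whose phase is
    augmented by pi / 2. This expresses complex multiples within a real vector space. *)
Lemma translate_rotate phi y a U : admissible phi y ->
  translate (fun x => phi x + a) y U =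
  cos a *: translate phi y U + sin a *: translate (fun x => phi x + pi / 2) y U.
Proof.
move=> adm; have adma := admissible_cst a adm; have admp := admissible_cst (pi / 2) adm.
apply: H1_ext.
have := repr_lin 1 (cos a *: translate phi y U) (sin a *: translate (fun x => phi x + pi / 2) y U).
rewrite scale1r.
have := repr_lin (cos a) (translate phi y U) (sin a *: translate (fun x => phi x + pi / 2) y U).
move=> L1 _; have L2 := repr_lin (sin a) (translate (fun x => phi x + pi / 2) y U) 0.
rewrite addr0 in L2.
have Z0 := repr_lin (-1) (0 : H1) 0; rewrite scaler0 addr0 in Z0.
apply: filterS3 (filterI (translate_repr U adm) (filterI (translate_repr U adma) (translate_repr U admp)))
  L1 (filterI L2 Z0) => x [E1 [E2 E3]] E4 [E5 E6].
rewrite E2 E4 E1 E5 E3; apply: part_eq => b.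
have P0 : part b (repr (0 : H1) x) = 0 by rewrite E6 part_lin; ring.
by rewrite !part_lin P0 !expiM cosD sinD cosDpihalf sinDpihalf; ring.
Qed.

End magnetic_translation.

(** * Weak convergence *)

Section weak_convergence.
Context {R : realType}.

Lemma cvg0_bound (p S : nat -> R) : (forall k, `|p k| <= S k) ->
  S k @[k --> \oo] --> (0 : R) -> p k @[k --> \oo] --> (0 : R).
Proof.
move=> pS S0; apply: (@squeeze_cvgr _ _ _ _ (fun n => - S n) S) => //.
- by apply: nearW => n; rewrite -ler_norml.
- by rewrite -oppr0; exact: cvgN.
Qed.

Lemma cvg_eventually (p : nat -> R) l n0 : (forall n, (n0 <= n)%N -> p n = l) ->
  p n @[n --> \oo] --> l.
Proof.
move=> pl; apply/cvgrPdist_lt => e e0; exists n0 => // n n0n.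
by rewrite (pl n n0n) subrr normr0.
Qed.

Lemma cvg0_rotation (a p q : nat -> R) : p k @[k --> \oo] --> (0 : R) ->
  q k @[k --> \oo] --> (0 : R) -> cos (a k) * p k + sin (a k) * q k @[k --> \oo] --> (0 : R).
Proof.
move=> p0 q0; apply: (@cvg0_bound _ (fun k => `|p k| + `|q k|)).
  move=> k; rewrite (le_trans (ler_normD _ _))// !normrM.
  by apply: lerD; rewrite ler_piMl// ler_norml ?cos_geN1 ?cos_le1 ?sin_geN1 ?sin_le1.
have np : `|p k| @[k --> \oo] --> (0 : R) by rewrite -[X in _ --> X](@normr0 R R); exact: cvg_norm.
have nq : `|q k| @[k --> \oo] --> (0 : R) by rewrite -[X in _ --> X](@normr0 R R); exact: cvg_norm.
by rewrite -[X in _ --> X](addr0 (0 : R)); exact: cvgD.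
Qed.

Section inner_product_space.
Variables (H : lmodType R) (ip : H -> H -> R).
Hypothesis ipP : inner_product ip.

Lemma ipZ a u w : ip (a *: u) w = a * ip u w.
Proof.
have [_ lin _ _] := ipP; have := lin a u 0 w; rewrite addr0 => ->.
have : ip 0 w = 0 by have := lin (-1) 0 0 w; rewrite scaler0 addr0 => ->; ring.
by move=> ->; rewrite addr0.
Qed.

Lemma ipD u v w : ip (u + v) w = ip u w + ip v w.
Proof. by have [_ lin _ _] := ipP; have := lin 1 u v w; rewrite scale1r mul1r. Qed.

(** A space of positive dimension has a normalized vector, so the set of operator norms
    below is not empty. *)
Lemma unit_vector : @infinite_dimensional R H -> exists u, hnorm ip u = 1.
Proof.
have [ipC _ ge0 ip0] := ipP; move=> /(_ 0%N (fun=> 0))[u u0].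
have nu : ip u u != 0.
  by apply/eqP => /ip0 u00; apply: (u0 (fun=> 0)); rewrite big_ord0.
exists ((Num.sqrt (ip u u))^-1 *: u).
by rewrite /hnorm ipZ ipC ipZ mulrA -expr2 exprVn sqr_sqrtr ?ge0// mulVf ?sqrtr1.
Qed.

Lemma adjoint_uniq S S' : is_adjoint ip S S' -> adjoint ip S = S'.
Proof.
move=> SS'; have [ipC _ _ ip0] := ipP.
apply: xget_unique => // S'' SS''; apply/funext => w.
apply/eqP; rewrite -subr_eq0; apply/eqP/ip0.
have E1 z : ip (S'' w - S' w) z = ip z (S'' w) - ip z (S' w).
  by rewrite ipD -scaleN1r ipZ mulN1r ipC (ipC (S' w)).
by rewrite E1 -SS'' -SS' subrr.
Qed.

End inner_product_space.

Lemma weakly_to0_subseq (H : lmodType R) (ip : H -> H -> R) (u : nat -> H) (n : nat -> nat) :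
  {homo n : i j / (i < j)%N} -> weakly_to0 ip u -> weakly_to0 ip (u \o n).
Proof.
move=> ninc u0 W; move/cvgrPdist_lt : (u0 W) => uW; apply/cvgrPdist_lt => e e0.
have [n0 _ Hn0] := uW e e0; exists n0 => // k n0k; apply: Hn0 => /=.
apply: (leq_trans n0k); elim: k {n0k} => // k IH.
by apply: (leq_ltn_trans IH); exact: ninc.
Qed.

Lemma subseq_of_infinite (P : nat -> Prop) :
  (forall n0, exists2 n, (n0 <= n)%N & P n) ->
  exists2 n : nat -> nat, {homo n : i j / (i < j)%N} & forall k, P (n k).
Proof.
move=> H; have /choice[h Hh] : forall n0, exists n, (n0 <= n)%N /\ P n.
  by move=> n0; have [n n0n Pn] := H n0; exists n.
pose n := fix n k := if k is k'.+1 then h (n k').+1 else h 0%N.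
exists n; last by case=> [|k]; case: (Hh 0%N) => // *; case: (Hh (n k).+1).
apply: homo_ltn; first by move=> y x z; exact: ltn_trans.
by move=> k /=; case: (Hh (n k).+1).
Qed.

End weak_convergence.

(** * Translations along divergent sequences of lattice vectors *)

Section divergent.
Context {R : realType} {N : nat}.
Local Notation E := 'rV[R]_N.
Local Notation mu := (@lebesgue_rV R N).
Variable d : nat -> 'rV[int]_N.
Hypothesis d_div : forall z, exists n0, forall n, (n0 <= n)%N -> d n != z.

(** Only finitely many lattice vectors lie in a given cube. *)
Lemma eventually_outside (K : nat) : exists n0, forall n, (n0 <= n)%N ->
  exists i, K%:R < `|lattice (d n) 0 i| :> R.
Proof.
pose Z (r : 'rV['I_(K + K).+1]_N) : 'rV[int]_N := \row_i ((r 0 i : nat)%:Z - K%:Z).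
have : \forall n \near \oo, forall r, d n != Z r.
  by apply: filter_forall => r; have [n0 Hn0] := d_div (Z r); exists n0.
move=> [n0 _ Hn0]; exists n0 => n n0n; apply: contrapT => /forallNP H.
pose r : 'rV['I_(K + K).+1]_N := \row_i inord (absz (d n 0 i + K%:Z)).
have /negP := Hn0 n n0n r; apply; apply/eqP/rowP => i; rewrite !mxE.
have := H i; move/negP; rewrite -leNgt mxE -intr_norm pmulrn ler_int => dK.
move: dK; rewrite lter_norml => /andP[dK1 dK2].
rewrite inordK; last by lia.
have dK : 0 <= d n 0 i + K%:Z by rewrite addrC -lerBlDl sub0r.
by rewrite gez0_abs// addrK.
Qed.

(** Outside a large cube g has small norm, while a fixed cube sees, after the
    translation, only the tail of f. *)
Lemma translate_vanish (f g : E -> R) : sqint mu f -> sqint mu g ->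
  dot mu (fun x => f (x + lattice (d n))) g @[n --> \oo] --> (0 : R).
Proof.
move=> sf sg; apply/cvgrPdist_lt => e e0.
pose gm m (x : E) := g x * \1_(cube m) x.
have cut01 m (x : E) (a : R) : `|a * \1_(cube m) x| <= `|a|.
  by have [->|->] := indic01 (cube m) x; rewrite ?mulr0 ?mulr1 ?normr0.
have [|||||_ gmc] := @sqint_dominated _ _ _ mu gm g g.
- by move=> m; exact: measurable_funM sg.1 (sqint_cube m).1.
- by case: sg.
- apply: aeW => x; have [m0 Hm0] := in_cube x.
  apply: (@cvg_eventually _ _ _ m0) => m m0m.
  by rewrite /gm indicE mem_set ?mulr1//; exact: Hm0.
- exact: sg.
- by apply: aeW => x m; exact: cut01.
have e2 : 0 < e / 2 by rewrite divr_gt0.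
have D0 : 0 < dot mu f f + 1 by rewrite ltr_wpDl// dot_ge0.
have C0 : 0 < dot mu g g + 1 by rewrite ltr_wpDl// dot_ge0.
move/cvgrPdist_lt : gmc => /(_ _ (divr_gt0 (exprn_gt0 2 e2) D0))[m _ /(_ m (leqnn m))].
rewrite sub0r normrN ger0_norm ?dot_ge0// ltr_pdivlMr// => Hm.
pose fn n (x : E) := f x * \1_(cube m) (x - lattice (d n)).
have mcut n : measurable_fun setT (fun x : E => \1_(cube m) (x - lattice (d n)) : R).
  exact: measurable_subr (sqint_cube m).1.
have [|||||_ fnc] := @sqint_dominated _ _ _ mu fn (fun=> 0) f.
- by move=> n; apply: measurable_funM => //; case: sf.
- exact: measurable_cst.
- apply: aeW => x; have [K HK] := in_cube x; have [n0 Hn0] := eventually_outside (K + m).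
  apply: (@cvg_eventually _ _ _ n0) => n n0n.
  rewrite /fn indicE memNset ?mulr0// => xd; case: (Hn0 n n0n) => i.
  have := xd i; have := HK K (leqnn K) i; rewrite !mxE natrD.
  have := ler_normB (x 0 i) (x 0 i - (d n 0 i)%:~R).
  rewrite opprB addrCA subrr addr0 => H1 H2 H3; rewrite ltNge => /negP; apply.
  by rewrite (le_trans H1)// lerD.
- exact: sf.
- by apply: aeW => x n; rewrite normrM; have [->|->] := indic01 (cube m) (x - lattice (d n));
    rewrite ?normr0 ?normr1 ?mulr0 ?mulr1.
move/cvgrPdist_lt : fnc => /(_ _ (divr_gt0 (exprn_gt0 2 e2) C0))[n0 _ Hn0].
exists n0 => // n n0n; rewrite sub0r normrN.
have := Hn0 n n0n; rewrite sub0r normrN ger0_norm ?dot_ge0// ltr_pdivlMr// => Hf.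
have sfd := sqint_shift (lattice (d n)) sf.
have sgm : sqint mu (gm m).
  by apply: (sqint_le _ _ sg); [exact: measurable_funM sg.1 (sqint_cube m).1|
    apply: aeW => x; exact: cut01].
have sgB := sqintB sgm sg.
have sfn : sqint mu (fun x => fn n x - 0).
  by apply: (sqint_le _ _ sf); [under eq_fun do rewrite subr0; apply: measurable_funM => //; case: sf|
    apply: aeW => x; rewrite subr0 normrM;
    have [->|->] := indic01 (cube m) (x - lattice (d n)); rewrite ?normr0 ?normr1 ?mulr0 ?mulr1].
have sfs := sqint_shift (lattice (d n)) sfn.
have E1 : dot mu (fun x => f (x + lattice (d n))) g =
    dot mu (fun x => fn n (x + lattice (d n)) - 0) g +
    -1 * dot mu (gm m \- g) (fun x => f (x + lattice (d n))).
  rewrite /dot -RintegralZl//; last exact: integ_mul.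
  rewrite -RintegralD//; [|exact: integ_mul|exact/integZ/integ_mul].
  by apply: eq_Rintegral => x _; rewrite /fn /gm addrK /=; ring.
rewrite E1 mulN1r (le_lt_trans (ler_normB _ _))// [ltRHS]splitr.
have small (a c : R) : a ^+ 2 < (e / 2) ^+ 2 -> `|a| < e / 2.
  by move=> H; rewrite -(ltr_pXn2r (n := 2))// ?nnegrE ?(ltW e2)// real_normK ?num_real.
apply: ltrD; apply: small => //.
- apply: le_lt_trans (cauchy_schwarz sfs sg) _; apply: le_lt_trans Hf.
  rewrite (dot_shift (lattice (d n)) sfn sfn) ler_wpM2l ?dot_ge0//.
  by rewrite lerDl.
- apply: le_lt_trans (cauchy_schwarz sgB sfd) _; apply: le_lt_trans Hm.
  by rewrite (dot_shift (lattice (d n)) sf sf) ler_wpM2l ?dot_ge0// lerDl.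
Qed.

Variables (A : E -> E) (V : E -> R) (c : R).
Hypothesis loc2A : forall i, loc2 (fun x => A x 0 i).
Hypothesis loc1V : Lp_loc 1 V.
Hypothesis c0 : 0 < c.
Hypothesis Vc : {ae mu, forall x, c <= V x}.

(** Pointwise, the absolute value of the scalar product of the coordinates is at most a
    product of two fixed square-integrable functions, one of them translated. *)
Lemma translate_weakly_to0 (phi : nat -> E -> R) :
  (forall n, admissible A V (phi n) (lattice (d n))) ->
  op_weakly_to0 (H1_ip A V) (fun n => @translate R N A V (phi n) (lattice (d n))).
Proof.
move=> adm U W.
pose a Z k x : R := `|part false (ccoord (A := A) (V := V) Z k x)| + `|part true (ccoord Z k x)|.
have sn Z k b := ccoord_sqint loc2A loc1V c0 Vc Z k b.
have sa Z k : sqint mu (a Z k).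
  have s1 b : sqint mu (fun x => `|part b (ccoord (A := A) (V := V) Z k x)|).
    apply: (sqint_le _ _ (sn Z k b)).
      by apply: measurableT_comp => //; case: (sn Z k b).
    by apply: aeW => x; rewrite normr_id.
  exact: sqintD.
pose S n := \sum_k dot mu (fun x => 2 * a U k (x + lattice (d n))) (a W k).
have S0 : S n @[n --> \oo] --> (0 : R).
  rewrite [X in _ --> X](_ : 0 = \sum_(k : option 'I_N) (0 : R)); last by rewrite big1.
  by apply: cvg_big => [|k _]; [exact: add_continuous|exact: translate_vanish (sqintZ 2 (sa U k)) (sa W k)].
have bound n : `|H1_ip A V (translate (phi n) (lattice (d n)) U) W| <= S n.
  rewrite (H1_ipE loc2A loc1V c0 Vc) (le_trans (ler_norm_sum _ _ _))//.
  apply: ler_sum => k _.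
  have mphi := admissible_measurable (adm n).
  have se b := sqint_expi (lattice (d n)) b mphi (sn U k).
  have ih : mu.-integrable setT (EFin \o (fun x =>
      hdot (expi (phi n x) * ccoord U k (x + lattice (d n))) (ccoord W k x))).
    exact: hdot_integ.
  rewrite (@Rintegral_ae _ _ _ mu _ (fun x =>
      hdot (expi (phi n x) * ccoord U k (x + lattice (d n))) (ccoord W k x))).
  - apply: (le_trans (le_normr_Rintegral measurableT ih)).
    apply: le_Rintegral => //; first exact: integrable_norm.
      exact: integ_mul (sqint_shift _ (sqintZ 2 (sa U k))) (sa W k).
    move=> x _; rewrite (le_trans (hdot_bound _ _))//.
    rewrite ler_wpM2r ?addr_ge0// mulr_natl mulr2n.
    by rewrite lerD// part_expi_bound.
  - exact/integ_measurable/hdot_integ.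
  - exact: integ_measurable ih.
  - by apply: filterS (translate_ccoord loc2A loc1V U k (adm n)) => x ->.
exact: cvg0_bound bound S0.
Qed.

End divergent.

Section main.
Context {R : realType} {N : nat}.
Local Notation E := 'rV[R]_N.
Local Notation mu := (@lebesgue_rV R N).
Variables (A : E -> E) (V : E -> R) (c : R).
Hypothesis N0 : (0 < N)%N.
Hypothesis loc2A : forall i, loc2 (fun x => A x 0 i).
Hypothesis loc1V : Lp_loc 1 V.
Hypothesis c0 : 0 < c.
Hypothesis Vc : {ae mu, forall x, c <= V x}.
Local Notation H1 := (H1_space A V).
Local Notation ip := (H1_ip A V).
Local Notation transl := (@translate R N A V).

Let hilbert := H1_separable_infinite_hilbert loc2A loc1V c0 Vc N0.

Let ipP : inner_product ip := hilbert_inner_product hilbert.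

Lemma translate_norm phi y U : admissible A V phi y ->
  hnorm ip (transl phi y U) = hnorm ip U.
Proof. by move=> adm; rewrite /hnorm (translate_ip loc2A loc1V c0 Vc). Qed.

Lemma adjoint_translate phi y : admissible A V phi y ->
  adjoint ip (transl phi y) = transl (fun x => - phi (x - y)) (- y).
Proof.
move=> adm; apply: (adjoint_uniq ipP) => U W.
by rewrite (translate_adjoint loc2A loc1V c0 Vc).
Qed.

(** Constant changes of phase combine two fixed operators with bounded coefficients, and
    each of the two preserves weak convergence to 0 because it has an adjoint. *)
Lemma rotated_weakly_to0 (phi : E -> R) (y : E) (a : nat -> R) (u : nat -> H1) :
  admissible A V phi y -> weakly_to0 ip u ->
  weakly_to0 ip (fun k => transl (fun x => phi x + a k) y (u k)).
Proof.
move=> adm u0 W; have admp := admissible_cst (pi / 2) adm.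
pose p k := ip (transl phi y (u k)) W.
pose q k := ip (transl (fun x => phi x + pi / 2) y (u k)) W.
have p0 : p k @[k --> \oo] --> (0 : R).
  have -> : p = fun k => ip (u k) (transl (fun x => - phi (x - y)) (- y) W).
    by apply/funext => k; rewrite /p (translate_adjoint loc2A loc1V c0 Vc).
  exact: u0.
have q0 : q k @[k --> \oo] --> (0 : R).
  have -> : q = fun k => ip (u k) (transl (fun x => - (phi (x - y) + pi / 2)) (- y) W).
    by apply/funext => k; rewrite /q (translate_adjoint loc2A loc1V c0 Vc).
  exact: u0.
have E1 k : ip (transl (fun x => phi x + a k) y (u k)) W = cos (a k) * p k + sin (a k) * q k.
  by rewrite (translate_rotate loc2A loc1V)// (ipD ipP) !(ipZ ipP).
have := cvg0_rotation a p0 q0.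
suff -> : (fun k => cos (a k) * p k + sin (a k) * q k) =
  fun k => ip (transl (fun x => phi x + a k) y (u k)) W by [].
by apply/funext => k; rewrite E1.
Qed.

(** The operator S_k^* T_k is the translation along d_k = z_k - y_k with some admissible
    phase. If every value of d_k were taken finitely often, these operators would converge
    weakly to 0; so a value recurs, and along its occurrences the phases differ by
    constants. *)
Theorem translations_dislocations (phi : 'rV[int]_N -> E -> R) :
  (forall y, admissible A V (phi y) (lattice y)) ->
  dislocations ip [set transl (phi y) (lattice y) | y in [set: 'rV[int]_N]].
Proof.
move=> adm.
have norms : operator_norms ip [set transl (phi y) (lattice y) | y in [set: 'rV[int]_N]] =
    [set 1%E].
  apply/seteqP; split=> [_ [_ [U [[y _ <-] U1 ->]]]|_ ->].
    by rewrite /= translate_norm ?U1.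
  have [U U1] := unit_vector ipP (hilbert_infinite_dimensional hilbert).
  exists (transl (phi 0) (lattice 0)), U.
  by rewrite translate_norm// U1; split => //; exists 0.
split=> //.
- move=> _ [y _ <-]; split; first by move=> a U W; rewrite (translate_linear loc2A loc1V).
  by exists 1 => U; rewrite translate_norm// mul1r.
- rewrite norms ereal_inf1 ereal_sup1; split; first by rewrite lte_fin.
  by split => //; exact: ltry.
move=> S T DS DT notw u u0.
have /choice[y yE] : forall k, exists y, S k = transl (phi y) (lattice y).
  by move=> k; have [y _ <-] := DS k; exists y.
have /choice[z zE] : forall k, exists z, T k = transl (phi z) (lattice z).
  by move=> k; have [z _ <-] := DT k; exists z.
pose d k := - y k + z k.
pose ph k x := - phi (y k) (x - lattice (y k)) + phi (z k) (x + (- lattice (y k))).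
have dE k : lattice (d k) = - lattice (y k) + lattice (z k) :> E.
  by apply/rowP => i; rewrite !mxE intrD intrN.
have admph k : admissible A V (ph k) (lattice (d k)).
  rewrite dE; apply: (admissible_comp (admissible_inv (adm (y k))) (adm (z k))).
have STE k U : adjoint ip (S k) (T k U) = transl (ph k) (lattice (d k)) U.
  rewrite yE zE adjoint_translate// dE.
  exact: (translate_comp loc2A loc1V U (admissible_inv (adm (y k))) (adm (z k))).
have [z0 Hz0] : exists z0, forall n0, exists2 n, (n0 <= n)%N & d n = z0.
  apply: contrapT => H; apply: notw.
  have -> : (fun k => adjoint ip (S k) \o T k) = fun k => transl (ph k) (lattice (d k)).
    by apply/funext => k; apply/funext => U; exact: STE.
  apply: (translate_weakly_to0 _ loc2A loc1V c0 Vc admph) => w.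
  apply: contrapT => /forallNP Hw; apply: H; exists w => n0.
  have /existsNP[n /not_implyP[n0n /negP]] := Hw n0; rewrite negbK => /eqP dn.
  by exists n.
have [n ninc nz] := subseq_of_infinite Hz0; exists n; first exact: ninc.
have adm0 k : admissible A V (ph (n k)) (lattice z0) by rewrite -(nz k).
have /choice[a aE] : forall k, exists a, ph (n k) = fun x => ph (n 0%N) x + a.
  by move=> k; exact: (admissible_uniq (adm0 0%N) (adm0 k)).
have -> : (fun k => adjoint ip (S (n k)) (T (n k) (u (n k)))) =
    fun k => transl (fun x => ph (n 0%N) x + a k) (lattice z0) ((u \o n) k).
  by apply/funext => k; rewrite STE nz -aE.
exact: rotated_weakly_to0 (adm0 0%N) (weakly_to0_subseq ninc u0).
Qed.

End main.

Theorem proposition3p8 (R : realType) (N : nat) (hN : (2 <= N)%N)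
  (A : 'rV[R]_N -> 'rV[R]_N) (V : 'rV[R]_N -> R)
  (eps : R) (heps : 0 < eps)
  (hA : vector_potential eps A) (hV : scalar_potential V)
  (psi : 'rV[int]_N -> 'rV[R]_N -> R)
  (hpsi : forall y, gauge_function eps A y (psi y)) :
  dislocations (H1_ip A V) [set tau A V psi y | y in [set: 'rV[int]_N]].
Proof.
have [hA3 hA2 _] := hA; have [V1 Vper Vinf] := hV.
have loc2A i : loc2 (fun x => A x 0 i).
  have [N2|N2] := eqVneq N 2%N.
    by have [L _] := hA2 N2; apply: (Lp_loc_loc2 _ (L i)); rewrite lerDl ltW.
  have N3 : (2 < N)%N by rewrite ltn_neqAle eq_sym N2.
  have [L _ _] := hA3 N3; apply: (Lp_loc_loc2 _ (L i)).
  by rewrite (ler_nat R 2 N).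
have [c c0 Vc] : exists2 c : R, 0 < c & {ae @lebesgue_rV R N, forall x, c <= V x}.
  have [c c0 cinf] : exists2 c : R, 0 < c & (c%:E <= ess_inf (@lebesgue_rV R N) (EFin \o V))%E.
    case: (ess_inf _ _) Vinf => [r r0||//]; first by exists r.
    by exists 1 => //; rewrite leey.
  by exists c => //; move/ess_infP : cinf; apply: filterS => x; rewrite lee_fin.
have adm y : admissible A V (gauge_phase psi y) (lattice y).
  have [cpsi _ _ [g wg Ag]] := hpsi y; split => //.
    by apply: continuous_addf => //; exact: cst_continuous.
  by exists g => // i; exact: weak_partialDcst.
have N0 : (0 < N)%N by exact: leq_trans hN.
exact: (translations_dislocations N0 loc2A V1 c0 Vc adm).
Qed.
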